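(* Let $\Gamma$ be a countable group, let $(X_0,\mu_0)$ be a diffuse standard probability space, and let $\Gamma\curvearrowright (X,\mu):=(X_0^\Gamma,\mu_0^\Gamma)$ be the Bernoulli action. If $\Gamma$ is exact and contains a nonamenable, non-properly proximal, wq-normal subgroup, then $\Gamma\curvearrowright (X,\mu)$ is $\{\mathbb T\}$-cocycle superrigid, i.e., any $1$-cocycle $w:\Gamma\times X\to\mathbb T$ is cohomologous to a group homomorphism $\Gamma\to\mathbb T$.
   Context: Proper proximality: for a countable group $\Lambda$, let $(R_tf)(s)=f(st)$ on $\ell^\infty(\Lambda)$ and $\mathbb S(\Lambda)=\{f\in\ell^\infty(\Lambda): f-R_tf\in c_0(\Lambda)\ \text{for all } t\in\Lambda\}$. The group $\Lambda$ is properly proximal if there is no left-$\Lambda$-invariant state on $\mathbb S(\Lambda)$. A subgroup $\Lambda\le\Gamma$ is wq-normal if for every intermediate subgroup $\Lambda\le K\subsetneq\Gamma$ there exists $g\in\Gamma\setminus K$ such that $gKg^{-1}\cap K$ is infinite. A $1$-cocycle is a measurable map $w:\Gamma\times X\to\mathbb T$ with $w(st,x)=w(s,tx)\,w(t,x)$ for all $s,t\in\Gamma$ and a.e. $x$. It is cohomologous to a homomorphism $\chi:\Gamma\to\mathbb T$ if there is a measurable $u:X\to\mathbb T$ with $w(t,x)=u(tx)\,\chi(t)\,u(x)^{-1}$ for all $t\in\Gamma$ and a.e. $x$. The Bernoulli action is the action of $\Gamma$ on $X_0^\Gamma$ by left shift of coordinates. A group is exact if its reduced C$^*$-algebra is exact.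 *)

(* Defs.v *)
From HB Require Import structures.
From mathcomp Require Import all_boot all_order all_algebra finmap.
From mathcomp Require Import all_classical all_reals all_analysis.
From mathcomp Require Import complex ring lra.

Set Implicit Arguments.
Unset Strict Implicit.
Unset Printing Implicit Defensive.

Import Order.TTheory GRing.Theory Num.Theory.
Import numFieldNormedType.Exports.

Local Open Scope classical_set_scope.
Local Open Scope ring_scope.
Local Open Scope complex_scope.

(* The modulus of a complex number, as an element of R. *)
Local Notation normc := (@Normc.normc _).

Definition ipnorm (R : realType) (H : Type) (ip : H -> H -> R[i]) (u : H) : R :=
  Num.sqrt (complex.Re (ip u u)).

(* Complex Hilbert spaces; the inner product is linear in its first argument. *)
HB.mixin Record Lmodule_isHilbert (R : realType) H of GRing.Lmodule R[i] H := {
  inner : H -> H -> R[i];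
  inner_linearl : forall (a : R[i]) (u v w : H),
    inner (a *: u + v) w = a * inner u w + inner v w;
  inner_conj : forall u v : H, inner u v = (inner v u)^*;
  inner_ge0 : forall u : H, 0 <= inner u u;
  inner_eq0 : forall u : H, inner u u = 0 -> u = 0;
  inner_complete : forall u : nat -> H,
    (forall e : R, 0 < e -> exists N : nat, forall m n : nat,
      (N <= m)%N -> (N <= n)%N -> ipnorm inner (u m - u n) < e) ->
    exists l : H, forall e : R, 0 < e -> exists N : nat, forall n : nat,
      (N <= n)%N -> ipnorm inner (u n - l) < e
}.

#[short(type="hilbertType")]
HB.structure Definition Hilbert (R : realType) :=
  { H of GRing.Lmodule R[i] H & Lmodule_isHilbert R H }.

Definition hnorm (R : realType) (H : hilbertType R) (u : H) : R :=
  ipnorm (@inner R H) u.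

Section unordered_sum.
Variables (R : realType) (I : choiceType).
Implicit Types (f g : I -> R[i]) (l : R[i]).

(* Unordered summation: the finite partial sums converge to l along the
   directed set of finite subsets of I. *)
Definition is_usum f l := forall e : R, 0 < e ->
  exists F : {fset I}, forall F' : {fset I}, (F `<=` F')%fset ->
    normc (l - \sum_(i <- F') f i) < e.

Definition usum f : R[i] := xget 0 [set l | is_usum f l].

Definition sqsummable : pred (I -> R[i]) := fun f =>
  `[< exists M : R, forall F : {fset I}, \sum_(i <- F) normc (f i) ^+ 2 <= M >].

Lemma normc_sq (z : R[i]) :
  normc z ^+ 2 = complex.Re z ^+ 2 + complex.Im z ^+ 2.
Proof.
by case: z => a b /=; rewrite sqr_sqrtr // addr_ge0 // sqr_ge0.
Qed.

Lemma normc_ge0 (z : R[i]) : 0 <= normc z.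
Proof. by case: z => a b /=; exact: sqrtr_ge0. Qed.

Lemma normcZ (z : R[i]) (a : R) : normc (a%:C * z) = `|a| * normc z.
Proof. by rewrite Normc.normcM /= expr0n addr0 sqrtr_sqr. Qed.

Lemma normcR (a : R) : normc a%:C = `|a|.
Proof. by rewrite /= expr0n addr0 sqrtr_sqr. Qed.

Lemma normcJ (z : R[i]) : normc z^* = normc z.
Proof. by case: z => a b /=; rewrite sqrrN. Qed.

Lemma normcDle (z w : R[i]) : normc (z + w) <= normc z + normc w.
Proof. exact: le_normcD. Qed.

Lemma normcNE (z : R[i]) : normc (- z) = normc z.
Proof. by case: z => a b /=; rewrite !sqrrN. Qed.

Lemma is_usum_uniq f l l' : is_usum f l -> is_usum f l' -> l = l'.
Proof.
move=> h h'; apply/eqP; rewrite -subr_eq0; apply/eqP/Normc.eq0_normc/eqP.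
rewrite eq_le normc_ge0 andbT; apply/ler_addgt0Pr => e e0; rewrite add0r.
have e2 : 0 < e / 2 by rewrite divr_gt0.
have [F hF] := h _ e2; have [F' hF'] := h' _ e2.
pose s := \sum_(i <- (F `|` F')%fset) f i.
have -> : l - l' = (l - s) + - (l' - s) by ring.
apply: (le_trans (normcDle _ _)); rewrite normcNE (splitr e) ltW // ltrD //.
  by apply: hF; rewrite fsubsetUl.
by apply: hF'; rewrite fsubsetUr.
Qed.

Lemma usumE f l : is_usum f l -> usum f = l.
Proof.
move=> h; apply: (@is_usum_uniq f) => //.
by apply: (@xgetPex _ 0 [set l | is_usum f l]); exists l.
Qed.

Lemma is_usumD f g l l' : is_usum f l -> is_usum g l' ->
  is_usum (fun i => f i + g i) (l + l').
Proof.
move=> h h' e e0.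
have e2 : 0 < e / 2 by rewrite divr_gt0.
have [F hF] := h _ e2; have [F' hF'] := h' _ e2.
exists (F `|` F')%fset => G; rewrite fsubUset => /andP[FG F'G].
rewrite big_split /=.
set a := \sum_(i <- G) f i; set b := \sum_(i <- G) g i.
have -> : l + l' - (a + b) = (l - a) + (l' - b) by ring.
apply: (le_lt_trans (normcDle _ _)); rewrite (splitr e) ltrD //.
  exact: hF.
exact: hF'.
Qed.

Lemma is_usumZ f l (a : R[i]) : is_usum f l ->
  is_usum (fun i => a * f i) (a * l).
Proof.
move=> h e e0.
have n0 : 0 < normc a + 1 by rewrite ltr_wpDl // normc_ge0.
have [F hF] := h _ (divr_gt0 e0 n0).
exists F => G FG; rewrite -mulr_sumr -mulrBr Normc.normcM.
apply: (@le_lt_trans _ _ ((normc a + 1) * normc (l - \sum_(i <- G) f i))).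
  by rewrite ler_wpM2r ?normc_ge0 // lerDl.
by rewrite mulrC -ltr_pdivlMr // hF.
Qed.

Lemma is_usumJ f l : is_usum f l -> is_usum (fun i => (f i)^*) l^*.
Proof.
move=> h e e0; have [F hF] := h _ e0; exists F => G FG.
by rewrite -rmorph_sum -rmorphB normcJ hF.
Qed.

Lemma fset_sum_le (g : I -> R) (F F' : {fset I}) : (forall i, 0 <= g i) ->
  (F `<=` F')%fset -> \sum_(i <- F) g i <= \sum_(i <- F') g i.
Proof.
move=> g0 FF'; rewrite [leRHS](bigID (mem F)) /=.
have -> : \sum_(i <- F' | i \in F) g i = \sum_(i <- F) g i.
  rewrite -big_filter; apply: perm_big; apply: uniq_perm.
  - by rewrite filter_uniq // fset_uniq.
  - exact: fset_uniq.
  - move=> i; rewrite mem_filter; apply/andP/idP => [[] //|iF]; split=> //.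
    exact: (fsubsetP FF').
by rewrite lerDl sumr_ge0.
Qed.

Lemma is_usum_nonneg (g : I -> R) (M : R) : (forall i, 0 <= g i) ->
  (forall F : {fset I}, \sum_(i <- F) g i <= M) ->
  exists s : R, [/\ is_usum (fun i => (g i)%:C) s%:C, s <= M &
    forall F : {fset I}, \sum_(i <- F) g i <= s].
Proof.
move=> g0 gM; pose E := [set x | exists F : {fset I}, x = \sum_(i <- F) g i].
have E0 : E !=set0 by exists 0, fset0; rewrite big_seq_fset0.
have EM : ubound E M by move=> _ [F ->].
have Es : has_sup E by split=> //; exists M.
have ub (F : {fset I}) : \sum_(i <- F) g i <= sup E.
  by apply: (ub_le_sup (proj2 Es)); exists F.
exists (sup E); split=> //; last exact: ge_sup.
move=> e e0; have [_ [F ->] hF] := sup_adherent e0 Es.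
exists F => G FG; rewrite -rmorph_sum -rmorphB normcR ger0_norm ?subr_ge0 //.
rewrite ltrBlDr -ltrBlDl (lt_le_trans hF) //; exact: fset_sum_le.
Qed.

Lemma is_usum_abs f (M : R) :
  (forall F : {fset I}, \sum_(i <- F) normc (f i) <= M) ->
  exists l, is_usum f l.
Proof.
move=> fM.
have part (g : I -> R) : (forall i, 0 <= g i) -> (forall i, g i <= normc (f i)) ->
    exists s : R, is_usum (fun i => (g i)%:C) s%:C.
  move=> g0 gf; have [|s [hs _ _]] := @is_usum_nonneg g M g0; last by exists s.
  by move=> F; apply: le_trans (fM F); exact: ler_sum.
have Rle (z : R[i]) : `|complex.Re z| <= normc z.
  by rewrite -(@ler_pXn2r _ 2) ?nnegrE ?normc_ge0 // normc_sq real_normK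
    ?num_real // lerDl sqr_ge0.
have Ile (z : R[i]) : `|complex.Im z| <= normc z.
  by rewrite -(@ler_pXn2r _ 2) ?nnegrE ?normc_ge0 // normc_sq real_normK
    ?num_real // lerDr sqr_ge0.
have real (h : I -> R) : (forall i, `|h i| <= normc (f i)) ->
    exists s : R, is_usum (fun i => (h i)%:C) s%:C.
  move=> hf.
  have [i|i|p hp] := part (fun i => (`|h i| + h i) / 2).
  - by have := ler_norm (- h i); rewrite normrN; lra.
  - by have := ler_norm (h i); have := hf i; lra.
  have [i|i|q hq] := part (fun i => (`|h i| - h i) / 2).
  - by have := ler_norm (h i); lra.
  - by have := ler_norm (- h i); rewrite normrN; have := hf i; lra.
  exists (p - q).
  have -> : (fun i => (h i)%:C) =
      fun i => ((`|h i| + h i) / 2)%:C + (- 1) * ((`|h i| - h i) / 2)%:C.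
    apply/funext => i; rewrite mulN1r -rmorphB /=; congr (_ %:C); lra.
  have -> : (p - q)%:C = p%:C + (- 1) * q%:C by rewrite mulN1r -rmorphB.
  by apply: is_usumD => //; exact: is_usumZ.
have [r hr] := real (fun i => complex.Re (f i)) (fun i => Rle (f i)).
have [s hs] := real (fun i => complex.Im (f i)) (fun i => Ile (f i)).
exists (r%:C + 'i%C * s%:C).
have -> : f = fun i => (complex.Re (f i))%:C + 'i%C * (complex.Im (f i))%:C.
  by apply/funext => i; exact: complexE.
by apply: is_usumD => //; exact: is_usumZ.
Qed.

Lemma sqsummableP f : reflect (exists M : R, forall F : {fset I},
  \sum_(i <- F) normc (f i) ^+ 2 <= M) (f \in sqsummable).
Proof. exact: asboolP. Qed.

Lemma sqsummable_submod : submod_closed sqsummable.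
Proof.
split.
  by apply/sqsummableP; exists 0 => F; rewrite big1 // => i _;
    rewrite Normc.normc0 expr0n.
move=> a f g /sqsummableP[M hM] /sqsummableP[N hN]; apply/sqsummableP.
exists (2 * normc a ^+ 2 * M + 2 * N) => F.
apply: (@le_trans _ _
  (\sum_(i <- F) (2 * normc a ^+ 2 * normc (f i) ^+ 2 + 2 * normc (g i) ^+ 2))).
  apply: ler_sum => i _.
  apply: (@le_trans _ _ ((normc a * normc (f i) + normc (g i)) ^+ 2)).
    rewrite ler_pXn2r ?nnegrE ?normc_ge0 ?addr_ge0 ?mulr_ge0 ?normc_ge0 //.
    by rewrite -Normc.normcM; exact: normcDle.
  have := sqr_ge0 (normc a * normc (f i) - normc (g i)).
  set x := normc a; set y := normc (f i); set z := normc (g i); nra.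
rewrite big_split /= -!mulr_sumr.
apply: lerD; apply: ler_wpM2l => //; by rewrite mulr_ge0 ?sqr_ge0.
Qed.

Lemma is_usum_inner f g : f \in sqsummable -> g \in sqsummable ->
  is_usum (fun i => f i * (g i)^*) (usum (fun i => f i * (g i)^*)).
Proof.
move=> /sqsummableP[M hM] /sqsummableP[N hN].
have [|l hl] := @is_usum_abs (fun i => f i * (g i)^*) (M + N).
  move=> F; apply: (@le_trans _ _
    (\sum_(i <- F) (normc (f i) ^+ 2 + normc (g i) ^+ 2))).
    apply: ler_sum => i _; rewrite Normc.normcM normcJ.
    have := sqr_ge0 (normc (f i) - normc (g i)).
    have := normc_ge0 (f i); have := normc_ge0 (g i).
    set y := normc (f i); set z := normc (g i); nra.
  by rewrite big_split /= lerD.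
by rewrite (usumE hl).
Qed.

End unordered_sum.

Record l2 (R : realType) (I : choiceType) :=
  L2 { l2_fun :> I -> R[i]; _ : l2_fun \in @sqsummable R I }.

Section l2.
Variables (R : realType) (I : choiceType).

HB.instance Definition _ := [isSub for @l2_fun R I].
HB.instance Definition _ := [Choice of l2 R I by <:].
HB.instance Definition _ := GRing.SubChoice_isSubLmodule.Build R[i]
  (I -> R[i]) (@sqsummable R I) (l2 R I) (@sqsummable_submod R I).

Implicit Types u v w : l2 R I.

Definition l2_inner u v : R[i] := usum (fun i => u i * (v i)^*).

Lemma l2_is_usum u v : is_usum (fun i => u i * (v i)^*) (l2_inner u v).
Proof. exact: is_usum_inner (valP u) (valP v). Qed.

Lemma l2_innerl (a : R[i]) u v w :
  l2_inner (a *: u + v) w = a * l2_inner u w + l2_inner v w.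
Proof.
apply: usumE.
have -> : (fun i => (a *: u + v) i * (w i)^*) =
    fun i => a * (u i * (w i)^*) + v i * (w i)^*.
  by apply/funext => i; rewrite mulrA -mulrDl.
by apply: is_usumD; [apply: is_usumZ|]; exact: l2_is_usum.
Qed.

Lemma l2_innerC u v : l2_inner u v = (l2_inner v u)^*.
Proof.
apply: usumE.
have -> : (fun i => u i * (v i)^*) = fun i => (v i * (u i)^*)^*.
  apply/funext => i; case: (u i) (v i) => [a b] [c d]; apply/eqP.
  by rewrite eq_complex /=; apply/andP; split; apply/eqP; ring.
by apply: is_usumJ; exact: l2_is_usum.
Qed.

Lemma l2_inner_real u : exists s : R, [/\ l2_inner u u = s%:C,
  forall F : {fset I}, \sum_(i <- F) normc (u i) ^+ 2 <= s &
  forall M : R, (forall F : {fset I}, \sum_(i <- F) normc (u i) ^+ 2 <= M) ->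
    s <= M].
Proof.
have sq : (fun i => u i * (u i)^*) = fun i => (normc (u i) ^+ 2)%:C.
  by apply/funext => i; case: (u i) => a b; apply/eqP;
    rewrite eq_complex normc_sq /=; apply/andP; split; apply/eqP; ring.
have /sqsummableP[N hN] := valP u.
have g0 i : 0 <= normc (u i) ^+ 2 by exact: sqr_ge0.
have [s [hs _ sF]] := is_usum_nonneg g0 hN.
exists s; split=> //; first by apply: usumE; rewrite sq.
move=> M hM.
have [t [ht tM _]] := is_usum_nonneg g0 hM.
by have [->] := is_usum_uniq hs ht.
Qed.

Lemma l2_inner_ge0 u : 0 <= l2_inner u u.
Proof.
have [s [-> sF _]] := l2_inner_real u.
by rewrite ler0c; have := sF fset0; rewrite big_seq_fset0.
Qed.

Lemma l2_normP u (e : R) : 0 <= e -> ipnorm l2_inner u <= e <->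
  forall F : {fset I}, \sum_(i <- F) normc (u i) ^+ 2 <= e ^+ 2.
Proof.
move=> e0; have [s [us sF sM]] := l2_inner_real u; rewrite /ipnorm us /=.
have s0 : 0 <= s by have := sF fset0; rewrite big_seq_fset0.
rewrite -(@ler_pXn2r _ 2) ?nnegrE ?sqrtr_ge0 // sqr_sqrtr //; split=> [h F|].
  exact: le_trans (sF F) h.
exact: sM.
Qed.

Lemma l2_coord_le u i : normc (u i) <= ipnorm l2_inner u.
Proof.
rewrite -(@ler_pXn2r _ 2) ?nnegrE ?normc_ge0 ?sqrtr_ge0 //.
have /l2_normP : ipnorm l2_inner u <= ipnorm l2_inner u by [].
by move=> /(_ (sqrtr_ge0 _) [fset i]%fset); rewrite big_seq_fset1.
Qed.

Lemma l2_inner_eq0 u : l2_inner u u = 0 -> u = 0.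
Proof.
move=> u0; apply/val_inj/funext => i; apply: Normc.eq0_normc; apply/eqP.
rewrite eq_le normc_ge0 andbT (le_trans (l2_coord_le u i)) //.
by rewrite /ipnorm u0 /= sqrtr0.
Qed.

Lemma l2_complete (u : nat -> l2 R I) :
  (forall e : R, 0 < e -> exists N : nat, forall m n : nat,
    (N <= m)%N -> (N <= n)%N -> ipnorm l2_inner (u m - u n) < e) ->
  exists l : l2 R I, forall e : R, 0 < e -> exists N : nat, forall n : nat,
    (N <= n)%N -> ipnorm l2_inner (u n - l) < e.
Proof.
move=> uC.
have cvgc (p : R[i] -> R) : (forall x y, p (x - y) = p x - p y) ->
    (forall z, `|p z| <= normc z) ->
    forall i, cvg ((fun n => p (u n i)) @ \oo).
  move=> pB pn i; apply: cauchy_cvg; apply: cauchy_exP => e e0.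
  have [N hN] := uC _ e0; exists (p (u N i)), N => // n /= Nn.
  rewrite /ball /= -pB (le_lt_trans (pn _)) //.
  exact: le_lt_trans (l2_coord_le (u N - u n) i) (hN _ _ _ _).
have cR := cvgc (@complex.Re R) _ _; have cI := cvgc (@complex.Im R) _ _.
have {}cR i : cvg ((fun n => complex.Re (u n i)) @ \oo).
  apply: cR => [[? ?] [? ?] //|z].
  by rewrite -(@ler_pXn2r _ 2) ?nnegrE ?normc_ge0 // normc_sq real_normK
    ?num_real // lerDl sqr_ge0.
have {}cI i : cvg ((fun n => complex.Im (u n i)) @ \oo).
  apply: cI => [[? ?] [? ?] //|z].
  by rewrite -(@ler_pXn2r _ 2) ?nnegrE ?normc_ge0 // normc_sq real_normK
    ?num_real // lerDr sqr_ge0.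
pose l i := lim ((fun n => complex.Re (u n i)) @ \oo) +i*
            lim ((fun n => complex.Im (u n i)) @ \oo).
have key (e : R) : 0 < e -> exists N : nat, forall n : nat, (N <= n)%N ->
    forall F : {fset I}, \sum_(i <- F) normc (u n i - l i) ^+ 2 <= e ^+ 2.
  move=> e0; have [N hN] := uC _ e0; exists N => n Nn F.
  have cv : (fun m => \sum_(i <- F) normc (u n i - u m i) ^+ 2) @ \oo -->
      \sum_(i <- F) normc (u n i - l i) ^+ 2.
    apply: cvg_big => [|i _]; first exact: add_continuous.
    rewrite normc_sq.
    have -> : (fun m => normc (u n i - u m i) ^+ 2) = fun m =>
        (complex.Re (u n i) - complex.Re (u m i)) ^+ 2 +
        (complex.Im (u n i) - complex.Im (u m i)) ^+ 2.
      apply/funext => m; rewrite normc_sq.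
      by case: (u n i) (u m i) => [? ?] [? ?].
    have -> : complex.Re (u n i - l i) =
        complex.Re (u n i) - lim ((fun n => complex.Re (u n i)) @ \oo).
      by rewrite /l; case: (u n i).
    have -> : complex.Im (u n i - l i) =
        complex.Im (u n i) - lim ((fun n => complex.Im (u n i)) @ \oo).
      by rewrite /l; case: (u n i).
    rewrite !expr2.
    by apply: cvgD; apply: cvgM; apply: cvgB => //; exact: cvg_cst.
  have <- := cvg_lim (@Rhausdorff _) cv.
  apply: limr_le; first by apply/cvg_ex; eexists; exact: cv.
  exists N => // m /= Nm.
  have /l2_normP : ipnorm l2_inner (u n - u m) <= e by exact/ltW/hN.
  by move=> /(_ (ltW e0)); exact.
have lsq : l \in @sqsummable R I.
  have [N hN] := key 1 ltr01.
  have -> : l = (u N : I -> R[i]) - ((u N : I -> R[i]) - l).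
    by apply/funext => i; rewrite /= subKr.
  have [S0 SL] := @sqsummable_submod R I.
  have h : (u N : I -> R[i]) - l \in @sqsummable R I.
    by apply/sqsummableP; exists (1 ^+ 2) => F; exact: hN.
  by have := SL (-1) _ _ h (valP (u N)); rewrite scaleN1r addrC.
exists (L2 lsq) => e e0.
have e2 : 0 < e / 2 by rewrite divr_gt0.
have [N hN] := key _ e2; exists N => n Nn.
apply: (@le_lt_trans _ _ (e / 2)); last by lra.
by apply/l2_normP; [exact: ltW | exact: hN].
Qed.

HB.instance Definition _ := Lmodule_isHilbert.Build R (l2 R I)
  l2_innerl l2_innerC l2_inner_ge0 l2_inner_eq0 l2_complete.

End l2.

Section operators.
Variable R : realType.
Implicit Types H K : hilbertType R.

Definition opnorm_le H K (a : H -> K) (c : R) : Prop :=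
  0 <= c /\ forall u : H, hnorm (a u) <= c * hnorm u.

Definition bounded_op H : set (H -> H) :=
  [set a | linear a /\ exists c : R, opnorm_le a c].

Definition adjoint H (a b : H -> H) : Prop :=
  forall u v : H, inner (a u) v = inner u (b v).

(* Positivity of an n x n matrix of operators, acting on the n-fold direct sum
   of H. *)
Definition mx_op_ge0 H (n : nat) (a : 'I_n -> 'I_n -> (H -> H)) : Prop :=
  forall u : 'I_n -> H, 0 <= \sum_(i < n) \sum_(j < n) inner (a i j (u j)) (u i).

Definition op_linear H K (A : set (H -> H)) (phi : (H -> H) -> (K -> K)) : Prop :=
  forall (c : R[i]) (a b : H -> H), A a -> A b ->
    phi (c *: a + b) = c *: phi a + phi b.

(* Contractive completely positive maps from A to B, for C*-algebras
   A of operators on H and B of operators on K; the values of phi outside A are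
   irrelevant. *)
Definition ccp_map H K (A : set (H -> H)) (B : set (K -> K))
    (phi : (H -> H) -> (K -> K)) : Prop :=
  [/\ forall a, A a -> B (phi a),
      op_linear A phi,
      forall (n : nat) (a : 'I_n -> 'I_n -> (H -> H)), (forall i j, A (a i j)) ->
        mx_op_ge0 a -> mx_op_ge0 (fun i j => phi (a i j))
    & forall (a : H -> H) (c : R), A a -> opnorm_le a c -> opnorm_le (phi a) c].

(* M_k(C), as the algebra of all operators on the k-dimensional Hilbert space *)
Definition mx_alg (k : nat) : set (l2 R 'I_k -> l2 R 'I_k) :=
  @bounded_op (l2 R 'I_k).

(* theta : A -> B(K) is nuclear: a point-norm limit of maps which factor through
   matrix algebras by contractive completely positive maps. *)
Definition nuclear_map H K (A : set (H -> H)) (theta : (H -> H) -> (K -> K)) :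
    Prop :=
  forall (F : set (H -> H)) (e : R), finite_set F -> F `<=` A -> 0 < e ->
  exists (k : nat) (phi : (H -> H) -> (l2 R 'I_k -> l2 R 'I_k))
    (psi : (l2 R 'I_k -> l2 R 'I_k) -> (K -> K)),
    [/\ ccp_map A (@mx_alg k) phi, ccp_map (@mx_alg k) (@bounded_op K) psi
      & forall a, F a -> opnorm_le (psi (phi a) - theta a) e].

Definition faithful_rep H K (A : set (H -> H)) (pi : (H -> H) -> (K -> K)) :
    Prop :=
  [/\ forall a, A a -> bounded_op (pi a),
      op_linear A pi,
      forall a b, A a -> A b -> pi (a \o b) = pi a \o pi b,
      forall a b, A a -> A b -> adjoint a b -> adjoint (pi a) (pi b)
    & forall a b, A a -> A b -> pi a = pi b -> a = b].

(* Exactness of a C*-algebra A of operators on H, in the sense of Brown and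
   Ozawa, "C*-algebras and finite-dimensional approximations", Def. 2.3.2. *)
Definition exact_cstar H (A : set (H -> H)) : Prop :=
  exists (K : hilbertType R) (pi : (H -> H) -> (K -> K)),
    faithful_rep A pi /\ nuclear_map A pi.

End operators.

Section group.
Variables (R : realType) (G : groupType).

Lemma lreg_sqsummable (s : G) (f : l2 R G) :
  (fun t : G => f (s^-1 * t)%g) \in @sqsummable R G.
Proof.
have /sqsummableP[M hM] := valP f; apply/sqsummableP; exists M => F.
have := hM [fset (s^-1 * t)%g | t in F]%fset.
by rewrite big_imfset //= => x y _ _; exact: mulgI.
Qed.

Definition lreg (s : G) (f : l2 R G) : l2 R G := L2 (lreg_sqsummable s f).

(* The reduced C*-algebra: the norm closure in B(l2(G)) of the linear span of
   the left regular representation. *)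
Definition reduced_cstar : set (l2 R G -> l2 R G) :=
  [set a | @bounded_op R (l2 R G) a /\
    forall e : R, 0 < e -> exists (F : {fset G}) (c : G -> R[i]),
      @opnorm_le R (l2 R G) (l2 R G) (a - \sum_(s <- F) c s *: lreg s) e].

Definition exact_group : Prop := @exact_cstar R (l2 R G) reduced_cstar.

Definition linf : set (G -> R[i]) :=
  [set f | exists M : R, forall s, normc (f s) <= M].

Definition c0 : set (G -> R[i]) :=
  [set f | forall e : R, 0 < e -> finite_set [set s | e <= normc (f s)]].

Definition ltrans (t : G) (f : G -> R[i]) : G -> R[i] := fun s => f (t^-1 * s)%g.

Definition rtrans (t : G) (f : G -> R[i]) : G -> R[i] := fun s => f (s * t)%g.

Definition small_at_infinity : set (G -> R[i]) :=
  [set f | linf f /\ forall t : G, c0 (f - rtrans t f)].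

(* States on a unital, left translation invariant space V of bounded functions;
   the values of phi outside V are irrelevant. *)
Definition state (V : set (G -> R[i])) (phi : (G -> R[i]) -> R[i]) : Prop :=
  [/\ forall (a : R[i]) (f g : G -> R[i]), V f -> V g ->
        phi (a *: f + g) = a * phi f + phi g,
      forall f, V f -> (forall s, 0 <= f s) -> 0 <= phi f
    & phi (fun=> 1) = 1].

Definition left_invariant_state (V : set (G -> R[i]))
    (phi : (G -> R[i]) -> R[i]) : Prop :=
  state V phi /\ forall (t : G) (f : G -> R[i]), V f -> phi (ltrans t f) = phi f.

Definition amenable : Prop := exists phi, left_invariant_state linf phi.

Definition properly_proximal : Prop :=
  ~ exists phi, left_invariant_state small_at_infinity phi.

Definition wq_normal (S : {pred G}) : Prop :=
  forall K : {pred G}, group_closed K -> {subset S <= K} ->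
    (exists g, g \notin K) ->
    exists2 g, g \notin K &
      infinite_set ([set (g * k * g^-1)%g | k in [set` K]] `&` [set` K]).

End group.

Section measure.
Variable R : realType.

Definition standard_borel d (T : measurableType d) : Prop :=
  exists dist : T -> T -> R,
  [/\ (forall x y, dist x y = 0 <-> x = y) /\
      (forall x y, dist x y = dist y x) /\
      (forall x y z, dist x z <= dist x y + dist y z),
      forall u : nat -> T,
        (forall e : R, 0 < e -> exists N : nat, forall m n : nat,
          (N <= m)%N -> (N <= n)%N -> dist (u m) (u n) < e) ->
        exists l : T, forall e : R, 0 < e -> exists N : nat, forall n : nat,
          (N <= n)%N -> dist (u n) l < e,
      exists2 D : set T, countable D &
        forall (x : T) (e : R), 0 < e -> exists2 y, D y & dist x y < e
    & (@measurable d T : set (set T)) =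
        <<s [set U : set T | forall x, U x -> exists2 e : R, 0 < e &
               [set y | dist x y < e] `<=` U] >>].

Definition diffuse d (T : measurableType d) (mu : probability T R) : Prop :=
  forall x : T, mu [set x] = 0%E.

(* Measurability for the Borel sigma-algebra of C = R^2 *)
Definition cmeasurable d (T : measurableType d) (f : T -> R[i]) : Prop :=
  measurable_fun setT (fun x => complex.Re (f x)) /\
  measurable_fun setT (fun x => complex.Im (f x)).

Definition circle : set R[i] := [set z | normc z = 1].

End measure.

(* An alias of G carrying the sigma-algebra of all subsets, so that a cocycle can
   be required to be jointly measurable on G x X. *)
Definition discrete_group (G : groupType) : Type := G.

HB.instance Definition _ (G : groupType) := Group.on (discrete_group G).
HB.instance Definition _ (G : groupType) :=
  isPointed.Build (discrete_group G) (1%g : G).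
HB.instance Definition _ (G : groupType) :=
  @isMeasurable.Build default_measure_display (discrete_group G)
    discrete_measurable discrete_measurable0
    discrete_measurableC discrete_measurableU.

Section cocycles.
Variables (R : realType) (G : groupType) (d : measure_display).
Variables (X : measurableType d) (act : G -> X -> X) (mu : probability X R).

Definition is_cocycle (w : G -> X -> R[i]) : Prop :=
  [/\ cmeasurable (fun p : discrete_group G * X => w p.1 p.2),
      forall t x, circle (w t x)
    & forall s t : G, {ae mu, forall x, w (s * t)%g x = w s (act t x) * w t x}].

Definition is_character (chi : G -> R[i]) : Prop :=
  (forall t, circle (chi t)) /\ forall s t, chi (s * t)%g = chi s * chi t.

Definition cohomologous (w : G -> X -> R[i]) (chi : G -> R[i]) : Prop :=
  exists u : X -> R[i], [/\ cmeasurable u, forall x, circle (u x)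
    & forall t : G, {ae mu, forall x, w t x = u (act t x) * chi t * (u x)^-1}].

Definition circle_cocycle_superrigid : Prop :=
  forall w, is_cocycle w -> exists2 chi, is_character chi & cohomologous w chi.

End cocycles.

Section bernoulli.
Variables (G : groupType) (d : measure_display) (X0 : measurableType d).

Definition cylinders : set (set (G -> X0)) :=
  [set C | exists (g : G) (A : set X0),
     measurable A /\ C = [set x : G -> X0 | A (x g)]].

Definition bernoulli_space := g_sigma_algebraType cylinders.

(* The infinite product measure is characterized by its values on
   finite-dimensional boxes; it exists and is unique. *)
Definition is_product_measure (R : realType) (mu0 : probability X0 R)
    (mu : probability bernoulli_space R) : Prop :=
  forall (F : {fset G}) (A : G -> set X0), (forall g, measurable (A g)) ->
    mu [set x : G -> X0 | forall g, g \in F -> A g (x g)] =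
    (\prod_(g <- F) mu0 (A g))%E.

Definition bernoulli_action (t : G) (x : bernoulli_space) : bernoulli_space :=
  fun s : G => x (t^-1 * s)%g.

End bernoulli.

(* Main.v *)
(** Write [W_t(x) = w(t, t^-1 x)] and let [x^A] be obtained from [x] by replacing, by an
    independent copy [y], the coordinates whose independent label lies in [A]. For the
    nonamenable subgroup [L], either the functions [W_t], [t] in [L], are uniformly
    insensitive to the noise [x -> x^A] for [A] of small measure, or they are not.

    If they are not, the Efron-Stein decomposition of the unit vector [W_t] is the law of
    a random finite subset of [G], nonempty with probability bounded below along a coset.
    By the cocycle identity these laws are equivariant up to finite sets, so composing
    with an invariant state on the functions small at infinity yields an invariant mean
    on [L], against nonamenability.

    If they are, the vector of minimal norm in a closed convex invariant set of functions
    of [z = (v, (x, y))] ([v] the labels) shows that [W_t(x) / W_t(x^A)] is a coboundary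
    for [A] small. As the base is diffuse, it is a finite union of small sets, so
    [W_t(x) / W_t(y)] is a coboundary [f(z) / f(t^-1 z)]. By mixing, [f] splits as a
    product of a function [u] of [x] and a function of [(v, y)]; hence [w] twisted by [u]
    is constant on [L].

    The elements on which the twisted cocycle is constant form a subgroup [K]. If
    [g K g^-1] meets [K] in an infinite set then the twisted cocycle at [g] is multiplied
    by scalars under infinitely many elements, hence is constant by mixing; so [K = G] by
    wq-normality. *)

Require Import Defs.
From HB Require Import structures.
From mathcomp Require Import all_boot all_order all_algebra finmap.
From mathcomp Require Import all_classical all_reals all_analysis.
From mathcomp Require Import measurable_realfun.
From mathcomp Require Import complex ring lra zify.

Set Implicit Arguments.
Unset Strict Implicit.
Unset Printing Implicit Defensive.

Import Order.TTheory GRing.Theory Num.Theory.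
Import numFieldNormedType.Exports.

Local Open Scope classical_set_scope.
Local Open Scope ring_scope.

(** * Bounded measurable functions and expectations *)

(** The noise rate and the averaging weight are tied together, which is why the dichotomy concerns
    label sets of small measure. The mean on [L] averages a function over the random set with a
    weight [p] on [G]. This [p] vanishes at infinity: right translation alters the random set of
    [W_t] inside a translate [tF], negligible for all but finitely many [t], so the averages are
    small at infinity. It varies slowly under left translation by a given finite set. It is at most
    [dl] everywhere, so that exceptional sets whose size is known before [dl] carry little weight.
    Still the total weight of the random set must not degenerate: sensitivity to noise of rate [dl]
    forces points of that set into a window on which [p >= dl / 2].

    In the other case, the labels make the noise a deterministic measure preserving map that
    commutes with the diagonal action. Hence [W_t(x) / W_t(x^A)] is itself a cocycle, of an action
    that is still mixing, and its real part has mean at least 1/2; this keeps the vector of minimal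
    norm away from zero. *)

Section bfun.
Context (R : realType) d (T : measurableType d).

Definition bmeas : pred (T -> R) := fun (f : T -> R) =>
  `[< measurable_fun setT f /\ exists M : R, forall x, `|f x| <= M >].

Lemma bmeasP (f : T -> R) : reflect
  (measurable_fun setT f /\ exists M : R, forall x, `|f x| <= M) (f \in bmeas).
Proof. exact: asboolP. Qed.

Lemma bmeas_cst r : cst r \in bmeas.
Proof. by apply/bmeasP; split=> //; exists `|r|. Qed.

Lemma bmeasD f g : f \in bmeas -> g \in bmeas -> f \+ g \in bmeas.
Proof.
move=> /bmeasP[mf [M fM]] /bmeasP[mg [N gN]]; apply/bmeasP; split.
  exact: measurable_funD.
by exists (M + N) => x; rewrite (le_trans (ler_normD _ _)) // lerD.
Qed.

Lemma bmeasM f g : f \in bmeas -> g \in bmeas -> f \* g \in bmeas.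
Proof.
move=> /bmeasP[mf [M fM]] /bmeasP[mg [N gN]]; apply/bmeasP; split.
  exact: measurable_funM.
by exists (M * N) => x; rewrite normrM ler_pM.
Qed.

Lemma bmeas_subring : subring_closed bmeas.
Proof.
split=> [|f g fb gb|f g fb gb]; first exact: (bmeas_cst 1).
  have -> : f - g = f \+ (cst (-1) \* g).
    by apply/funext => x; rewrite /= mulN1r.
  by apply: bmeasD => //; apply: bmeasM => //; exact: bmeas_cst.
exact: bmeasM.
Qed.

(** Genuine functions, not classes modulo null sets: sections, compositions and partial integrals
    are again total functions, identities are settled by [ring], and every expectation is finite.
    The price is that inner products are only semidefinite. *)
Record bfun := BFun { bfun_fun :> T -> R; _ : bfun_fun \in bmeas }.

HB.instance Definition _ := [isSub for bfun_fun].
HB.instance Definition _ := [Choice of bfun by <:].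
HB.instance Definition _ := GRing.SubChoice_isSubComPzRing.Build
  (T -> R) bmeas bfun bmeas_subring.

Lemma bfun_eq (f g : bfun) : f =1 g -> f = g.
Proof. by move=> fg; apply: val_inj; apply/funext. Qed.

Definition bcst (r : R) : bfun := BFun (bmeas_cst r).

Lemma measurable_bfun (f : bfun) : measurable_fun setT f.
Proof. by have /bmeasP[] := valP f. Qed.

Lemma bfun_bounded (f : bfun) : exists2 M : R, 0 <= M & forall x, `|f x| <= M.
Proof.
have /bmeasP[_ [M fM]] := valP f; exists M => //.
exact: le_trans (fM point).
Qed.

Lemma bfunD (f g : bfun) x : (f + g) x = f x + g x. Proof. by []. Qed.
Lemma bfunB (f g : bfun) x : (f - g) x = f x - g x. Proof. by []. Qed.
Lemma bfunN (f : bfun) x : (- f) x = - f x. Proof. by []. Qed.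
Lemma bfunM (f g : bfun) x : (f * g) x = f x * g x. Proof. by []. Qed.
Lemma bfun0 x : (0 : bfun) x = 0. Proof. by []. Qed.
Lemma bfun1 x : (1 : bfun) x = 1. Proof. by []. Qed.

Definition bfunE := (bfunD, bfunN, bfunM, bfun0, bfun1).

End bfun.

Section bcomp.
Context (R : realType) d d' (T : measurableType d) (T' : measurableType d').

Lemma bcomp_subproof (h : T -> T') (mh : measurable_fun setT h)
  (f : bfun R T') : f \o h \in @bmeas R _ T.
Proof.
have /bmeasP[mf [M fM]] := valP f; apply/bmeasP; split.
  exact: measurableT_comp.
by exists M => x; exact: fM.
Qed.

Definition bcomp h (mh : measurable_fun setT h) f := BFun (bcomp_subproof mh f).

End bcomp.

Section bind.
Context (R : realType) d (T : measurableType d).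

Lemma bind_subproof (A : set T) : measurable A -> \1_A \in @bmeas R _ T.
Proof.
move=> mA; apply/bmeasP; split; first exact: measurable_indic.
by exists 1 => x; rewrite indicE; case: (_ \in _); rewrite ?normr1 ?normr0.
Qed.

Definition bind A (mA : measurable A) : bfun R T := BFun (bind_subproof mA).

Lemma bindE A (mA : measurable A) x : bind mA x = (x \in A)%:R.
Proof. by rewrite /bind /= indicE. Qed.

End bind.

Definition mpres (R : realType) d d' (T : measurableType d)
    (T' : measurableType d') (mu : probability T R) (nu : probability T' R)
    (h : T -> T') :=
  measurable_fun setT h /\ forall A, measurable A -> mu (h @^-1` A) = nu A.

Section expectation.
Context (R : realType) d (T : measurableType d) (mu : probability T R).
Implicit Types f g : bfun R T.

Lemma bfun_integrable f : mu.-integrable setT (EFin \o f).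
Proof.
have [M M0 fM] := bfun_bounded f.
have iM : mu.-integrable setT (EFin \o cst M) by exact: finite_measure_integrable_cst.
apply: le_integrable iM => //; first exact/measurable_EFinP/measurable_bfun.
by move=> x _ /=; rewrite lee_fin (ger0_norm M0).
Qed.

Definition Ex f : R := \int[mu]_x f x.

Lemma ExD f g : Ex (f + g) = Ex f + Ex g.
Proof. exact: (RintegralD measurableT (bfun_integrable f) (bfun_integrable g)). Qed.

Lemma ExB f g : Ex (f - g) = Ex f - Ex g.
Proof. exact: (RintegralB measurableT (bfun_integrable f) (bfun_integrable g)). Qed.

Lemma ExZ r f : Ex (bcst T r * f) = r * Ex f.
Proof. exact: (RintegralZl _ measurableT (bfun_integrable f)). Qed.

Lemma Ex_cst r : Ex (bcst T r) = r.
Proof.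
rewrite [LHS](Rintegral_cst mu measurableT r).
by have /= -> := probability_setT mu; rewrite mulr1.
Qed.

Lemma Ex_const f (c : R) : (forall x, f x = c) -> Ex f = c.
Proof. by move=> fc; rewrite -[RHS]Ex_cst; congr Ex; exact: bfun_eq. Qed.

Lemma Ex0 : Ex 0 = 0. Proof. by rewrite -(subrr 0) ExB subrr. Qed.

Lemma Ex1 : Ex 1 = 1.
Proof. by rewrite -[RHS](Ex_cst 1); congr Ex; exact: bfun_eq. Qed.

Lemma Ex_ge0 f : (forall x, 0 <= f x) -> 0 <= Ex f.
Proof. by move=> f0; exact: Rintegral_ge0. Qed.

Lemma Ex_le f g : (forall x, f x <= g x) -> Ex f <= Ex g.
Proof.
by move=> fg; rewrite -subr_ge0 -ExB Ex_ge0 // => x; rewrite bfunB subr_ge0.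
Qed.

Lemma Ex_norm_le f M : (forall x, `|f x| <= M) -> `|Ex f| <= M.
Proof.
move=> fM; rewrite ler_norml -(Ex_cst M); apply/andP; split.
  rewrite -sub0r -Ex0 -ExB; apply: Ex_le => x.
  by rewrite bfunB sub0r; have := fM x; rewrite ler_norml => /andP[].
by apply: Ex_le => x /=; rewrite (le_trans (ler_norm _)).
Qed.

Lemma Ex_sqr_le f : Ex f ^+ 2 <= Ex (f * f).
Proof.
have : 0 <= Ex ((f - bcst T (Ex f)) * (f - bcst T (Ex f))).
  by apply: Ex_ge0 => x; rewrite bfunM -expr2 sqr_ge0.
have -> : (f - bcst T (Ex f)) * (f - bcst T (Ex f)) =
  f * f - bcst T (2 * Ex f) * f + bcst T (Ex f ^+ 2).
  by apply: bfun_eq => x; rewrite !bfunE /=; ring.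
rewrite ExD ExB ExZ Ex_cst; lra.
Qed.

Lemma Ex_ind (A : set T) (mA : measurable A) : Ex (bind R mA) = fine (mu A).
Proof.
by rewrite /Ex /Rintegral /= integral_indic // setIT.
Qed.

Lemma Ex_eq0_ae f : (forall x, 0 <= f x) -> Ex f = 0 -> {ae mu, forall x, f x = 0}.
Proof.
move=> f0 Ef.
have mf : measurable_fun setT (EFin \o f) by exact/measurable_EFinP/measurable_bfun.
have int0 : (\int[mu]_x `|(EFin \o f) x| = 0)%E.
  rewrite (eq_integral (EFin \o f)); last by move=> x _; rewrite /= ger0_norm.
  have /fineK <- : (\int[mu]_x (f x)%:E)%E \is a fin_num.
    exact: integrable_fin_num (bfun_integrable f).
  by congr (_ %:E); exact: Ef.
have /(_ int0) := proj1 (@ae_eq_integral_abs _ _ _ mu setT measurableT _ mf).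
by apply: filterS => x /= /(_ I) [].
Qed.

Lemma ae_Ex_eq f g : {ae mu, forall x, f x = g x} -> Ex f = Ex g.
Proof.
move=> fg; congr fine; apply: ae_eq_integral => //.
- exact/measurable_EFinP/measurable_bfun.
- exact/measurable_EFinP/measurable_bfun.
- by apply: filterS fg => x /= -> .
Qed.

Lemma ae_exists (P : T -> Prop) : {ae mu, forall x, P x} -> exists x, P x.
Proof.
move=> [N [mN N0 PN]]; apply/not_existsP => nP.
have NT : N = setT.
  by apply/seteqP; split=> // x _; apply: PN => /= /nP.
by move: N0; rewrite NT probability_setT => /eqP; rewrite onee_eq0.
Qed.

Lemma Ex_eq0_point f : (forall x, 0 <= f x) -> Ex f = 0 -> exists x, f x = 0.
Proof. by move=> f0 /(Ex_eq0_ae f0)/ae_exists. Qed.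

End expectation.

Section mpres.
Context (R : realType) d d' (T : measurableType d) (T' : measurableType d').
Variables (mu : probability T R) (nu : probability T' R).

Lemma Ex_comp (h : T -> T') (hp : mpres mu nu h) (f : bfun R T') :
  Ex mu (bcomp hp.1 f) = Ex nu f.
Proof.
have [mh muh] := hp.
rewrite /Ex /Rintegral /=; congr fine.
have -> : (\int[nu]_x (f x)%:E = \int[pushforward mu h]_x (f x)%:E)%E.
  by apply: eq_measure_integral => A mA _; first [exact: muh | exact/esym/muh].
rewrite (integral_pushforward mh) //=.
- exact/measurable_EFinP/measurable_bfun.
- exact: (bfun_integrable mu (bcomp mh f)).
Qed.

Lemma ae_comp (h : T -> T') (P : T' -> Prop) : mpres mu nu h ->
  {ae nu, forall x, P x} -> {ae mu, forall x, P (h x)}.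
Proof.
move=> [mh muh] [N [mN N0 PN]]; exists (h @^-1` N); split.
- by rewrite -[X in measurable X]setTI; exact: mh.
- by rewrite muh.
- by move=> x /= /PN.
Qed.

End mpres.

Section fubini_bfun.
Context (R : realType) d d' (T : measurableType d) (T' : measurableType d').
Variables (mu : probability T R) (nu : probability T' R).
Implicit Types f : bfun R (T * T')%type.

Definition bsec1 f (x : T) : bfun R T' := bcomp (pair1_measurable x) f.
Definition bsec2 f (y : T') : bfun R T := bcomp (pair2_measurable y) f.

Lemma bint2_subproof f : (fun x => Ex nu (bsec1 f x)) \in @bmeas R _ T.
Proof.
have [M M0 fM] := bfun_bounded f; apply/bmeasP; split; last first.
  by exists M => x; apply: Ex_norm_le => y; exact: fM.
apply: measurableT_comp; first exact: fine_measurable.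
exact: measurable_fubini_F (bfun_integrable (mu \x nu)%E f).
Qed.

Lemma bint1_subproof f : (fun y => Ex mu (bsec2 f y)) \in @bmeas R _ T'.
Proof.
have [M M0 fM] := bfun_bounded f; apply/bmeasP; split; last first.
  by exists M => x; apply: Ex_norm_le => y; exact: fM.
apply: measurableT_comp; first exact: fine_measurable.
exact: measurable_fubini_G (bfun_integrable (mu \x nu)%E f).
Qed.

Definition bint2 f : bfun R T := BFun (bint2_subproof f).
Definition bint1 f : bfun R T' := BFun (bint1_subproof f).

Lemma Ex_bint2 f : Ex (mu \x nu)%E f = Ex mu (bint2 f).
Proof.
congr fine; rewrite -integral12_prod_meas1; last exact: bfun_integrable.
apply: eq_integral => x _; rewrite /fubini_F /= fineK //.
exact: integrable_fin_num (bfun_integrable nu (bsec1 f x)).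
Qed.

Lemma Ex_bint1 f : Ex (mu \x nu)%E f = Ex nu (bint1 f).
Proof.
congr fine; rewrite -integral21_prod_meas1; last exact: bfun_integrable.
apply: eq_integral => x _; rewrite /fubini_G /= fineK //.
exact: integrable_fin_num (bfun_integrable mu (bsec2 f x)).
Qed.

End fubini_bfun.

(** * The law of a random finite set *)

Section law.
Context (R : realType) (I : eqType) (V : zmodType).
Context (ip : V -> V -> R) (P : I -> V -> V).
Implicit Types (f h : V) (E F T : seq I) (u : seq I -> R).

(** [ip] need not be definite. As [V] is a mere additive group, vectors cannot be rescaled, so
    Cauchy-Schwarz is assumed in the form [ip_amgm] with a free weight [l]; this also avoids square
    roots. *)
Record resampling : Prop := Resampling {
  ip_subl : forall f f' h, ip (f - f') h = ip f h - ip f' h;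
  ip_sym : forall f h, ip f h = ip h f;
  ip_pos : forall f, 0 <= ip f f;
  ip_amgm : forall (l : R) f h, 0 < l ->
    2 * `|ip f h| <= l * ip f f + l^-1 * ip h h;
  P_sub : forall g f h, P g (f - h) = P g f - P g h;
  P_idem : forall g f, P g (P g f) = P g f;
  P_comm : forall g g' f, P g (P g' f) = P g' (P g f);
  P_adj : forall g f h, ip (P g f) h = ip f (P g h) }.

(* For commuting orthogonal projections [P g], [q E f f u] is [|f|^2] times the mean
   of [u S], where [S] is the random subset of [E] taking the value [T] with
   probability [|prod_(g in T) (1 - P g) prod_(g in E - T) P g f|^2 / |f|^2];
   for functions on a product space, the random [S] of Efron-Stein. *)
Fixpoint q E f h u : R :=
  if E is g :: E' then
    q E' (P g f) (P g h) u + q E' (f - P g f) (h - P g h) (fun T => u (g :: T))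
  else u [::] * ip f h.

Hypothesis rs : resampling.

Lemma P_diff g f : P g (f - P g f) = 0.
Proof. by rewrite (P_sub rs) (P_idem rs) subrr. Qed.

Lemma P0 g : P g 0 = 0.
Proof. by rewrite -(subrr (0 : V)) (P_sub rs) !subrr. Qed.

Lemma ip0l h : ip 0 h = 0.
Proof. by rewrite -(subrr (0 : V)) (ip_subl rs) subrr. Qed.

Lemma ip_addl f f' h : ip (f + f') h = ip f h + ip f' h.
Proof.
by rewrite -[in LHS](opprK f') -(sub0r f') !(ip_subl rs) ip0l sub0r opprK.
Qed.

Lemma ip_subr f h h' : ip f (h - h') = ip f h - ip f h'.
Proof. by rewrite (ip_sym rs) (ip_subl rs) !(ip_sym rs f). Qed.

Lemma ip_addr f h h' : ip f (h + h') = ip f h + ip f h'.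
Proof. by rewrite (ip_sym rs) ip_addl !(ip_sym rs f). Qed.

Lemma pythagoras g f h : ip f h = ip (P g f) (P g h) + ip (f - P g f) (h - P g h).
Proof.
rewrite (ip_subl rs) !ip_subr !(P_adj rs) (P_idem rs); ring.
Qed.

Lemma q_subl E f f' h u : q E (f - f') h u = q E f h u - q E f' h u.
Proof.
elim: E f f' h u => [|g E IH] f f' h u /=; first by rewrite (ip_subl rs) mulrBr.
rewrite (P_sub rs) IH.
have -> : f - f' - (P g f - P g f') = (f - P g f) - (f' - P g f').
  by rewrite !opprB addrACA [RHS]addrACA; congr (_ + _); rewrite addrC.
by rewrite IH; ring.
Qed.

Lemma q_sym E f h u : q E f h u = q E h f u.
Proof.
by elim: E f h u => [|g E IH] f h u /=; [rewrite (ip_sym rs)|rewrite !(IH (P _ f)) IH (IH (f - _))].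
Qed.

Lemma q_subr E f h h' u : q E f (h - h') u = q E f h u - q E f h' u.
Proof. by rewrite q_sym q_subl !(q_sym E _ f). Qed.

Lemma q0l E h u : q E 0 h u = 0.
Proof. by rewrite -(subrr (0 : V)) q_subl subrr. Qed.

Lemma q_addl E f f' h u : q E (f + f') h u = q E f h u + q E f' h u.
Proof.
by rewrite -[in LHS](opprK f') -(sub0r f') !q_subl q0l sub0r opprK.
Qed.

Lemma q_addr E f h h' u : q E f (h + h') u = q E f h u + q E f h' u.
Proof. by rewrite q_sym q_addl !(q_sym E _ f). Qed.

Lemma q_ext E f h u u' : (forall T, subseq T E -> u T = u' T) ->
  q E f h u = q E f h u'.
Proof.
elim: E f h u u' => [|g E IH] f h u u' uu' /=; first by rewrite uu'.
congr (_ + _); apply: IH => T TE; apply: uu'.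
  exact: subseq_trans TE (subseq_cons _ _).
by rewrite /= eqxx.
Qed.

Lemma q_le E f u u' : (forall T, subseq T E -> u T <= u' T) ->
  q E f f u <= q E f f u'.
Proof.
elim: E f u u' => [|g E IH] f u u' uu' /=.
  by rewrite ler_wpM2r ?(ip_pos rs) // uu'.
apply: lerD; apply: IH => T TE; apply: uu'.
  exact: subseq_trans TE (subseq_cons _ _).
by rewrite /= eqxx.
Qed.

Lemma q_lin E f h (c : R) u u' :
  q E f h (fun T => c * u T + u' T) = c * q E f h u + q E f h u'.
Proof.
elim: E f h u u' => [|g E IH] f h u u' /=; first by ring.
by rewrite (IH _ _ u u') (IH _ _ (fun T => u (g :: T)) (fun T => u' (g :: T))); ring.
Qed.

Lemma q_cst E f h (c : R) : q E f h (fun=> c) = c * ip f h.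
Proof.
elim: E f h => [|g E IH] f h //=; by rewrite !IH (pythagoras g f h); ring.
Qed.

Lemma q_norm E f u (K : R) : (forall T, subseq T E -> `|u T| <= K) ->
  `|q E f f u| <= K * ip f f.
Proof.
move=> uK; rewrite ler_norml -mulNr -!(q_cst E).
apply/andP; split; apply: q_le => T /uK; rewrite ler_norml => /andP[] //.
Qed.

Lemma q_amgm E f h u (K l : R) : 0 < l -> (forall T, subseq T E -> `|u T| <= K) ->
  2 * `|q E f h u| <= K * (l * ip f f + l^-1 * ip h h).
Proof.
move=> l0; elim: E f h u => [|g E IH] f h u uK /=.
  rewrite normrM mulrCA; apply: ler_pM => //.
  - exact: uK.
  - exact: (ip_amgm rs).
rewrite (pythagoras g f f) (pythagoras g h h).
have h1 : forall T, subseq T E -> `|u T| <= K.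
  move=> T TE; apply: uK; exact: subseq_trans TE (subseq_cons _ _).
have h2 : forall T, subseq T E -> `|u (g :: T)| <= K.
  by move=> T TE; apply: uK; rewrite /= eqxx.
have := IH (P g f) (P g h) _ h1; have := IH (f - P g f) (h - P g h) _ h2.
set a := q _ _ _ _; set b := q _ _ _ _ => ha hb.
have := ler_normD b a; lra.
Qed.

Lemma q_diff E f f' u (K l : R) : 0 < l -> (forall T, subseq T E -> `|u T| <= K) ->
  2 * `|q E f f u - q E f' f' u| <=
    K * (l * ip (f - f') (f - f') + l^-1 * ip (f + f') (f + f')).
Proof.
move=> l0 uK; have -> : q E f f u - q E f' f' u = q E (f - f') (f + f') u.
  by rewrite q_subl !q_addr (q_sym E f' f); ring.
exact: q_amgm.
Qed.

(** [P g] commutes with every projection along [E], so a vector in its range and one in its kernel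
    remain so on each branch, and are orthogonal at the leaves. *)
Lemma q_orth E g f h u : q E (P g f) (h - P g h) u = 0.
Proof.
elim: E f h u => [|g' E IH] f h u /=.
  by rewrite (P_adj rs) P_diff (ip_sym rs) ip0l mulr0.
have -> : P g' (P g f) = P g (P g' f) by rewrite (P_comm rs).
have -> : P g' (h - P g h) = P g' h - P g (P g' h) by rewrite (P_sub rs) (P_comm rs).
rewrite IH add0r.
have -> : P g f - P g (P g' f) = P g (f - P g' f) by rewrite (P_sub rs).
have -> : h - P g h - (P g' h - P g (P g' h)) = (h - P g' h) - P g (h - P g' h).
  by rewrite (P_sub rs) !opprB addrACA [RHS]addrACA; congr (_ + _); rewrite addrC.
exact: IH.
Qed.

Lemma q_split E g f h u :
  q E (P g f) (P g h) u + q E (f - P g f) (h - P g h) u = q E f h u.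
Proof.
have h1 := q_orth E g f h u; have h2 := q_orth E g h f u.
rewrite (q_subr E (P g f)) in h1; rewrite (q_subr E (P g h)) in h2.
rewrite q_subl !q_subr; rewrite (q_sym E f (P g h)).
by rewrite (q_sym E (P g h) (P g f)) in h2; lra.
Qed.

(** Forgetting the coordinates outside [a] intersects the random set with [a]: at such a coordinate
    [q_split] recombines the two branches. *)
Lemma q_filter (a : pred I) E f h u :
  q (seq.filter a E) f h u = q E f h (fun T => u (seq.filter a T)).
Proof.
elim: E f h u => [|g E IH] f h u //=; case: ifP => ag /=.
  by rewrite !IH; congr (_ + _); apply: q_ext => T _ /=; rewrite ag.
rewrite -(q_split _ g) !IH; congr (_ + _).
Qed.

Lemma q_fix (a : pred I) E f u : (forall g, g \in E -> ~~ a g -> P g f = f) ->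
  q E f f u = q (seq.filter a E) f f u.
Proof.
elim: E f u => [|g E IH] f u fE //=; case: ifP => ag /=.
  rewrite !IH // => g' g'E ag'.
    by rewrite (P_sub rs) (P_comm rs g' g) fE // inE g'E orbT.
  by rewrite (P_comm rs) fE // inE g'E orbT.
have gf : P g f = f by rewrite fE ?mem_head ?ag.
rewrite gf subrr q0l addr0 IH // => g' g'E ag'.
by rewrite fE // inE g'E orbT.
Qed.

Lemma q_swap E g g' f h u : (forall T T', perm_eq T T' -> u T = u T') ->
  q (g :: g' :: E) f h u = q (g' :: g :: E) f h u.
Proof.
move=> pu /=; rewrite !(P_sub rs) !(P_comm rs g g') addrACA.
have e k : k - P g k - (P g' k - P g' (P g k)) = k - P g' k - (P g k - P g' (P g k)).
  by rewrite !opprB !addrA addrAC [RHS]addrAC; congr (_ + _); rewrite addrAC.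
rewrite (e f) (e h); congr (_ + _); congr (_ + _).
apply: q_ext => T _; apply: pu.
by rewrite -[g :: g' :: T]/([:: g] ++ [:: g'] ++ T) perm_catCA.
Qed.

Lemma q_mem E g f h u : (forall T T', perm_eq T T' -> u T = u T') -> g \in E ->
  q E f h u = q (g :: rem g E) f h u.
Proof.
elim: E f h u => [|g' E IH] f h u pu //; rewrite inE /=.
have [->//|gg'] := eqVneq g' g => /= gE.
rewrite -[RHS]/(q (g :: g' :: rem g E) f h u) q_swap //.
rewrite [LHS](_ : _ = q (g' :: E) f h u) // [LHS]/= [RHS]/= !(IH _ _ _ _ gE) //.
by move=> T T' TT'; apply: pu; rewrite perm_cons.
Qed.

Lemma q_perm E E' f h u : (forall T T', perm_eq T T' -> u T = u T') ->
  perm_eq E E' -> q E f h u = q E' f h u.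
Proof.
elim: E E' f h u => [|g E IH] E' f h u pu.
  by rewrite perm_sym => /perm_nilP ->.
move=> EE'; have gE' : g \in E' by rewrite -(perm_mem EE') mem_head.
rewrite (q_mem _ _ pu gE') /=.
have EE'' : perm_eq E (rem g E').
  by rewrite -(perm_cons g) (perm_trans EE') // perm_to_rem.
congr (_ + _); apply: IH => //.
by move=> T T' TT'; apply: pu; rewrite perm_cons.
Qed.

(** As [m] commutes with the projections, each atom of [m f] is the image of the corresponding atom
    of [f] and has at most its mass; the total variation between the two is therefore the mass
    lost. *)
Lemma q_mult (m : V -> V) E f u (K : R) :
  (forall f h, m (f - h) = m f - m h) -> (forall f, ip (m f) (m f) <= ip f f) ->
  (forall g, g \in E -> forall f, P g (m f) = m (P g f)) ->
  (forall T, subseq T E -> `|u T| <= K) ->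
  `|q E f f u - q E (m f) (m f) u| <= K * (ip f f - ip (m f) (m f)).
Proof.
move=> mB mc; elim: E f u => [|g E IH] f u mP uK /=.
  by rewrite -mulrBr normrM [X in _ * X]ger0_norm ?subr_ge0 // ler_wpM2r ?subr_ge0 ?uK.
rewrite mP ?mem_head // -mB.
have h1 : forall T, subseq T E -> `|u T| <= K.
  move=> T TE; apply: uK; exact: subseq_trans TE (subseq_cons _ _).
have h2 : forall T, subseq T E -> `|u (g :: T)| <= K.
  by move=> T TE; apply: uK; rewrite /= eqxx.
have mP' g' : g' \in E -> forall f, P g' (m f) = m (P g' f).
  by move=> g'E; apply: mP; rewrite inE g'E orbT.
rewrite (pythagoras g f) (pythagoras g (m f)) mP ?mem_head // -mB.
have := IH (P g f) _ mP' h1; have := IH (f - P g f) _ mP' h2.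
set a := q _ _ _ _; set b := q _ _ _ _; set c := q _ _ _ _; set e := q _ _ _ _.
move=> H1 H2; have := ler_normD (c - e) (a - b).
have -> : c - e + (a - b) = c + a - (e + b) by ring.
by lra.
Qed.

(** [I2 E f h] is the correlation of [f] with the noise operator [prod_(g in E) ((1 - c) P g + c)]
    applied to [h]. This operator is diagonal in the decomposition: it multiplies the component of
    index [T] by [c ^+ size T]. *)
Lemma q_geom (I2 : seq I -> V -> V -> R) (c : R) E f h :
  (forall f h, I2 [::] f h = ip f h) ->
  (forall g E f h, g \notin E ->
    I2 (g :: E) f h = (1 - c) * I2 E f (P g h) + c * I2 E f h) ->
  uniq E -> I2 E f h = q E f h (fun T => c ^+ size T).
Proof.
move=> I0 IS; elim: E f h => [|g E IH] f h /=; first by rewrite I0 mul1r.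
move=> /andP[gE uE]; rewrite IS // !IH //.
have -> : q E (f - P g f) (h - P g h) (fun T => c ^+ (size T).+1) =
    c * q E (f - P g f) (h - P g h) (fun T => c ^+ size T).
  have := q_lin E (f - P g f) (h - P g h) c (fun T => c ^+ size T) (fun=> 0).
  by rewrite q_cst mul0r addr0 => <-; apply: q_ext => T _; rewrite exprS addr0.
have h1 := q_split E g f h (fun T => c ^+ size T).
have h2 := q_orth E g h f (fun T => c ^+ size T).
rewrite q_subr (q_sym E _ f) (q_sym E _ (P g f)) in h2.
by rewrite -h1 (subr0_eq h2); ring.
Qed.

(* [f] is approximated by vectors fixed by all but finitely many [P g], so that
   its random set is almost surely finite and [q E] converges as [E] grows. *)
Definition tight f := forall e : R, 0 < e -> exists F a,
  [/\ forall g, g \notin F -> P g a = a, ip a a <= ip f f &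
      ip (f - a) (f - a) <= e].

(** Invariance under permutations makes [u] a function of the finite set that the list
    enumerates. *)
Definition adm u := (forall T T', perm_eq T T' -> u T = u T') /\
  exists K, forall T, `|u T| <= K.

(* The limit of [q E f f u] along the finite sets [E], written as a lower limit
   to make it total. *)
Definition Lw f u : R := sup [set x | exists F, forall E, uniq E ->
  {subset F <= E} -> x <= q E f f u].

Lemma parallelogram f h :
  ip (f + h) (f + h) + ip (f - h) (f - h) = 2 * ip f f + 2 * ip h h.
Proof.
by rewrite (ip_subl rs) !ip_subr ip_addl !ip_addr (ip_sym rs h f); ring.
Qed.

Lemma q_close (K M e : R) : 0 <= K -> 0 <= M -> 0 < e -> exists2 n : R, 0 < n &
  forall E f a u, ip f f <= M -> ip a a <= M -> ip (f - a) (f - a) <= n ->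
    (forall T, subseq T E -> `|u T| <= K) -> `|q E f f u - q E a a u| <= e.
Proof.
(* [l] is large enough for the second half of the bound of [q_diff] to be at most [e]; [n] is then
   small enough, given [l], for the first half. *)
move=> K0 M0 e0; pose l := (4 * K * M + 1) / e.
have KM : 0 < 4 * K * M + 1 by rewrite ltr_wpDl // !mulr_ge0.
have l0 : 0 < l by rewrite divr_gt0.
have Kl : 0 < K * l + 1 by rewrite ltr_wpDl // mulr_ge0 // ltW.
exists (e / (K * l + 1)) => [|E f a u fM aM fa uK]; first by rewrite divr_gt0.
have := q_diff f a l0 uK; have p := parallelogram f a.
have pos := ip_pos rs (f - a).
have h1 : ip (f + a) (f + a) <= 4 * M by lra.
have h2 : K * (l * ip (f - a) (f - a)) <= e.
  have Kl0 : 0 <= K * l by rewrite mulr_ge0 // ltW.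
  rewrite mulrA; apply: (le_trans (ler_wpM2l Kl0 fa)).
  by rewrite mulrCA ger_pMr // ler_pdivrMr // mul1r lerDl.
have h3 : K * (l^-1 * ip (f + a) (f + a)) <= e.
  have le : l * e = 4 * K * M + 1 by rewrite /l divfK // gt_eqF.
  rewrite mulrCA ler_pdivrMl // le (le_trans (ler_wpM2l K0 h1)) //; lra.
by rewrite mulrDr; lra.
Qed.

Lemma q_stable F a E u : uniq E -> {subset F <= E} ->
  (forall T T', perm_eq T T' -> u T = u T') ->
  (forall g, g \notin F -> P g a = a) -> q E a a u = q (undup F) a a u.
Proof.
move=> uE FE pu aF; rewrite (@q_fix (mem F)); last by move=> g _; exact: aF.
apply: q_perm => //; apply: uniq_perm; rewrite ?filter_uniq ?undup_uniq //.
move=> g; rewrite mem_filter mem_undup /=; apply/andP/idP => [[]//|gF].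
by split=> //; exact: FE.
Qed.

Lemma q_cauchy f u : tight f -> adm u -> forall e : R, 0 < e ->
  exists c F, forall E, uniq E -> {subset F <= E} -> `|q E f f u - c| <= e.
Proof.
move=> tf [pu [K uK]] e e0.
have K0 : 0 <= K by exact: le_trans (uK [::]).
have [n n0 H] := q_close K0 (ip_pos rs f) e0.
have [F [a [aF af fa]]] := tf _ n0.
exists (q (undup F) a a u), F => E uE FE.
by rewrite -(q_stable uE FE pu aF) H.
Qed.

Lemma Lw_lim f u : tight f -> adm u -> forall e : R, 0 < e ->
  exists F, forall E, uniq E -> {subset F <= E} -> `|q E f f u - Lw f u| <= e.
Proof.
move=> tf au e e0; have e2 : 0 < e / 2 by rewrite divr_gt0.
have [c [F cF]] := q_cauchy tf au e2; exists F => E uE FE.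
have inS : [set x | exists F, forall E, uniq E ->
    {subset F <= E} -> x <= q E f f u] (c - e / 2).
  exists F => E' uE' FE'; have := cF _ uE' FE'; rewrite ler_norml => /andP[]; lra.
have ubS : ubound [set x | exists F, forall E, uniq E ->
    {subset F <= E} -> x <= q E f f u] (c + e / 2).
  move=> x [F' xF']; have uE2 := undup_uniq (F ++ F').
  have h1 : x <= q (undup (F ++ F')) f f u.
    by apply: xF' => // g gF; rewrite mem_undup mem_cat gF orbT.
  have : `|q (undup (F ++ F')) f f u - c| <= e / 2.
    by apply: cF => // g gF; rewrite mem_undup mem_cat gF.
  rewrite ler_norml => /andP[]; lra.
have h1 : c - e / 2 <= Lw f u by apply: ub_le_sup => //; exists (c + e / 2).
have h2 : Lw f u <= c + e / 2 by apply: ge_sup => //; exists (c - e / 2).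
have := cF _ uE FE; rewrite !ler_norml => /andP[]; lra.
Qed.

Lemma Lw_le f f' u u' (c : R) : tight f -> tight f' -> adm u -> adm u' ->
  (exists F, forall E, uniq E -> {subset F <= E} ->
     q E f f u <= q E f' f' u' + c) -> Lw f u <= Lw f' u' + c.
Proof.
move=> tf tf' au au' [F0 H]; apply/ler_addgt0Pr => e e0.
have e2 : 0 < e / 2 by rewrite divr_gt0.
have [F hF] := Lw_lim tf au e2; have [F' hF'] := Lw_lim tf' au' e2.
pose E := undup (F0 ++ F ++ F').
have uE : uniq E by exact: undup_uniq.
have h0 : {subset F0 <= E} by move=> g gF; rewrite mem_undup !mem_cat gF.
have h1 : {subset F <= E} by move=> g gF; rewrite mem_undup !mem_cat gF orbT.
have h2 : {subset F' <= E} by move=> g gF; rewrite mem_undup !mem_cat gF !orbT.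
have := H _ uE h0; have := hF _ uE h1; have := hF' _ uE h2.
rewrite !ler_norml => /andP[? ?] /andP[? ?]; lra.
Qed.

Lemma Lw_dist f f' u u' (c : R) : tight f -> tight f' -> adm u -> adm u' ->
  (exists F, forall E, uniq E -> {subset F <= E} ->
     `|q E f f u - q E f' f' u'| <= c) -> `|Lw f u - Lw f' u'| <= c.
Proof.
move=> tf tf' au au' [F H].
have h1 : Lw f u <= Lw f' u' + c.
  apply: Lw_le => //; exists F => E uE FE; have := H _ uE FE.
  by rewrite ler_norml => /andP[]; lra.
have h2 : Lw f' u' <= Lw f u + c.
  apply: Lw_le => //; exists F => E uE FE; have := H _ uE FE.
  by rewrite ler_norml => /andP[]; lra.
by rewrite ler_norml; apply/andP; split; lra.
Qed.

Lemma Lw_mono f u u' : tight f -> adm u -> adm u' ->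
  (forall T, uniq T -> u T <= u' T) -> Lw f u <= Lw f u'.
Proof.
move=> tf au au' uu'; rewrite -[leRHS]addr0; apply: Lw_le => //.
exists [::] => E uE _; rewrite addr0; apply: q_le => T TE.
by apply: uu'; exact: subseq_uniq TE uE.
Qed.

Lemma Lw_close f u u' (c : R) : tight f -> adm u -> adm u' ->
  (forall T, uniq T -> `|u T - u' T| <= c) -> `|Lw f u - Lw f u'| <= c * ip f f.
Proof.
move=> tf au au' uu'; apply: Lw_dist => //; exists [::] => E uE _.
have -> : q E f f u - q E f f u' = q E f f (fun T => u T - u' T).
  rewrite addrC -mulN1r -q_lin; apply: q_ext => T _; ring.
by apply: q_norm => T TE; apply: uu'; exact: subseq_uniq TE uE.
Qed.

Lemma adm_cst (c : R) : adm (fun=> c).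
Proof. by split=> //; exists `|c|. Qed.

Lemma adm_lin (c : R) u u' : adm u -> adm u' -> adm (fun T => c * u T + u' T).
Proof.
move=> [pu [K uK]] [pu' [K' uK']]; split.
  by move=> T T' TT'; rewrite (pu _ _ TT') (pu' _ _ TT').
exists (`|c| * K + K') => T; rewrite (le_trans (ler_normD _ _)) // lerD //.
by rewrite normrM ler_wpM2l.
Qed.

Lemma Lw_cst f (c : R) : tight f -> Lw f (fun=> c) = c * ip f f.
Proof.
move=> tf; apply/eqP; rewrite eq_le; apply/andP; split; apply/ler_addgt0Pr => e e0;
have [F hF] := Lw_lim tf (adm_cst c) e0;
have := hF (undup F) (undup_uniq F);
have FF : {subset F <= undup F} by move=> g; rewrite mem_undup.
all: by move=> /(_ FF); rewrite q_cst ler_norml => /andP[]; lra.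
Qed.

Lemma Lw_lin f (c : R) u u' : tight f -> adm u -> adm u' ->
  Lw f (fun T => c * u T + u' T) = c * Lw f u + Lw f u'.
Proof.
move=> tf au au'; have al := adm_lin c au au'.
apply/eqP; rewrite -subr_eq0 -normr_eq0 -[_ == 0]orFb; apply/orP; right.
rewrite eq_le normr_ge0 andbT; apply/ler_addgt0Pr => e e0; rewrite add0r.
have c0 : 0 < `|c| + 2 by rewrite ltr_wpDl.
have d0 : 0 < e / (`|c| + 2) by rewrite divr_gt0.
have [F1 h1] := Lw_lim tf au d0; have [F2 h2] := Lw_lim tf au' d0.
have [F3 h3] := Lw_lim tf al d0.
pose E := undup (F1 ++ F2 ++ F3).
have uE : uniq E by exact: undup_uniq.
have := h1 E uE; have := h2 E uE; have := h3 E uE.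
have s1 : {subset F1 <= E} by move=> g gF; rewrite mem_undup !mem_cat gF.
have s2 : {subset F2 <= E} by move=> g gF; rewrite mem_undup !mem_cat gF orbT.
have s3 : {subset F3 <= E} by move=> g gF; rewrite mem_undup !mem_cat gF !orbT.
move=> /(_ s3) H3 /(_ s2) H2 /(_ s1) H1; rewrite q_lin in H3.
set A := q E f f u in H1 H3; set B := q E f f u' in H2 H3.
have -> : Lw f (fun T => c * u T + u' T) - (c * Lw f u + Lw f u') =
  - (c * A + B - Lw f (fun T => c * u T + u' T)) + (c * (A - Lw f u) + (B - Lw f u')).
  by ring.
rewrite (le_trans (ler_normD _ _)) // normrN.
have H4 := ler_normD (c * (A - Lw f u)) (B - Lw f u').
have H5 : `|c * (A - Lw f u)| <= `|c| * (e / (`|c| + 2)).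
  by rewrite normrM ler_wpM2l.
have H6 : `|c| * (e / (`|c| + 2)) + 2 * (e / (`|c| + 2)) = e.
  by rewrite -mulrDl mulrCA divff ?mulr1 // gt_eqF.
lra.
Qed.

(** A functional that only looks inside [E0] does not see the coordinates of a larger window, by
    [q_filter], so the limit is already attained at [E0]. *)
Lemma Lw_window f u E0 : tight f -> adm u -> uniq E0 ->
  (forall T, u T = u (seq.filter (mem E0) T)) -> Lw f u = q E0 f f u.
Proof.
move=> tf au uE0 uw; have qE E : uniq E -> {subset E0 <= E} -> q E f f u = q E0 f f u.
  move=> uE EE; rewrite (q_ext _ _ (fun T _ => uw T)) -q_filter.
  apply: q_perm; first by case: au.
  apply: uniq_perm; rewrite ?filter_uniq // => g; rewrite mem_filter /=.
  by apply/andP/idP => [[]//|gF]; split=> //; exact: EE.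
apply/eqP; rewrite -subr_eq0 -normr_eq0 eq_le normr_ge0 andbT.
apply/ler_addgt0Pr => e e0; rewrite add0r.
have [F hF] := Lw_lim tf au e0; have := hF (undup (F ++ E0)) (undup_uniq _).
rewrite qE ?undup_uniq //; last by move=> g gE; rewrite mem_undup mem_cat gE orbT.
by rewrite distrC; apply=> g gF; rewrite mem_undup mem_cat gF.
Qed.

(* Multiplying [h] by a function of the coordinates in [F] only moves the part
   of the random set that lies in [F]. *)
Lemma Lw_mult (M K e : R) : 0 <= M -> 0 <= K -> 0 < e -> exists2 n : R, 0 < n &
  forall (m : V -> V) f h u F (k : R), tight f -> tight h -> adm u ->
    ip f f <= M -> ip h h <= M -> (forall T, `|u T| <= K) ->
    (forall f h, m (f - h) = m f - m h) -> (forall f, ip (m f) (m f) <= ip f f) ->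
    (forall g, g \notin F -> forall f, P g (m f) = m (P g f)) ->
    ip (f - m h) (f - m h) <= n -> ip h h - ip (m h) (m h) <= n ->
    (forall T, uniq T -> `|u T - u (seq.filter (predC (mem F)) T)| <= k) ->
    `|Lw f u - Lw h u| <= e + 2 * k * M.
Proof.
move=> M0 K0 e0; have e2 : 0 < e / 2 by rewrite divr_gt0.
have [n n0 H] := q_close K0 M0 e2; have K1 : 0 < K + 1 by rewrite ltr_wpDl.
exists (Num.min n (e / 2 / (K + 1))); first by rewrite lt_min n0 divr_gt0.
move=> m f h u F k tf th au fM hM uK mB mc mP; rewrite !le_min.
move=> /andP[fmh _] /andP[_ hmh] uF.
have k0 : 0 <= k by exact: le_trans (uF [::] isT).
apply: Lw_dist => //; exists [::] => E uE _.
have mhM : ip (m h) (m h) <= M by exact: le_trans (mc h) hM.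
(* Pass from [f] to [m h] by closeness, drop the coordinates of [F] for both [m h] and [h], and
   compare these two off [F], where [m] commutes with the projections. *)
have h1 : `|q E f f u - q E (m h) (m h) u| <= e / 2.
  by apply: H => // T _; exact: uK.
have drop f' : ip f' f' <= M ->
    `|q E f' f' u - q (seq.filter (predC (mem F)) E) f' f' u| <= k * M.
  move=> f'M; rewrite q_filter.
  have -> : q E f' f' u - q E f' f' (fun T => u (seq.filter (predC (mem F)) T)) =
      q E f' f' (fun T => u T - u (seq.filter (predC (mem F)) T)).
    rewrite addrC -mulN1r -q_lin; apply: q_ext => T _; ring.
  apply: (le_trans (q_norm (K := k) _ _)).
    by move=> T TE; apply: uF; exact: subseq_uniq TE uE.
  by rewrite ler_wpM2l.
have h2 := drop _ mhM; have h3 := drop _ hM.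
have h4 : `|q (seq.filter (predC (mem F)) E) h h u -
    q (seq.filter (predC (mem F)) E) (m h) (m h) u| <= e / 2.
  have qm : `|q (seq.filter (predC (mem F)) E) h h u -
      q (seq.filter (predC (mem F)) E) (m h) (m h) u| <= K * (ip h h - ip (m h) (m h)).
    apply: q_mult => // g; rewrite mem_filter => /andP[gF _]; exact: mP.
  rewrite (le_trans qm) // (le_trans (ler_wpM2l K0 hmh)) //.
  by rewrite mulrCA ger_pMr // ler_pdivrMr // mul1r lerDl.
set a := q E f f u in h1 *; set b := q E (m h) (m h) u in h1 h2.
set c := q _ (m h) (m h) u in h2 h4; set d := q _ h h u in h3 h4.
rewrite -/d; set x := q E h h u in h3 *.
move: h1 h2 h3 h4; rewrite !ler_norml => /andP[? ?] /andP[? ?] /andP[? ?] /andP[? ?].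
by apply/andP; split; lra.
Qed.

End law.

Lemma q_map (R : realType) (I I' : eqType) (V V' : zmodType)
    (ip : V -> V -> R) (ip' : V' -> V' -> R)
    (P : I -> V -> V) (P' : I' -> V' -> V')
    (m : V -> V') (s : I -> I') (E : seq I) (f h : V) (u : seq I' -> R) :
  (forall f h, m (f - h) = m f - m h) ->
  (forall f h, ip' (m f) (m h) = ip f h) ->
  (forall g f, P' (s g) (m f) = m (P g f)) ->
  q ip' P' (map s E) (m f) (m h) u = q ip P E f h (fun T => u (map s T)).
Proof.
move=> mB mi mP; elim: E f h u => [|g E IH] f h u /=; first by rewrite mi.
by rewrite !mP -!mB !IH.
Qed.

Lemma Lw_map (R : realType) (I I' : eqType) (V V' : zmodType)
    (ip : V -> V -> R) (ip' : V' -> V' -> R)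
    (P : I -> V -> V) (P' : I' -> V' -> V')
    (m : V -> V') (s : I -> I') (s' : I' -> I) (f : V) (u : seq I' -> R) :
  cancel s s' -> cancel s' s ->
  (forall f h, m (f - h) = m f - m h) ->
  (forall f h, ip' (m f) (m h) = ip f h) ->
  (forall g f, P' (s g) (m f) = m (P g f)) ->
  Lw ip' P' (m f) u = Lw ip P f (fun T => u (map s T)).
Proof.
move=> sK s'K mB mi mP.
have inj : injective s by exact: can_inj sK.
have inj' : injective s' by exact: can_inj s'K.
congr sup; apply/seteqP; split=> x [F hF].
  exists (map s' F) => E uE FE; rewrite -(q_map _ _ _ _ mB mi mP).
  apply: hF; first by rewrite map_inj_uniq.
  by move=> g gF; rewrite -[g]s'K map_f // FE // map_f.
exists (map s F) => E uE FE; rewrite -[E](mapK s'K) (q_map _ _ _ _ mB mi mP).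
apply: hF; first by rewrite map_inj_uniq.
by move=> g gF; rewrite -[g]sK map_f // FE // map_f.
Qed.

(** * Bernoulli spaces *)

(** The sum is the minimum of [N] and the integer part of [y]: rounding down by counting
    thresholds. *)
Lemma count_below (R : realDomainType) (y : R) (N : nat) : 0 <= y ->
  let S := \sum_(k < N) (k.+1%:R <= y)%R%:R in
  [/\ S <= y, N%:R <= y -> S = N%:R & y <= N%:R -> y - 1 <= S].
Proof.
move=> y0 /=; elim: N => [|N [IH1 IH2 IH3]].
  rewrite big_ord0; split=> // h; lra.
rewrite big_ord_recr /=; have [Ny|yN] := leP N.+1%:R y.
  have NN : N%:R <= y by apply: le_trans Ny; rewrite ler_nat.
  rewrite (IH2 NN) natr1; split=> // h; lra.
rewrite addr0; split=> // h.
have [Ny|yN'] := leP N%:R y; last exact/IH3/ltW.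
by rewrite (IH2 Ny); rewrite -natr1 in h; lra.
Qed.

Section bfun_ind.
Context (R : realType) d (T : measurableType d).

Lemma bfun_ind (Q : bfun R T -> Prop) :
  (forall A (mA : measurable A), Q (bind R mA)) ->
  (forall f g : bfun R T, Q f -> Q g -> Q (f + g)) ->
  (forall (c : R) (f : bfun R T), Q f -> Q (bcst T c * f)) ->
  (forall f : bfun R T, (forall e : R, 0 < e ->
     exists2 g : bfun R T, Q g & forall x, `|f x - g x| <= e) -> Q f) ->
  forall f : bfun R T, Q f.
Proof.
move=> Qi QD QZ Qlim f; have [M M0 fM] := bfun_bounded f.
have Q1 : Q 1.
  suff -> : 1 = bind R (@measurableT _ T) by exact: Qi.
  by apply: bfun_eq => x; rewrite bindE in_setT.
have Qc c : Q (bcst T c).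
  suff -> : bcst T c = bcst T c * 1 by exact: QZ.
  by rewrite mulr1.
have Qsum N (h : 'I_N -> bfun R T) : (forall i, Q (h i)) -> Q (\sum_i h i).
  move=> hQ; apply: big_ind => //.
  suff -> : (0 : bfun R T) = bcst T 0 by exact: Qc.
  by apply: bfun_eq => x.
apply: Qlim => e e0; have M1 : 0 < M + 1 by rewrite ltr_wpDl.
pose N := (Num.bound (2 * (M + 1) / e)).+1.
have N0 : (0 : R) < N%:R by rewrite ltr0n.
have Ne : 2 * (M + 1) / N%:R <= e.
  have x0 : 0 <= 2 * (M + 1) / e by rewrite divr_ge0 // ?mulr_ge0 // ltW.
  rewrite ler_pdivrMr // -[leRHS]mulrC -ler_pdivrMr //; apply/ltW.
  by apply: lt_trans (archi_boundP x0) _; rewrite ltr_nat.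
(* The range of [f], inside [[-M, M]], is rescaled into [[0, N]]; rounding there changes [f] by at
   most [2 (M + 1) / N]. *)
pose y x := N%:R * ((f x + M) / (2 * (M + 1))).
have M2 : 0 < 2 * (M + 1) by rewrite mulr_gt0.
have y0 x : 0 <= y x.
  rewrite !mulr_ge0 ?invr_ge0 ?(ltW N0) ?(ltW M2) //.
  by have := fM x; rewrite ler_norml => /andP[]; lra.
have yN x : y x <= N%:R.
  rewrite /y ger_pMr // ler_pdivrMr // mul1r.
  by have := fM x; rewrite ler_norml => /andP[]; lra.
have mA (k : 'I_N) : measurable [set x | k.+1%:R <= y x].
  rewrite -[X in measurable X]setTI.
  apply: (measurable_fun_ler (f := cst k.+1%:R) (g := y) _ _ measurableT) => //.
  apply: measurable_funM => //; apply: measurable_funM => //.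
  by apply: measurable_funD => //; exact: measurable_bfun.
exists (bcst T (2 * (M + 1) / N%:R) * (\sum_(k < N) bind R (mA k)) + bcst T (- M)).
  by apply: QD => //; apply: QZ; apply: Qsum => k; exact: Qi.
move=> x; rewrite bfunD bfunM /=.
have -> : (\sum_(k < N) bind R (mA k)) x = \sum_(k < N) (k.+1%:R <= y x)%R%:R.
  elim/big_ind2 : _ => // [_ h _ b <- <- //|k _].
  rewrite bindE (_ : (_ \in _) = (k.+1%:R <= y x)) //.
  by apply/idP/idP; rewrite inE.
have [h1 _ /(_ (yN x)) h2] := count_below N (y0 x).
set S := \sum_(k < N) _ in h1 h2 *.
have -> : f x - (2 * (M + 1) / N%:R * S - M) = 2 * (M + 1) / N%:R * (y x - S).
  rewrite /y; field; rewrite !gt_eqF //.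
have P0 : 0 <= 2 * (M + 1) / N%:R by rewrite divr_ge0 // ltW.
rewrite normrM (ger0_norm P0); apply: le_trans Ne; rewrite ler_piMr //.
rewrite ler_norml; apply/andP; split; lra.
Qed.

End bfun_ind.

Lemma prob_ext (R : realType) d (T : measurableType d) (C : set (set T))
    (m1 m2 : {measure set T -> \bar R}) :
  @measurable _ T = <<s C >> -> setI_closed C -> C setT ->
  (m1 setT < +oo)%E -> (forall A, C A -> m1 A = m2 A) ->
  forall A, measurable A -> m1 A = m2 A.
Proof.
move=> mC CI CT m1oo m12 A mA.
apply: (@measure_unique _ R T C (fun=> setT) mC CI _ _ m1 m2) => //.
by apply/seteqP; split=> // x _; exists 0%N.
Qed.

Lemma prod_gen d d' (T : measurableType d) (T' : measurableType d')
    (C : set (set T)) (C' : set (set T')) :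
  @measurable _ T = <<s C >> -> C setT -> @measurable _ T' = <<s C' >> -> C' setT ->
  @measurable _ (T * T')%type = <<s [set A `*` B | A in C & B in C'] >>.
Proof.
move=> mC CT mC' CT'; rewrite measurable_prod_measurableType.
set S := <<s [set A `*` B | A in C & B in C'] >>.
have sS : sigma_algebra setT S by exact: smallest_sigma_algebra.
have S1 A : measurable A -> S (A `*` setT).
  suff : @measurable _ T `<=` [set A | S (A `*` setT)] by apply.
  rewrite mC; apply: smallest_sub => [|B CB]; last first.
    by apply: sub_sigma_algebra; exists B => //; exists setT.
  split=> /= [|B SB|F SF].
  - by rewrite set0X; case: sS.
  - have -> : (setT `\` B) `*` setT = setT `\` (B `*` [set: T']).
      by apply/seteqP; split=> [[x y] /= [[_ nB] _]|[x y] /= [_ nB]];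
        split=> //; [move=> []|split=> // Bx; apply: nB].
    by case: sS => _ + _; exact.
  - rewrite (_ : _ `*` _ = \bigcup_n (F n `*` [set: T'])); last first.
      by apply/seteqP; split=> [[x y] /= [[n _ Fn] _]|[x y] [n _ /= [Fn _]]];
        [exists n|split=> //; exists n].
    by case: sS => _ _; exact.
have S2 A : measurable A -> S (setT `*` A).
  suff : @measurable _ T' `<=` [set A | S (setT `*` A)] by apply.
  rewrite mC'; apply: smallest_sub => [|B CB]; last first.
    by apply: sub_sigma_algebra; exists setT => //; exists B.
  split=> /= [|B SB|F SF].
  - by rewrite setX0; case: sS.
  - have -> : setT `*` (setT `\` B) = setT `\` ([set: T] `*` B).
      by apply/seteqP; split=> [[x y] /= [_ [_ nB]]|[x y] /= [_ nB]];
        split=> //; [move=> []|split=> // Bx; apply: nB].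
    by case: sS => _ + _; exact.
  - rewrite (_ : _ `*` _ = \bigcup_n ([set: T] `*` F n)); last first.
      by apply/seteqP; split=> [[x y] /= [_ [n _ Fn]]|[x y] [n _ /= [_ Fn]]];
        [exists n|split=> //; exists n].
    by case: sS => _ _; exact.
apply/seteqP; split; apply: smallest_sub; try exact: smallest_sigma_algebra.
  move=> _ [A mA] [B mB] <-.
  have -> : A `*` B = (A `*` setT) `&` (setT `*` B).
    by apply/seteqP; split=> [[x y] /= []|[x y] /= [[] ? _ []]].
  exact: (@measurableI _ (g_sigma_algebraType [set A `*` B | A in C & B in C'])
    _ _ (S1 _ mA) (S2 _ mB)).
move=> _ [A CA] [B CB] <-; apply: sub_sigma_algebra; exists A.
  by rewrite mC; exact: sub_sigma_algebra.
by exists B => //; rewrite mC'; exact: sub_sigma_algebra.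
Qed.

Section bernoulli_boxes.
Context (G : groupType) d (X0 : measurableType d).
Local Notation X := (bernoulli_space G X0).

Lemma measurable_coord (g : G) : measurable_fun setT (fun x : X => x g).
Proof.
by move=> _ A mA; rewrite setTI; apply: sub_sigma_algebra; exists g, A.
Qed.

Lemma measurable_bernoulli d' (T : measurableType d') (h : T -> X) :
  (forall g, measurable_fun setT (fun t => h t g)) -> measurable_fun setT h.
Proof.
move=> mh; apply: (@measurability _ _ T X setT h (@cylinders G d X0)) => //.
move=> _ [_ [g [A [mA ->]]] <-]; exact: (mh g measurableT A mA).
Qed.

Definition box (F : {fset G}) (A : G -> set X0) : set X :=
  [set x | forall g, g \in F -> A g (x g)].

Definition boxes : set (set X) := [set C | exists (F : {fset G}) A,
  (forall g, measurable (A g)) /\ C = box F A].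

Lemma box_widen (F F' : {fset G}) A : (F `<=` F')%fset ->
  box F A = box F' (fun g => if g \in F then A g else setT).
Proof.
move=> FF'; apply/seteqP; split=> x /= Ax g gF; first by case: ifPn => // /Ax.
by have := Ax g (fsubsetP FF' _ gF); rewrite gF.
Qed.

Lemma measurable_box (F : {fset G}) A : (forall g, measurable (A g)) ->
  measurable (box F A).
Proof.
move=> mA; have -> : box F A = \bigcap_(g in [set` F]) [set x : X | A g (x g)].
  by apply/seteqP; split=> x /= Ax g; exact: Ax.
apply: fin_bigcap_measurable; first exact: finite_fset.
move=> g _; have := measurable_coord g measurableT (mA g).
by rewrite setTI.
Qed.

Lemma boxes_gen : @measurable _ X = <<s boxes >>.
Proof.
apply/seteqP; split; apply: smallest_sub; try exact: smallest_sigma_algebra.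
  move=> _ [g [A [mA ->]]]; apply: sub_sigma_algebra; exists [fset g]%fset, (fun=> A).
  split=> //; apply/seteqP; split=> x /= Ax; first by move=> g' /fset1P ->.
  by apply: Ax; rewrite fset11.
by move=> _ [F [A [mA ->]]]; exact: measurable_box.
Qed.

Lemma boxesT : boxes setT.
Proof.
exists fset0, (fun=> setT); split=> //.
by apply/seteqP; split=> x // _ g; rewrite inE.
Qed.

Lemma boxesI : setI_closed boxes.
Proof.
move=> _ _ [F [A [mA ->]]] [F' [A' [mA' ->]]]; exists (F `|` F')%fset.
exists (fun g => (if g \in F then A g else setT) `&` (if g \in F' then A' g else setT)).
split; first by move=> g; apply: measurableI; case: ifP.
rewrite (box_widen A (fsubsetUl F F')) (box_widen A' (fsubsetUr F F')).
apply/seteqP; split=> [x /= [Ax A'x] g gF|x /= Ax]; first by split; [exact: Ax|exact: A'x].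
by split=> g /Ax [].
Qed.

End bernoulli_boxes.

Section bernoulli_measure.
Context (R : realType) (G : groupType) d (X0 : measurableType d).
Local Notation X := (bernoulli_space G X0).
Context (mu0 : probability X0 R) (mu : probability X R).
Hypothesis mu_prod : is_product_measure mu0 mu.

Lemma mu_box (F : {fset G}) A : (forall g, measurable (A g)) ->
  mu (box F A) = (\prod_(g <- F) fine (mu0 (A g)))%:E.
Proof.
move=> mA; rewrite /box mu_prod // (big_morph EFin (@EFinM R) erefl).
by apply: eq_bigr => g _; rewrite fineK // fin_num_measure.
Qed.

Lemma measurable_act (t : G) : measurable_fun setT (@bernoulli_action G d X0 t).
Proof. by apply: measurable_bernoulli => g; exact: measurable_coord. Qed.

Lemma act_box (t : G) (F : {fset G}) A :
  @bernoulli_action G d X0 t @^-1` box F A =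
  box [fset (t^-1 * g)%g | g in F]%fset (fun g => A (t * g)%g).
Proof.
apply/seteqP; split=> x /= Ax.
  by move=> _ /imfsetP[g /= gF ->]; rewrite mulVKg; exact: Ax.
move=> g gF; have := Ax (t^-1 * g)%g; rewrite mulVKg; apply.
by apply/imfsetP; exists g.
Qed.

Lemma mpres_act (t : G) : mpres mu mu (@bernoulli_action G d X0 t).
Proof.
split; first exact: measurable_act.
pose m2 := pushforward mu (@bernoulli_action G d X0 t).
have mt := measurable_act t.
pose mt' := isMeasurableFun.Build _ _ _ _ _ mt.
pose act' : {mfun X >-> X} := HB.pack (@bernoulli_action G d X0 t) mt'.
move=> A mA; apply/esym.
apply: (@prob_ext R _ X (@boxes G d X0) mu (pushforward mu act')) => //.
- exact: boxes_gen.
- exact: boxesI.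
- exact: boxesT.
- by have /= -> := probability_setT mu; rewrite ltry.
move=> _ [F [B [mB ->]]].
rewrite [RHS](_ : _ = mu (@bernoulli_action G d X0 t @^-1` box F B)) //.
rewrite act_box mu_box //; apply: etrans (mu_box F mB) _.
congr (_%:E); rewrite big_imfset /=; last by move=> x y _ _; exact: mulgI.
by apply: eq_bigr => g _; rewrite mulVKg.
Qed.

Definition mix (B : set G) (x y : X) : X := fun g => if g \in B then y g else x g.

Lemma measurable_mix (B : set G) : measurable_fun setT (fun p : X * X => mix B p.1 p.2).
Proof.
apply: measurable_bernoulli => g; rewrite /mix; case: (g \in B).
  by apply: (measurableT_comp (measurable_coord g)).
by apply: (measurableT_comp (measurable_coord g)).
Qed.

Definition mixswap (B : set G) (p : X * X) := (mix B p.1 p.2, mix B p.2 p.1).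

Lemma measurable_mixswap (B : set G) : measurable_fun setT (mixswap B).
Proof.
apply: measurable_fun_pair; first exact: measurable_mix.
apply: (measurableT_comp (measurable_mix B) (f := fun p : X * X => mix B p.1 p.2)
  (g := fun p : X * X => (p.2, p.1))).
exact: measurable_fun_pair.
Qed.

(** On a product of two boxes the swap exchanges the factors at the coordinates in [B], which only
    permutes the terms of a finite product; such products form a generating pi-system. *)
Lemma mpres_mixswap (B : set G) : mpres (mu \x mu)%E (mu \x mu)%E (mixswap B).
Proof.
split; first exact: measurable_mixswap.
have mt := measurable_mixswap B.
pose mt' := isMeasurableFun.Build _ _ _ _ _ mt.
pose sw : {mfun (X * X)%type >-> (X * X)%type} := HB.pack (mixswap B) mt'.
move=> A mA; apply/esym.
apply: (@prob_ext R _ (X * X)%type [set A `*` B | A in @boxes G d X0 & B in @boxes G d X0]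
  (mu \x mu)%E (pushforward (mu \x mu)%E sw)) => //.
- by apply: prod_gen; [exact: boxes_gen|exact: boxesT|exact: boxes_gen|exact: boxesT].
- move=> _ _ [A1 bA1] [A2 bA2] <- [B1 bB1] [B2 bB2] <-.
  rewrite -setXI.
  by exists (A1 `&` B1); [exact: boxesI|exists (A2 `&` B2) => //; exact: boxesI].
- by exists setT; [exact: boxesT|exists setT; [exact: boxesT|rewrite setXTT]].
- by have /= -> := probability_setT (mu \x mu)%E; rewrite ltry.
move=> _ [_ [F1 [A1 [mA1 ->]]]] [_ [F2 [A2 [mA2 ->]]]] <-.
pose F := (F1 `|` F2)%fset.
pose C1 g := if g \in F1 then A1 g else setT.
pose C2 g := if g \in F2 then A2 g else setT.
rewrite (box_widen A1 (fsubsetUl F1 F2)) (box_widen A2 (fsubsetUr F1 F2)).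
rewrite -/F -/C1 -/C2.
have mC1 g : measurable (C1 g) by rewrite /C1; case: ifP.
have mC2 g : measurable (C2 g) by rewrite /C2; case: ifP.
rewrite [RHS](_ : _ = (mu \x mu)%E (mixswap B @^-1` (box F C1 `*` box F C2))) //.
have -> : mixswap B @^-1` (box F C1 `*` box F C2) =
    box F (fun g => if g \in B then C2 g else C1 g) `*`
    box F (fun g => if g \in B then C1 g else C2 g).
  apply/seteqP; split=> -[x y] /= [h1 h2]; split=> g gF;
    have := h1 g gF; have := h2 g gF; rewrite /mix; by case: ifP.
have mbox F' A' := @measurable_box G d X0 F' A'.
have mD1 g : measurable (if g \in B then C2 g else C1 g) by case: ifP.
have mD2 g : measurable (if g \in B then C1 g else C2 g) by case: ifP.
rewrite product_measure1E; [|exact: mbox|exact: mbox].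
apply: etrans (product_measure1E _ _ (mbox F C1 mC1) (mbox F C2 mC2)) _.
apply: etrans (f_equal2 mule (mu_box F mC1) (mu_box F mC2)) _.
apply/esym; apply: etrans (f_equal2 mule (mu_box F mD1) (mu_box F mD2)) _.
rewrite -!EFinM -!big_split /=; congr (_%:E); apply: eq_bigr => g _.
by case: ifP => // _; rewrite mulrC.
Qed.

End bernoulli_measure.

Section bfun_class.
Context (R : realType) d (T : measurableType d) (mu : probability T R).
Implicit Types f g : bfun R T.

Lemma babs_subproof f : (fun x => `|f x|) \in @bmeas R _ T.
Proof.
have [M M0 fM] := bfun_bounded f; apply/bmeasP; split.
  exact: (measurableT_comp (@normr_measurable R setT) (measurable_bfun f)).
by exists M => x; rewrite normr_id.
Qed.

Definition babs f : bfun R T := BFun (babs_subproof f).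

Lemma Ex_norm f : `|Ex mu f| <= Ex mu (babs f).
Proof.
rewrite ler_norml; apply/andP; split; last by apply: Ex_le => x; exact: ler_norm.
rewrite -sub0r -(Ex0 mu) -ExB; apply: Ex_le => x.
by rewrite bfunB bfun0 sub0r /= lerNl -normrN ler_norm.
Qed.

(** Functional form of Dynkin's argument, with closure in the L1 norm. The partial sums over a
    disjoint union lie below its indicator, so their L1 distance to it is a difference of measures,
    which tends to 0. *)
Lemma bfun_class (C : set (set T)) (Q : bfun R T -> Prop) :
  @measurable _ T = <<s C >> -> setI_closed C -> C setT ->
  (forall A (mA : measurable A), C A -> Q (bind R mA)) ->
  (forall f g, Q f -> Q g -> Q (f + g)) ->
  (forall (c : R) f, Q f -> Q (bcst T c * f)) ->
  (forall f, (forall e : R, 0 < e ->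
     exists2 g, Q g & Ex mu (babs (f - g)) <= e) -> Q f) ->
  forall f, Q f.
Proof.
move=> mC CI CT QC QD QZ Qlim; apply: bfun_ind => // [A mA|f H]; last first.
  apply: Qlim => e e0; have [g Qg fg] := H _ e0; exists g => //.
  by apply: le_trans (ler_norm _) _; apply: Ex_norm_le => x /=; rewrite normr_id fg.
pose Q' A := forall mA : measurable A, Q (bind R mA).
suff : Q' A by apply.
have Q1 : Q 1.
  suff -> : 1 = bind R (@measurableT _ T) by exact: QC.
  by apply: bfun_eq => x; rewrite bindE in_setT.
apply: (@dynkin_induction _ _ C Q' mC CI) => //; last by rewrite -mC.
- by move=> mT; exact: QC.
- by move=> B CB mB; exact: QC.
- move=> B mB QB mB'.
  have -> : bind R mB' = 1 + bcst T (-1) * bind R mB.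
    apply: bfun_eq => x; rewrite !bfunE /= !indicE in_setC.
    by case: (x \in B) => /=; ring.
  by apply: QD => //; apply: QZ; exact: QB.
move=> F mF tF QF mUF; apply: Qlim => e e0.
have Qs N : Q (\sum_(k < N) bind R (mF k)).
  apply: big_ind => //; last by move=> i _; exact: QF.
  suff -> : (0 : bfun R T) = bcst T 0 * 1 by exact: QZ.
  by apply: bfun_eq => x; rewrite !bfunE mulr1.
have Es N : Ex mu (\sum_(k < N) bind R (mF k)) = \sum_(k < N) fine (mu (F k)).
  rewrite (big_morph (Ex mu) (ExD mu) (Ex0 mu)).
  by apply: eq_bigr => k _; rewrite Ex_ind.
have sN N x : (\sum_(k < N) bind R (mF k)) x <= bind R mUF x.
  have -> : (\sum_(k < N) bind R (mF k)) x = \sum_(k < N) (x \in F k)%:R.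
    by elim/big_ind2 : _ => // _ h _ b <- <-.
  have [[k xk]|nx] := pselect (exists k : 'I_N, x \in F k); last first.
    rewrite big1 ?bindE ?ler0n // => k _.
    by case: (boolP (x \in F k)) => // xk; case: nx; exists k.
  rewrite (bigD1 k) //= xk big1 ?addr0 => [|j jk].
    by rewrite indicE (_ : x \in _) // inE; exists (val k) => //; exact/set_mem.
  case: (boolP (x \in F j)) => // xj; case/eqP: jk; apply: val_inj => /=.
  by apply: (tF) => //; exists x; split; exact/set_mem.
have cv : (fun n => \sum_(k < n) fine (mu (F k))) @ \oo --> fine (mu (\bigcup_k F k)).
  have h : (\sum_(0 <= i < n) mu (F i))%E @[n --> \oo] --> mu (\bigcup_n F n).
    exact: measure_semi_sigma_additive.
  have fU : mu (\bigcup_k F k) = (fine (mu (\bigcup_k F k)))%:E.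
    by rewrite fineK // fin_num_measure.
  move: h; rewrite fU => /fine_cvg; apply: cvg_trans; apply: near_eq_cvg.
  near=> n; rewrite /= big_mkord.
  rewrite [X in fine X](_ : _ = (\sum_(k < n) fine (mu (F k)))%:E) //.
  rewrite (big_morph EFin EFinD erefl).
  by apply: eq_bigr => k _; rewrite fineK // fin_num_measure.
have /cvgrPdist_le/(_ _ e0)[N _ /(_ N (leqnn N)) hN] := cv.
exists (\sum_(k < N) bind R (mF k)); first exact: Qs.
have -> : babs (bind R mUF - \sum_(k < N) bind R (mF k)) =
    bind R mUF - \sum_(k < N) bind R (mF k).
  by apply: bfun_eq => x; rewrite /= ger0_norm // subr_ge0; exact: sN.
by rewrite ExB Es Ex_ind (le_trans (ler_norm _)).
Unshelve. all: by end_near.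
Qed.

End bfun_class.

(** * Mixing actions *)

Lemma bcompM (R : realType) d d' (T : measurableType d) (T' : measurableType d')
    (h : T -> T') (mh : measurable_fun setT h) (f g : bfun R T') :
  bcomp mh (f * g) = bcomp mh f * bcomp mh g.
Proof. exact: bfun_eq. Qed.

Section mixing.
Context (R : realType) (G : groupType) d (T : measurableType d).
Context (mu : probability T R).
Implicit Types f g : bfun R T.

(** Linear functionals with a common L1 bound converge on an L1-closed linear space, so a generating
    pi-system is enough to test convergence. *)
Lemma functional_class (C : set (set T)) (Lam : nat -> bfun R T -> R)
    (L : bfun R T -> R) (K : R) :
  @measurable _ T = <<s C >> -> setI_closed C -> C setT ->
  (forall n f g, Lam n (f + g) = Lam n f + Lam n g) ->
  (forall n (c : R) f, Lam n (bcst T c * f) = c * Lam n f) ->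
  (forall f g, L (f + g) = L f + L g) ->
  (forall (c : R) f, L (bcst T c * f) = c * L f) ->
  0 <= K ->
  (forall n f, `|Lam n f| <= K * Ex mu (babs f)) ->
  (forall f, `|L f| <= K * Ex mu (babs f)) ->
  (forall A (mA : measurable A), C A ->
    (fun n => Lam n (bind R mA)) @ \oo --> L (bind R mA)) ->
  forall f, (fun n => Lam n f) @ \oo --> L f.
Proof.
move=> mC CI CT LamD LamZ LD LZ K0 LamK LK CL.
apply: (bfun_class (mu := mu) (Q := fun f => (fun n => Lam n f) @ \oo --> L f) mC CI CT CL).
- move=> f g cf cg; rewrite LD.
  rewrite (_ : (fun n => _) = (fun n => Lam n f) + (fun n => Lam n g)); last first.
    by apply/funext => n; exact: LamD.
  exact: cvgD.
- move=> c f cf; rewrite LZ.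
  rewrite (_ : (fun n => _) = (fun n => c * Lam n f)); last first.
    by apply/funext => n; exact: LamZ.
  exact: cvgMr.
move=> f H; apply/cvgrPdist_le => e e0.
have K1 : 0 < 2 * K + 1 by rewrite ltr_wpDl // mulr_ge0.
have d0 : 0 < e / (2 * K + 1) by rewrite divr_gt0.
have [g cg fg] := H _ d0.
have /cvgrPdist_le/(_ _ d0)[N _ hN] := cg; exists N => // n /= Nn.
have := hN n Nn; set D := e / (2 * K + 1) in fg *.
have LB : L f - L g = L (f - g).
  by have := LD (f - g) g; rewrite subrK => ->; rewrite addrK.
have LamB : Lam n f - Lam n g = Lam n (f - g).
  by have := LamD n (f - g) g; rewrite subrK => ->; rewrite addrK.
have h1 := LK (f - g); have h2 := LamK n (f - g); rewrite -LB in h1; rewrite -LamB in h2.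
have h3 : K * Ex mu (babs (f - g)) <= K * D by rewrite ler_wpM2l.
have eD : 2 * (K * D) + D = e.
  by rewrite mulrA -[X in _ + X]mul1r -mulrDl /D mulrC divfK // gt_eqF.
have -> : L f - Lam n f = (L f - L g) - (Lam n f - Lam n g) + (L g - Lam n g) by ring.
move=> h4; rewrite (le_trans (ler_normD _ _)) //.
have := ler_normB (L f - L g) (Lam n f - Lam n g); lra.
Qed.

Definition pmp (act : G -> T -> T) := forall t, mpres mu mu (act t).

(** Injective sequences stand for going to infinity in the discrete group. *)
Definition mixing (act : G -> T -> T) (pa : pmp act) :=
  forall tau : nat -> G, injective tau -> forall f g : bfun R T,
    (fun n => Ex mu (f * bcomp (pa (tau n)).1 g)) @ \oo --> Ex mu f * Ex mu g.

Lemma mixing_gen (C : set (set T)) (act : G -> T -> T) (pa : pmp act) :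
  @measurable _ T = <<s C >> -> setI_closed C -> C setT ->
  (forall tau : nat -> G, injective tau -> forall A B (mA : measurable A)
    (mB : measurable B), C A -> C B ->
    (fun n => Ex mu (bind R mA * bcomp (pa (tau n)).1 (bind R mB))) @ \oo -->
      Ex mu (bind R mA) * Ex mu (bind R mB)) ->
  mixing pa.
Proof.
move=> mC CI CT H tau itau f g.
have bd (f1 f2 : bfun R T) M : (forall x, `|f1 x| <= M) -> `|Ex mu (f1 * f2)| <= M * Ex mu (babs f2).
  move=> f1M; apply: le_trans (Ex_norm _ _) _; rewrite -ExZ; apply: Ex_le => x.
  by rewrite bfunM /= normrM ler_wpM2r.
have step B (mB : measurable B) : C B -> forall f1 : bfun R T,
    (fun n => Ex mu (f1 * bcomp (pa (tau n)).1 (bind R mB))) @ \oo -->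
      Ex mu f1 * Ex mu (bind R mB).
  move=> CB; have iM x : `|bind R mB x| <= 1.
    by rewrite bindE; case: (_ \in _); rewrite ?normr1 ?normr0.
  apply: (functional_class (Lam := fun n f1 => Ex mu (f1 * bcomp (pa (tau n)).1 (bind R mB)))
    (L := fun f1 => Ex mu f1 * Ex mu (bind R mB)) (K := 1) mC CI CT) => //.
  - by move=> n f1 f2; rewrite mulrDl ExD.
  - by move=> n c f1; rewrite -mulrA ExZ.
  - by move=> f1 f2; rewrite ExD mulrDl.
  - by move=> c f1; rewrite ExZ mulrA.
  - by move=> n f1; rewrite mulrC; apply: bd => x; exact: iM.
  - move=> f1; rewrite normrM mulrC ler_pM //; last exact: Ex_norm.
    exact: Ex_norm_le.
  - by move=> A mA CA; exact: H.
have [M M0 fM] := bfun_bounded f.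
apply: (functional_class (Lam := fun n g => Ex mu (f * bcomp (pa (tau n)).1 g))
    (L := fun g => Ex mu f * Ex mu g) (K := M) mC CI CT) => //.
- by move=> n f1 f2; rewrite -ExD -mulrDr; congr Ex; exact: bfun_eq.
- move=> n c f1; rewrite -ExZ; congr Ex; apply: bfun_eq => x.
  by rewrite !bfunM /= mulrCA.
- by move=> f1 f2; rewrite ExD mulrDr.
- by move=> c f1; rewrite ExZ mulrCA.
- move=> n f1; apply: le_trans (bd _ _ _ fM) _.
  by rewrite -(Ex_comp (pa (tau n)) (babs f1)); apply: ler_wpM2l => //; apply: Ex_le => x.
- by move=> f1; rewrite normrM ler_pM //; [exact: Ex_norm_le|exact: Ex_norm].
- by move=> B mB CB; exact: step.
Qed.

(** The correlations along [tau] all equal the second moment of [f], while mixing sends them to the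
    squared mean; so the variance vanishes. *)
Lemma mixing_const (act : G -> T -> T) (pa : pmp act) (tau : nat -> G) f :
  mixing pa -> injective tau ->
  (forall n, {ae mu, forall x, f (act (tau n) x) = f x}) ->
  {ae mu, forall x, f x = Ex mu f}.
Proof.
move=> mix_ itau inv; have := mix_ tau itau f f.
have e n : Ex mu (f * bcomp (pa (tau n)).1 f) = Ex mu (f * f).
  by apply: ae_Ex_eq; apply: filterS (inv n) => x fx; rewrite !bfunM /= fx.
rewrite (_ : (fun n => _) = cst (Ex mu (f * f))); last by apply/funext => n; exact: e.
move=> /cvg_lim => /(_ (@Rhausdorff _)); rewrite lim_cst // => ff.
have h0 : Ex mu ((f - bcst T (Ex mu f)) * (f - bcst T (Ex mu f))) = 0.
  have -> : (f - bcst T (Ex mu f)) * (f - bcst T (Ex mu f)) =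
    f * f - bcst T (2 * Ex mu f) * f + bcst T (Ex mu f ^+ 2).
    by apply: bfun_eq => x; rewrite !bfunE /=; ring.
  by rewrite ExD ExB ExZ Ex_cst ff; ring.
have := Ex_eq0_ae _ h0; move=> /(_ _)/wrap[]; first by move=> x; rewrite bfunM -expr2 sqr_ge0.
apply: filterS => x /eqP; rewrite bfunM mulf_eq0 orbb bfunB subr_eq0 => /eqP; exact.
Qed.

End mixing.

Lemma mpres_prod (R : realType) d1 (T1 : measurableType d1) d1' (T1' : measurableType d1')
    d2 (T2 : measurableType d2) d2' (T2' : measurableType d2')
    (m1 : probability T1 R) (m1' : probability T1' R)
    (m2 : probability T2 R) (m2' : probability T2' R) (h : T1 -> T2) (h' : T1' -> T2') :
  mpres m1 m2 h -> mpres m1' m2' h' ->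
  mpres (m1 \x m1')%E (m2 \x m2')%E (fun p : T1 * T1' => (h p.1, h' p.2)).
Proof.
move=> [mh muh] [mh' nuh'].
have mp : measurable_fun setT (fun p : T1 * T1' => (h p.1, h' p.2)).
  by apply: measurable_fun_pair; exact: measurableT_comp.
split=> // A mA; apply/esym.
pose mp' := isMeasurableFun.Build _ _ _ _ _ mp.
pose p' : {mfun (T1 * T1')%type >-> (T2 * T2')%type} :=
  HB.pack (fun p : T1 * T1' => (h p.1, h' p.2)) mp'.
apply: (@prob_ext R _ (T2 * T2')%type [set A `*` B | A in @measurable _ T2 & B in @measurable _ T2']
  (m2 \x m2')%E (pushforward (m1 \x m1')%E p')) => //.
- exact: measurable_prod_measurableType.
- move=> _ _ [A1 mA1] [A2 mA2] <- [B1 mB1] [B2 mB2] <-.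
  rewrite -setXI.
  by exists (A1 `&` B1); [exact: measurableI|exists (A2 `&` B2) => //; exact: measurableI].
- by exists setT => //; exists setT => //; rewrite setXTT.
- by have /= -> := probability_setT (m2 \x m2')%E; rewrite ltry.
move=> _ [A1 mA1] [A2 mA2] <-.
rewrite [RHS](_ : _ = (m1 \x m1')%E ((h @^-1` A1) `*` (h' @^-1` A2))) //.
have k1 : measurable (h @^-1` A1) by rewrite -[X in measurable X]setTI; exact: mh.
have k2 : measurable (h' @^-1` A2) by rewrite -[X in measurable X]setTI; exact: mh'.
apply: etrans (product_measure1E _ _ mA1 mA2) _; rewrite product_measure1E //.
exact: (f_equal2 mule (esym (muh _ mA1)) (esym (nuh' _ mA2))).
Qed.

Section mixing_prod.
Context (R : realType) (G : groupType) d (T : measurableType d) d' (T' : measurableType d').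
Context (mu : probability T R) (nu : probability T' R).
Context (act : G -> T -> T) (act' : G -> T' -> T').

Definition pact (t : G) (p : T * T') := (act t p.1, act' t p.2).

Context (pa : pmp mu act) (pa' : pmp nu act').

Lemma pmp_prod : pmp (mu \x nu)%E pact.
Proof. by move=> t; exact: mpres_prod. Qed.

Lemma Ex_prod (f : bfun R T) (g : bfun R T') (F : bfun R (T * T')%type) :
  (forall x y, F (x, y) = f x * g y) -> Ex (mu \x nu)%E F = Ex mu f * Ex nu g.
Proof.
move=> Ffg; rewrite Ex_bint2 mulrC -ExZ; congr Ex; apply: bfun_eq => x.
rewrite bfunM /= mulrC -ExZ; congr Ex; apply: bfun_eq => y.
by rewrite bfunM /= Ffg.
Qed.

Lemma mixing_prod : mixing pa -> mixing pa' -> mixing pmp_prod.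
Proof.
move=> mx mx'.
apply: (mixing_gen (C := [set A `*` B | A in @measurable _ T & B in @measurable _ T'])).
- exact: measurable_prod_measurableType.
- move=> _ _ [A1 mA1] [A2 mA2] <- [B1 mB1] [B2 mB2] <-.
  rewrite -setXI.
  by exists (A1 `&` B1); [exact: measurableI|exists (A2 `&` B2) => //; exact: measurableI].
- by exists setT => //; exists setT => //; rewrite setXTT.
move=> tau itau A B mA mB [A1 mA1] [A2 mA2] eA [B1 mB1] [B2 mB2] eB.
have bX (C : set (T * T')) (mC : measurable C) C1 (mC1 : measurable C1) C2
  (mC2 : measurable C2) : C1 `*` C2 = C ->
  forall x y, bind R mC (x, y) = bind R mC1 x * bind R mC2 y.
  move=> eC x y; rewrite !bindE -eC -natrM mulnb; congr (_ %:R); congr nat_of_bool.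
  by apply/idP/andP; rewrite !inE /= => -[].
rewrite (Ex_prod (bX _ mA _ mA1 _ mA2 eA)) (Ex_prod (bX _ mB _ mB1 _ mB2 eB)).
have e n : Ex (mu \x nu)%E (bind R mA * bcomp (pmp_prod (tau n)).1 (bind R mB)) =
    Ex mu (bind R mA1 * bcomp (pa (tau n)).1 (bind R mB1)) *
    Ex nu (bind R mA2 * bcomp (pa' (tau n)).1 (bind R mB2)).
  apply: Ex_prod => x y; rewrite !bfunM (bX _ mA _ mA1 _ mA2 eA).
  by rewrite [X in _ * _ * X](bX _ mB _ mB1 _ mB2 eB) /=; ring.
rewrite (_ : (fun n => _) = (fun n => Ex mu (bind R mA1 * bcomp (pa (tau n)).1 (bind R mB1)) *
    Ex nu (bind R mA2 * bcomp (pa' (tau n)).1 (bind R mB2)))); last first.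
  by apply/funext => n; exact: e.
rewrite mulrACA; apply: cvgM; [exact: mx|exact: mx'].
Qed.

End mixing_prod.

Lemma seq_avoid (G : eqType) (tau : nat -> G) (s : seq G) : injective tau ->
  exists N, forall n, (N <= n)%N -> tau n \notin s.
Proof.
move=> itau; elim: s => [|a s [N hN]]; first by exists 0%N.
have [[m ma]|na] := pselect (exists m, tau m = a); last first.
  exists N => n Nn; rewrite inE negb_or hN // andbT; apply/eqP => e.
  by apply: na; exists n.
exists (maxn N m.+1) => n; rewrite geq_max => /andP[Nn mn].
rewrite inE negb_or hN // andbT -ma; apply/eqP => /itau e.
by rewrite e ltnn in mn.
Qed.

Section bernoulli_law.
Context (R : realType) (G : groupType) d (X0 : measurableType d).
Local Notation X := (bernoulli_space G X0).
Context (mu0 : probability X0 R) (mu : probability X R).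
Hypothesis mu_prod : is_product_measure mu0 mu.
Local Notation act := (@bernoulli_action G d X0).

Lemma mu_boxI (F F' : {fset G}) A A' : (forall g, measurable (A g)) ->
  (forall g, measurable (A' g)) -> [disjoint F & F']%fset ->
  mu (box F A `&` box F' A') = (mu (box F A) * mu (box F' A'))%E.
Proof.
move=> mA mA' dF.
pose C g : set X0 := if g \in F then A g else setT.
pose C' g : set X0 := if g \in F' then A' g else setT.
have mC g : measurable (C g) by rewrite /C; case: ifP.
have mC' g : measurable (C' g) by rewrite /C'; case: ifP.
rewrite (box_widen A (fsubsetUl F F')) (box_widen A' (fsubsetUr F F')) -/C -/C'.
have -> : box (F `|` F')%fset C `&` box (F `|` F')%fset C' =
    box (F `|` F')%fset (fun g => C g `&` C' g).
  apply/seteqP; split=> x /= => [[h1 h2] g gF|h]; first by split; [exact: h1|exact: h2].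
  by split=> g /h [].
rewrite !(mu_box mu_prod) //; last by move=> g; exact: measurableI.
rewrite -EFinM -big_split /=; congr (_%:E); apply: eq_bigr => g _.
have T1 : fine (mu0 setT) = 1 by have /= -> := probability_setT mu0.
rewrite /C /C'; case: ifPn => gF; last by rewrite setTI T1 mul1r.
by rewrite (negPf (fdisjointP dF g gF)) setIT T1 mulr1.
Qed.

Lemma mixing_bernoulli : mixing (mpres_act mu_prod).
Proof.
apply: (mixing_gen (C := @boxes G d X0)).
- exact: boxes_gen.
- exact: boxesI.
- exact: boxesT.
move=> tau itau A B mA mB [F [A1 [mA1 eA]]] [F' [B1 [mB1 eB]]].
(* The finitely many elements to avoid are those [t] for which [t^-1 F'] meets [F]; for all others
   the two boxes are independent. *)
have [N hN] := seq_avoid [seq (h * g^-1)%g | h <- F', g <- F] itau.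
apply/cvgrPdist_le => e e0; exists N => // n /= Nn.
have -> : Ex mu (bind R mA * bcomp (mpres_act mu_prod (tau n)).1 (bind R mB)) =
   Ex mu (bind R mA) * Ex mu (bind R mB); last by rewrite subrr normr0 ltW.
have mpB : measurable (act (tau n) @^-1` B).
  by rewrite -[X in measurable X]setTI; exact: (mpres_act mu_prod (tau n)).1.
have mAB : measurable (A `&` act (tau n) @^-1` B) by exact: measurableI.
have -> : bind R mA * bcomp (mpres_act mu_prod (tau n)).1 (bind R mB) = bind R mAB.
  apply: bfun_eq => x; rewrite bfunM /= !indicE -natrM mulnb; congr (_ %:R).
  congr nat_of_bool; apply/andP/idP => [[/set_mem h1 /set_mem h2]|/set_mem [h1 h2]].
    exact/mem_set.
  by split; exact/mem_set.
have mBp : mu B = mu (act (tau n) @^-1` B) by rewrite (mpres_act mu_prod (tau n)).2.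
rewrite !Ex_ind mBp eA eB act_box mu_boxI //; last first.
  apply/fdisjointP => g gF; apply/negP => /imfsetP[h /= hF' gh].
  have := hN n Nn; apply/negP; rewrite negbK; apply/allpairsP; exists (h, g).
  by split=> //=; rewrite gh invgM invgK mulVKg.
rewrite fineM // fin_num_measure //; apply: measurable_box => //.
Qed.

Lemma mix_idem (B : set G) (x y z : X) : mix B (mix B x y) z = mix B x z.
Proof. by apply/funext => g; rewrite /mix; case: (g \in B). Qed.

Lemma mix_swapK (B : set G) (x y : X) : mix B (mix B x y) (mix B y x) = x.
Proof. by apply/funext => g; rewrite /mix; case: (g \in B). Qed.

Lemma mix_comm (B C : set G) (x y z : X) : [disjoint B & C]%classic ->
  mix C (mix B x y) z = mix B (mix C x z) y.
Proof.
move=> BC; apply/funext => g; rewrite /mix.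
case: (boolP (g \in C)) => gC; case: (boolP (g \in B)) => gB //.
suff : (set0 : set G) g by [].
by rewrite -(eqP BC); split; exact/set_mem.
Qed.

(** The conditional expectation given the coordinates outside [B], as an integral over an
    independent copy. *)
Definition res (B : set G) (f : bfun R X) : bfun R X :=
  bint2 mu mu (bcomp (measurable_mix B) f).

Implicit Types f h a : bfun R X.

Lemma resE B f x : res B f x = Ex mu (bsec1 (bcomp (measurable_mix B) f) x).
Proof. by []. Qed.

Lemma resB B f h : res B (f - h) = res B f - res B h.
Proof.
by apply: bfun_eq => x; rewrite bfunB !resE -ExB; congr Ex; exact: bfun_eq.
Qed.

Lemma res_id B f : (forall x y, f (mix B x y) = f x) -> res B f = f.
Proof. by move=> fB; apply: bfun_eq => x; apply: Ex_const => y; exact: fB. Qed.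

Lemma res_mix B f x y : res B f (mix B x y) = res B f x.
Proof. by congr Ex; apply: bfun_eq => z /=; rewrite mix_idem. Qed.

Lemma res_idem B f : res B (res B f) = res B f.
Proof. by apply: res_id => x y; exact: res_mix. Qed.

Lemma resM B a f : (forall x y, a (mix B x y) = a x) -> res B (a * f) = a * res B f.
Proof.
move=> aB; apply: bfun_eq => x; rewrite bfunM !resE -ExZ; congr Ex.
by apply: bfun_eq => y; rewrite [LHS]bfunM /= aB.
Qed.

Lemma res_comm (B C : set G) f : [disjoint B & C]%classic ->
  res B (res C f) = res C (res B f).
Proof.
move=> BC; apply: bfun_eq => x; rewrite !resE.
have mF : measurable_fun setT (fun p : X * X => mix C (mix B x p.1) p.2).
  apply: (measurableT_comp (measurable_mix C) (f := fun p : X * X => mix C p.1 p.2)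
    (g := fun p : X * X => (mix B x p.1, p.2))).
  apply: measurable_fun_pair => //.
  apply: (measurableT_comp (measurable_mix B) (f := fun p : X * X => mix B p.1 p.2)
    (g := fun p : X * X => (x, p.1))).
  by apply: measurable_fun_pair.
have h1 := Ex_bint2 mu mu (bcomp mF f); have h2 := Ex_bint1 mu mu (bcomp mF f).
rewrite h1 in h2; apply: etrans (etrans _ h2) _; congr Ex; apply: bfun_eq => y.
  by congr Ex; exact: bfun_eq.
by congr Ex; apply: bfun_eq => z; rewrite /= mix_comm.
Qed.

(** [mixswap] preserves the measure and exchanges [x] with [mix B x y], so the resampling moves from
    one factor to the other. *)
Lemma res_adj B f h : Ex mu (res B f * h) = Ex mu (f * res B h).
Proof.
pose hB := bcomp (measurable_mix (X0 := X0) B) h.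
pose fB := bcomp (measurable_mix (X0 := X0) B) f.
have m1 : measurable_fun setT (fun p : X * X => p.1) by exact: measurable_fst.
have e1 : Ex mu (res B f * h) = Ex (mu \x mu)%E (bcomp m1 h * fB).
  rewrite Ex_bint2; congr Ex; apply: bfun_eq => x.
  by rewrite bfunM mulrC resE -ExZ; congr Ex; exact: bfun_eq.
have e2 : Ex mu (f * res B h) = Ex (mu \x mu)%E (bcomp m1 f * hB).
  rewrite Ex_bint2; congr Ex; apply: bfun_eq => x.
  by rewrite bfunM resE -ExZ; congr Ex; exact: bfun_eq.
rewrite e1 e2 -(Ex_comp (mpres_mixswap mu_prod B) (bcomp m1 f * hB)); congr Ex.
by apply: bfun_eq => -[x y]; rewrite bcompM !bfunM /= mix_swapK mulrC.
Qed.

End bernoulli_law.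

(** * Resampling coordinates of a Bernoulli space *)

Section cpx.
Context (R : realType) d (T : measurableType d).

(* Bounded measurable complex functions, as pairs of real and imaginary part. *)
Definition cpx := (bfun R T * bfun R T)%type.
Implicit Types f h a : cpx.

Definition cip f h : bfun R T := f.1 * h.1 + f.2 * h.2.
Definition nsq f := cip f f.
Definition cmul f h : cpx := (f.1 * h.1 - f.2 * h.2, f.1 * h.2 + f.2 * h.1).
Definition cunit f := forall x, nsq f x = 1.

Lemma nsqE f x : nsq f x = f.1 x ^+ 2 + f.2 x ^+ 2.
Proof. by rewrite /nsq /cip !bfunE -!expr2. Qed.

Lemma nsq_ge0 f x : 0 <= nsq f x.
Proof. by rewrite nsqE addr_ge0 // sqr_ge0. Qed.

Lemma nsq_cmul f h : nsq (cmul f h) = nsq f * nsq h.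
Proof. by rewrite /nsq /cip /cmul /=; ring. Qed.

Lemma cunit_cmul f h : cunit f -> cunit h -> cunit (cmul f h).
Proof. by move=> uf uh x; rewrite nsq_cmul bfunM uf uh mulr1. Qed.

Lemma cmulB a f h : cmul a (f - h) = cmul a f - cmul a h.
Proof. by rewrite /cmul /=; congr (_, _) => /=; ring. Qed.

Lemma cmulC f h : cmul f h = cmul h f.
Proof. by rewrite /cmul; congr (_, _); ring. Qed.

Definition cconj f : cpx := (f.1, - f.2).

Lemma cunit_cconj f : cunit f -> cunit (cconj f).
Proof. by move=> uf x; have := uf x; rewrite !nsqE /= sqrrN. Qed.

Lemma cmulK f h : cunit h -> cmul (cmul f h) (cconj h) = f.
Proof.
move=> uh; rewrite [RHS]surjective_pairing; congr (_, _); apply: bfun_eq => x;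
  have := uh x; rewrite nsqE => e.
- change ((f.1 x * h.1 x - f.2 x * h.2 x) * h.1 x -
    (f.1 x * h.2 x + f.2 x * h.1 x) * - h.2 x = f.1 x).
  by rewrite -[RHS]mulr1 -e; ring.
- change ((f.1 x * h.1 x - f.2 x * h.2 x) * - h.2 x +
    (f.1 x * h.2 x + f.2 x * h.1 x) * h.1 x = f.2 x).
  by rewrite -[RHS]mulr1 -e; ring.
Qed.

Context (mu : probability T R).

(** The real part of the complex inner product. It suffices for the law of the random set, since
    resampling acts separately on real and imaginary parts. *)
Definition ip f h := Ex mu (cip f h).

Lemma ip_ge0 f : 0 <= ip f f.
Proof. by apply: Ex_ge0 => x; exact: nsq_ge0. Qed.

Lemma ip_unit f : cunit f -> ip f f = 1.
Proof. by move=> uf; rewrite -(Ex1 mu); congr Ex; exact: bfun_eq. Qed.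

Lemma ip_cmul_le a f : (forall x, nsq a x <= 1) -> ip (cmul a f) (cmul a f) <= ip f f.
Proof.
move=> a1; apply: Ex_le => x; have := nsq_cmul a f; rewrite /nsq => ->.
by rewrite bfunM ler_piMl ?a1 //; exact: nsq_ge0.
Qed.

Lemma ip_amgm_cpx (l : R) f h : 0 < l ->
  2 * `|ip f h| <= l * ip f f + l^-1 * ip h h.
Proof.
move=> l0; have lV : l * l^-1 = 1 by rewrite divff // gt_eqF.
have l'0 : 0 < l^-1 by rewrite invr_gt0.
have key (s : R) : s ^+ 2 = 1 -> 0 <= l * ip f f + l^-1 * ip h h + 2 * s * ip f h.
  move=> s1; rewrite -!ExZ -!ExD; apply: Ex_ge0 => x.
  rewrite /cip !bfunE /=.
  have -> : l * (f.1 x * f.1 x + f.2 x * f.2 x) + l^-1 * (h.1 x * h.1 x + h.2 x * h.2 x) +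
     2 * s * (f.1 x * h.1 x + f.2 x * h.2 x) =
     l * ((f.1 x + s * l^-1 * h.1 x) ^+ 2 + (f.2 x + s * l^-1 * h.2 x) ^+ 2).
    have -> : l * ((f.1 x + s * l^-1 * h.1 x) ^+ 2 + (f.2 x + s * l^-1 * h.2 x) ^+ 2) =
      l * (f.1 x * f.1 x + f.2 x * f.2 x) + 2 * s * (l * l^-1) * (f.1 x * h.1 x + f.2 x * h.2 x)
      + s ^+ 2 * (l * l^-1) * l^-1 * (h.1 x * h.1 x + h.2 x * h.2 x) by ring.
    by rewrite lV s1; ring.
  by rewrite mulr_ge0 ?addr_ge0 ?sqr_ge0 // ltW.
have h1 := key 1 (expr1n _ _); have h2 := key (-1) ltac:(by rewrite sqrrN expr1n).
move: h1 h2; move: (ip f f) (ip h h) (ip f h) (l^-1) => A B C k h1 h2.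
by have [b0|b0] := ger0P C; lra.
Qed.

End cpx.

Section ccomp.
Context (R : realType) d (T : measurableType d) d' (T' : measurableType d').

Definition ccomp (h : T -> T') (mh : measurable_fun setT h) (f : cpx R T') : cpx R T :=
  (bcomp mh f.1, bcomp mh f.2).

Lemma nsq_ccomp (h : T -> T') mh f : nsq (@ccomp h mh f) = bcomp mh (nsq f).
Proof. exact: bfun_eq. Qed.

Lemma cunit_ccomp (h : T -> T') mh f : cunit f -> cunit (@ccomp h mh f).
Proof. by move=> uf x; rewrite nsq_ccomp; exact: uf. Qed.

Lemma ip_ccomp (mu : probability T R) (nu : probability T' R) (h : T -> T')
    (hp : mpres mu nu h) f g : ip mu (ccomp hp.1 f) (ccomp hp.1 g) = ip nu f g.
Proof. by rewrite /ip -(Ex_comp hp); congr Ex; exact: bfun_eq. Qed.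

End ccomp.

Section resampling_bernoulli.
Context (R : realType) (G : groupType) d (X0 : measurableType d).
Local Notation X := (bernoulli_space G X0).
Context (mu0 : probability X0 R) (mu : probability X R).
Hypothesis mu_prod : is_product_measure mu0 mu.
Implicit Types (f h a W : cpx R X) (B : set G).

Definition cres B f : cpx R X := (res mu B f.1, res mu B f.2).

Lemma cresB B f h : cres B (f - h) = cres B f - cres B h.
Proof. by rewrite /cres !resB. Qed.

Lemma resampling_bernoulli : resampling (ip mu) (fun g => cres [set g]).
Proof.
split.
- move=> f f' h; rewrite /ip -ExB; congr Ex; rewrite /cip /=; ring.
- by move=> f h; rewrite /ip; congr Ex; rewrite /cip /=; ring.
- exact: ip_ge0.
- exact: ip_amgm_cpx.
- by move=> g f h; exact: cresB.
- by move=> g f; rewrite /cres /= !res_idem.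
- move=> g g' f; have [->//|gg'] := eqVneq g g'.
  have dg : [disjoint [set g] & [set g']]%classic.
    apply/eqP/seteqP; split=> // x [/= -> e]; by rewrite e eqxx in gg'.
  by rewrite /cres /= !(res_comm _ _ dg).
- by move=> g f h; rewrite /ip /cip !ExD /= !(res_adj mu_prod).
Qed.

Definition depends (F : seq G) a := forall g, g \notin F -> forall x y,
  a.1 (mix [set g] x y) = a.1 x /\ a.2 (mix [set g] x y) = a.2 x.

Lemma cres_cmul (F : seq G) a g f : depends F a -> g \notin F ->
  cres [set g] (cmul a f) = cmul a (cres [set g] f).
Proof.
move=> dF gF; have a1 x y : a.1 (mix [set g] x y) = a.1 x by have [] := dF g gF x y.
have a2 x y : a.2 (mix [set g] x y) = a.2 x by have [] := dF g gF x y.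
rewrite /cres /cmul /= resB !(resM _ _ a1) !(resM _ _ a2); congr (_, _).
have e : a.1 * f.2 + a.2 * f.1 = a.1 * f.2 - (- a.2) * f.1 by ring.
have na2 x y : (- a.2) (mix [set g] x y) = (- a.2) x by rewrite !bfunN a2.
by rewrite e resB !(resM _ _ a1) (resM _ _ na2); ring.
Qed.

Lemma depends_cres (F : seq G) a g : depends F a -> g \notin F ->
  cres [set g] a = a.
Proof.
move=> dF gF; rewrite [RHS]surjective_pairing /cres; congr (_, _); apply: res_id => x y;
by have [] := dF g gF x y.
Qed.

Lemma depends_res (F : {fset G}) W : depends F (cres (~` [set` F]) W).
Proof.
move=> g gF x y; suff e z : mix (~` [set` F]) (mix [set g] x y) z = mix (~` [set` F]) x z.
  by split; congr Ex; apply: bfun_eq => z /=; rewrite e.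
apply/funext => k; rewrite /mix; case: ifPn => // kF.
case: ifPn => // /set_mem /= kg; exfalso.
by move/negP: kF; apply; apply/mem_set => /=; rewrite kg; exact/negP.
Qed.

Lemma mpres_fst d1 (T1 : measurableType d1) d2 (T2 : measurableType d2)
    (m1 : probability T1 R) (m2 : probability T2 R) :
  mpres (m1 \x m2)%E m1 (fun p : T1 * T2 => p.1).
Proof.
split; first exact: measurable_fst.
move=> A mA; rewrite (_ : _ @^-1` A = A `*` setT); last first.
  by apply/seteqP; split=> x //= [].
apply: etrans (product_measure1E m1 m2 mA measurableT) _.
by rewrite -[RHS]mule1; congr (_ * _)%E; exact: probability_setT.
Qed.

Lemma mpres_snd d1 (T1 : measurableType d1) d2 (T2 : measurableType d2)
    (m1 : probability T1 R) (m2 : probability T2 R) :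
  mpres (m1 \x m2)%E m2 (fun p : T1 * T2 => p.2).
Proof.
split; first exact: measurable_snd.
move=> A mA; rewrite (_ : _ @^-1` A = setT `*` A); last first.
  by apply/seteqP; split=> x //= [].
apply: etrans (product_measure1E m1 m2 measurableT mA) _.
by rewrite -[RHS]mul1e; congr (_ * _)%E; exact: probability_setT.
Qed.

Lemma mpres_comp d1 (T1 : measurableType d1) d2 (T2 : measurableType d2)
    d3 (T3 : measurableType d3)
    (m1 : probability T1 R) (m2 : probability T2 R) (m3 : probability T3 R)
    (h : T1 -> T2) (k : T2 -> T3) :
  mpres m1 m2 h -> mpres m2 m3 k -> mpres m1 m3 (k \o h).
Proof.
move=> [mh eh] [mk ek]; split; first exact: measurableT_comp.
move=> A mA; rewrite comp_preimage eh ?ek //.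
by rewrite -[X in measurable X]setTI; exact: mk.
Qed.

Lemma mpres_mix B : mpres (mu \x mu)%E mu (fun p : X * X => mix B p.1 p.2).
Proof. exact: mpres_comp (mpres_mixswap mu_prod B) (mpres_fst mu mu). Qed.

(** Replacing the coordinates outside [F'] does nothing to a box supported in [F']. The property
    passes to all bounded functions because the error [D F'] is subadditive and, mixing being
    measure preserving, at most twice the L1 norm, uniformly in [F']. *)
Lemma tail_approx (f : bfun R X) (e : R) : 0 < e -> exists F : {fset G},
  forall F' : {fset G}, (F `<=` F')%fset ->
    Ex (mu \x mu)%E (babs (bcomp (mpres_fst mu mu).1 f -
      bcomp (mpres_mix (~` [set` F'])).1 f)) <= e.
Proof.
move: f e; pose D (F' : {fset G}) (f : bfun R X) := Ex (mu \x mu)%E (babs (bcomp (mpres_fst mu mu).1 f -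
      bcomp (mpres_mix (~` [set` F'])).1 f)).
have Dx F' (f : bfun R X) x : babs (bcomp (mpres_fst mu mu).1 f -
    bcomp (mpres_mix (~` [set` F'])).1 f) x =
  `|f x.1 - f (mix (~` [set` F']) x.1 x.2)| by [].
have DD F' (f g : bfun R X) : D F' (f + g) <= D F' f + D F' g.
  rewrite /D -ExD; apply: Ex_le => x; rewrite bfunD !Dx !bfunD opprD addrACA.
  exact: ler_normD.
have DE F' (f : bfun R X) : D F' f <= 2 * Ex mu (babs f).
  rewrite /D mulr_natl mulr2n -{1}(Ex_comp (mpres_fst mu mu) (babs f)).
  rewrite -(Ex_comp (mpres_mix (~` [set` F'])) (babs f)) -ExD; apply: Ex_le => x.
  by rewrite bfunD Dx; exact: ler_normB.
have DZ F' (c : R) (f : bfun R X) : D F' (bcst _ c * f) = `|c| * D F' f.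
  rewrite /D -ExZ; congr Ex; apply: bfun_eq => x.
  by rewrite bfunM !Dx !bfunM /= -normrM mulrBr.
suff H : forall f : bfun R X, forall e : R, 0 < e -> exists F : {fset G}, forall F' : {fset G},
  (F `<=` F')%fset -> D F' f <= e by [].
apply: (bfun_class (mu := mu) (C := @boxes G d X0)).
- exact: boxes_gen.
- exact: boxesI.
- exact: boxesT.
- move=> A mA [F [A0 [mA0 eA]]] e e0; exists F => F' FF'.
  rewrite (_ : D F' _ = 0) ?ltW //; apply: Ex_const => -[x y]; rewrite Dx; apply/eqP.
  rewrite normr_eq0 !bindE /= (_ : (x \in A) = (mix (~` [set` F']) x y \in A)) ?subrr //.
  have mixF g : g \in F -> mix (~` [set` F']) x y g = x g.
    move=> gF; rewrite /mix; case: ifPn => // /set_mem; case.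
    exact: (fsubsetP FF').
  by apply/idP/idP => /set_mem; rewrite eA /= => h; apply/mem_set => g gF /=;
    have := h g gF; rewrite mixF.
- move=> f g Df Dg e e0; have e2 : 0 < e / 2 by rewrite divr_gt0.
  have [F1 h1] := Df _ e2; have [F2 h2] := Dg _ e2; exists (F1 `|` F2)%fset => F'.
  rewrite fsubUset => /andP[/h1 ? /h2 ?]; have := DD F' f g; lra.
- move=> c f Df e e0; have c0 : 0 < `|c| + 1 by rewrite ltr_wpDl.
  have [F hF] := Df _ (divr_gt0 e0 c0); exists F => F' /hF h; rewrite DZ.
  apply: le_trans (ler_wpM2l (normr_ge0 c) h) _.
  by rewrite mulrCA ger_pMr // ler_pdivrMr // mul1r lerDl.
- move=> f H e e0; have e4 : 0 < e / 4 by rewrite divr_gt0.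
  have [g Dg fg] := H _ e4; have [F hF] := Dg _ e4; exists F => F' /hF h.
  have := DD F' (f - g) g; rewrite subrK => h1; have := DE F' (f - g); lra.
Qed.

End resampling_bernoulli.

(** * The random set of a function of modulus one on a Bernoulli space *)

Section law_bernoulli.
Context (R : realType) (G : groupType) d (X0 : measurableType d).
Local Notation X := (bernoulli_space G X0).
Context (mu0 : probability X0 R) (mu : probability X R).
Hypothesis mu_prod : is_product_measure mu0 mu.
Local Notation act := (@bernoulli_action G d X0).
Local Notation P := (fun g => cres mu [set g]).
Local Notation rs := (resampling_bernoulli mu_prod).
Implicit Types (f h a W : cpx R X) (B : set G) (u : seq G -> R).

Lemma actM (s t : G) (x : X) : act (s * t)%g x = act s (act t x).
Proof.
by apply/funext => k; rewrite /bernoulli_action invgM mulgA.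
Qed.

Lemma act1 (x : X) : act 1%g x = x.
Proof. by apply/funext => k; rewrite /bernoulli_action invg1 mul1g. Qed.

Lemma actK (t : G) (x : X) : act t^-1%g (act t x) = x.
Proof. by rewrite -actM mulVg act1. Qed.

Lemma actVK (t : G) (x : X) : act t (act t^-1%g x) = x.
Proof. by rewrite -actM mulgV act1. Qed.

Definition cact (t : G) : cpx R X -> cpx R X := ccomp (mpres_act mu_prod t^-1%g).1.

Lemma cactB t f h : cact t (f - h) = cact t f - cact t h.
Proof. by rewrite /cact /ccomp /=; congr (_, _); exact: bfun_eq. Qed.

Lemma cact1 f : cact 1%g f = f.
Proof.
rewrite [RHS]surjective_pairing /cact /ccomp; congr (_, _); apply: bfun_eq => x /=;
by rewrite invg1 act1.
Qed.

Lemma act_mix (t g : G) (x y : X) :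
  act t^-1%g (mix [set (t * g)%g] x y) = mix [set g] (act t^-1%g x) (act t^-1%g y).
Proof.
apply/funext => k; rewrite /bernoulli_action /mix invgK.
have -> : ((t * k)%g \in [set (t * g)%g]) = (k \in [set g]) => //.
by apply/idP/idP => /set_mem /= h; apply/mem_set => /=; [exact: mulgI h|rewrite h].
Qed.

Lemma cres_cact t g f : P (t * g)%g (cact t f) = cact t (P g f).
Proof.
have key (f0 : bfun R X) : res mu [set (t * g)%g] (bcomp (mpres_act mu_prod t^-1%g).1 f0) =
    bcomp (mpres_act mu_prod t^-1%g).1 (res mu [set g] f0).
  apply: bfun_eq => x.
  rewrite [RHS](_ : _ = res mu [set g] f0 (act t^-1%g x)) // !resE.
  rewrite -[RHS](Ex_comp (mpres_act mu_prod t^-1%g)); congr Ex.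
  by apply: bfun_eq => y /=; rewrite act_mix.
by rewrite /cres /cact /ccomp /= !key.
Qed.

Lemma ip_cact t f h : ip mu (cact t f) (cact t h) = ip mu f h.
Proof. exact: ip_ccomp. Qed.

Lemma depends_cact t (F : seq G) a : depends F a ->
  depends (map (fun g => t * g)%g F) (cact t a).
Proof.
move=> dF g gF x y; have gF' : (t^-1 * g)%g \notin F.
  by apply: contra gF => gF; apply/mapP; exists (t^-1 * g)%g => //; rewrite mulVKg.
by rewrite /= -[g](mulVKg t) !act_mix; exact: dF.
Qed.

Lemma Ex_abs_res (B : set G) (f : bfun R X) :
  Ex mu (babs (f - res mu B f)) <=
  Ex (mu \x mu)%E (babs (bcomp (mpres_fst mu mu).1 f - bcomp (mpres_mix mu_prod B).1 f)).
Proof.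
rewrite Ex_bint2; apply: Ex_le => x.
have bint2E F : bint2 mu mu F x = Ex mu (bsec1 F x) by [].
rewrite bint2E [leLHS](_ : _ = `|f x - res mu B f x|) //.
rewrite resE -{1}(Ex_cst mu (f x)) -ExB; apply: le_trans (Ex_norm _ _) _.
by apply: Ex_le => y.
Qed.

Lemma cunit_le W : cunit W -> forall x, `|W.1 x| <= 1 /\ `|W.2 x| <= 1.
Proof.
move=> uW x; have := uW x; rewrite nsqE => e.
by split; rewrite -(@ler_pXn2r _ 2) ?nnegrE // expr1n real_normK ?num_real // -e
  ?lerDl ?lerDr sqr_ge0.
Qed.

Lemma cres_sqr_le B (f : bfun R X) : (forall x, `|f x| <= 1) ->
  Ex mu ((f - res mu B f) * (f - res mu B f)) <= 2 * Ex mu (babs (f - res mu B f)).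
Proof.
move=> f1; have r1 x : `|res mu B f x| <= 1 by apply: Ex_norm_le => y; exact: f1.
rewrite -ExZ; apply: Ex_le => x; rewrite !bfunM /= -expr2 -real_normK ?num_real //.
rewrite expr2 ler_wpM2r // (le_trans (ler_normB _ _)) //.
have := f1 x; have := r1 x; move: (`|f x|) (`|res mu B f x|) => A C; lra.
Qed.

Lemma nsq_cres_le B W : cunit W -> forall x, nsq (cres mu B W) x <= 1.
Proof.
move=> uW x; rewrite nsqE /=.
apply: le_trans (lerD (Ex_sqr_le _ _) (Ex_sqr_le _ _)) _; rewrite -ExD.
rewrite -[leRHS](Ex1 mu); apply: Ex_le => y.
rewrite bfunD !bfunM /= -!expr2 -nsqE; by rewrite uW.
Qed.

Lemma ip_cres B W : ip mu (W - cres mu B W) (W - cres mu B W) =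
  ip mu W W - ip mu (cres mu B W) (cres mu B W).
Proof.
have e1 := res_adj mu_prod B W.1 (res mu B W.1).
have e2 := res_adj mu_prod B W.2 (res mu B W.2).
rewrite res_idem in e1; rewrite res_idem in e2.
have key (w r : bfun R X) : Ex mu (r * r) = Ex mu (w * r) ->
    Ex mu ((w - r) * (w - r)) = Ex mu (w * w) - Ex mu (r * r).
  move=> e; have -> : (w - r) * (w - r) = w * w - w * r - (w * r - r * r) by ring.
  by rewrite !ExB -e subrr subr0.
by rewrite /ip /cip !ExD (key _ _ e1) (key _ _ e2) addrACA -opprD.
Qed.

Lemma finite_approx W (e : R) : cunit W -> 0 < e -> exists (F : seq G) a,
  [/\ depends F a, forall x, nsq a x <= 1, ip mu (W - a) (W - a) <= e &
      1 - ip mu a a <= e].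
Proof.
(* Each of the two components contributes to the squared norm at most twice its L1 error, by
   [cres_sqr_le]; hence the quarter. *)
move=> uW e0; have e4 : 0 < e / 4 by rewrite divr_gt0.
have [F1 h1] := tail_approx mu_prod W.1 e4; have [F2 h2] := tail_approx mu_prod W.2 e4.
have {}h1 := h1 _ (fsubsetUl F1 F2); have {}h2 := h2 _ (fsubsetUr F1 F2).
set F := (F1 `|` F2)%fset in h1 h2.
have W1 x : `|W.1 x| <= 1 by have [] := cunit_le uW x.
have W2 x : `|W.2 x| <= 1 by have [] := cunit_le uW x.
have We : ip mu (W - cres mu (~` [set` F]) W) (W - cres mu (~` [set` F]) W) <= e.
  rewrite /ip /cip ExD /=.
  have := cres_sqr_le (~` [set` F]) W1; have := cres_sqr_le (~` [set` F]) W2.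
  have := le_trans (Ex_abs_res (~` [set` F]) W.1) h1.
  have := le_trans (Ex_abs_res (~` [set` F]) W.2) h2.
  set A := Ex _ (babs _); set C := Ex _ (babs _).
  set D := Ex _ _; set E := Ex _ _.
  clearbody A C D E; move=> {h1 h2 W1 W2 uW e4} ? ? ? ?; lra.
exists F, (cres mu (~` [set` F]) W); split=> //.
- exact: depends_res.
- exact: nsq_cres_le.
- by rewrite -(ip_unit mu uW) -ip_cres.
Qed.

Lemma ip_le1 a : (forall x, nsq a x <= 1) -> ip mu a a <= 1.
Proof. by move=> a1; rewrite -[leRHS](Ex1 mu); apply: Ex_le => x; exact: a1. Qed.

Lemma tight_unit W : cunit W -> tight (ip mu) P W.
Proof.
move=> uW e e0; have [F [a [dF a1 We _]]] := finite_approx uW e0.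
exists F, a; split=> //; last by rewrite (ip_unit mu uW) ip_le1.
by move=> g gF; exact: depends_cres dF gF.
Qed.

Local Notation law := (Lw (ip mu) P).

Lemma law_null W W' u : cunit W -> cunit W' -> adm u ->
  ip mu (W - W') (W - W') = 0 -> law W u = law W' u.
Proof.
move=> uW uW' au e0; apply/eqP; rewrite -subr_eq0 -normr_eq0 eq_le normr_ge0 andbT.
have [pu [K uK]] := au; have K0 : 0 <= K by exact: le_trans (uK [::]).
apply/ler_addgt0Pr => e e_gt0; rewrite add0r.
have [n n0 H] := q_close rs K0 ler01 e_gt0.
apply: (Lw_dist rs) => //; try exact: tight_unit.
exists [::] => E uE _; apply: H => //.
- by rewrite ip_unit.
- by rewrite ip_unit.
- by rewrite e0 ltW.
Qed.

Lemma law_cact (t : G) W u : law (cact t W) u =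
  law W (fun T => u (map (fun g => t * g)%g T)).
Proof.
apply: (Lw_map (s' := fun g => (t^-1 * g)%g)) => //.
- exact: mulKg.
- exact: mulVKg.
- exact: cactB.
- exact: ip_cact.
- by move=> g f; exact: cres_cact.
Qed.

(* The random set of [W h] coincides with that of [h] off a finite set which
   depends on [W] only, up to a small probability. *)
Lemma law_cmul W (K e : R) : cunit W -> 0 <= K -> 0 < e -> exists F : seq G,
  forall (t : G) h u (k : R), cunit h -> adm u -> (forall T, `|u T| <= K) ->
    (forall T, uniq T -> `|u T - u (seq.filter
      (predC (mem (map (fun g => t * g)%g F))) T)| <= k) ->
    `|law (cmul (cact t W) h) u - law h u| <= e + 2 * k.
Proof.
move=> uW K0 e0; have [n n0 H] := Lw_mult rs ler01 K0 e0.
have [F [a [dF a1 We ae]]] := finite_approx uW n0.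
exists F => t h u k uh au uK uF.
have uWt : cunit (cact t W) by exact: cunit_ccomp.
have a1t x : nsq (cact t a) x <= 1 by rewrite nsq_ccomp /=; exact: a1.
have cmulBl f f' g : cmul f g - cmul f' g = cmul (f - f') g.
  by rewrite /cmul /=; congr (_, _) => /=; ring.
have ipu f g : cunit g -> ip mu (cmul f g) (cmul f g) = ip mu f f.
  move=> ug; rewrite /ip; congr Ex; have := nsq_cmul f g; rewrite /nsq => ->.
  by apply: bfun_eq => x; rewrite bfunM; have := ug x; rewrite /nsq => ->; rewrite mulr1.
rewrite -[X in e + X]mulr1.
(* [m] multiplies by the translate of the finite approximant [a]. It commutes with resampling off
   the translate of [F], and it nearly preserves the norm of [h] because [1 - ip a a] is small;
   neither bound depends on [t]. *)
apply: (H (cmul (cact t a)) _ _ _ (map (fun g => t * g)%g F)) => //.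
- exact/tight_unit/cunit_cmul.
- exact: tight_unit.
- by rewrite ip_unit //; exact: cunit_cmul.
- by rewrite ip_unit.
- by move=> f g; exact: cmulB.
- by move=> f; exact: ip_cmul_le.
- by move=> g gF f; exact: (cres_cmul mu f (depends_cact dF) gF).
- by rewrite cmulBl ipu // -cactB ip_cact.
- by rewrite ipu // ip_cact ip_unit.
Qed.

End law_bernoulli.

(** * Noise *)

Lemma mpres_of_Ex (R : realType) d d' (T : measurableType d) (T' : measurableType d')
    (mu : probability T R) (nu : probability T' R) (h : T -> T')
    (mh : measurable_fun setT h) :
  (forall f : bfun R T', Ex mu (bcomp mh f) = Ex nu f) -> mpres mu nu h.
Proof.
move=> H; split=> // A mA.
have mhA : measurable (h @^-1` A) by rewrite -[X in measurable X]setTI; exact (mh measurableT A mA).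
have := H (bind R mA); rewrite Ex_ind.
have -> : bcomp mh (bind R mA) = bind R mhA by exact: bfun_eq.
rewrite Ex_ind => e.
by rewrite -[LHS]fineK ?fin_num_measure // -[RHS]fineK ?fin_num_measure // e.
Qed.

Lemma mem_self (T : Type) (x : T) : x \in [set x].
Proof. exact/mem_set. Qed.

Lemma nsqB (R : realType) d (T : measurableType d) (a b : cpx R T) :
  nsq (a - b) = nsq a + nsq b - (cip a b + cip a b).
Proof. by rewrite /nsq /cip /=; ring. Qed.

Section noise.
Context (R : realType) (G : groupType) d (X0 : measurableType d).
Local Notation X := (bernoulli_space G X0).
Context (mu0 : probability X0 R) (mu : probability X R).
Hypothesis mu_prod : is_product_measure mu0 mu.
Local Notation act := (@bernoulli_action G d X0).
Local Notation P := (fun g => cres mu [set g]).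
Local Notation Z := (X * (X * X))%type.
Local Notation muZ := (mu \x (mu \x mu))%E.

(** The labels form one more point of the same Bernoulli space. The coordinates are thus marked
    independently, with probability [mu0 A], by a rule that follows the action; and disjoint label
    sets mark disjoint sets of coordinates. *)
Definition marked (A : set X0) (E : set G) (v : X) : set G :=
  E `&` [set g | A (v g)].

(* In [z = (v, (x, y))], the coordinate [x g] is replaced by [y g] when [g] is
   in [E] and the label [v g] is in [A]. *)
Definition noise (A : set X0) (E : set G) (z : Z) : X :=
  mix (marked A E z.1) z.2.1 z.2.2.

Lemma measurable_label (A : set X0) (g : G) : measurable A ->
  measurable [set v : X | A (v g)].
Proof.
by move=> mA; have := measurable_coord g measurableT mA; rewrite setTI.
Qed.

Lemma measurable_noise_fun (A : set X0) (E : set G) (h k : Z -> X) : measurable A ->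
  measurable_fun setT h -> measurable_fun setT k ->
  measurable_fun setT (fun z : Z => mix (marked A E z.1) (h z) (k z)).
Proof.
move=> mA mh mk; apply: measurable_bernoulli => g.
have [gE|gE] := boolP (g \in E); last first.
  rewrite (_ : (fun z => _) = (fun z => h z g)).
    exact: (measurableT_comp (measurable_coord g)).
  apply/funext => z; rewrite /mix; case: ifPn => // /set_mem[/mem_set].
  by rewrite (negPf gE).
rewrite (_ : (fun z => _) = (fun z => if z.1 \in [set v : X | A (v g)] then k z g else h z g)).
  apply: measurable_fun_ifT.
  - apply: (@measurable_fun_bool _ _ _ _ true); rewrite setTI.
    rewrite (_ : _ @^-1` _ = fst @^-1` [set v : X | A (v g)]).
      have := @measurable_fst _ _ X (X * X)%type measurableT _ (measurable_label g mA).
      by rewrite setTI.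
    by apply/seteqP; split=> z /= => [/set_mem|/mem_set].
  - exact: (measurableT_comp (measurable_coord g)).
  - exact: (measurableT_comp (measurable_coord g)).
apply/funext => z; rewrite /mix /marked.
have -> // : (g \in E `&` [set g0 | A (z.1 g0)]) = (z.1 \in [set v : X | A (v g)]).
by apply/idP/idP => /set_mem /= => [[_ h1]|h1]; apply/mem_set => //; split=> //; exact/set_mem.
Qed.

Let mx : measurable_fun setT (fun z : Z => z.2.1).
Proof. exact: (measurableT_comp measurable_fst measurable_snd). Qed.

Let my : measurable_fun setT (fun z : Z => z.2.2).
Proof. exact: (measurableT_comp measurable_snd measurable_snd). Qed.

Definition noiseswap (A : set X0) (E : set G) (z : Z) : Z :=
  (z.1, mixswap (marked A E z.1) z.2).

Lemma measurable_noiseswap (A : set X0) (E : set G) : measurable A ->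
  measurable_fun setT (noiseswap A E).
Proof.
move=> mA; apply: measurable_fun_pair; first exact: measurable_fst.
by apply: measurable_fun_pair; exact: measurable_noise_fun.
Qed.

Lemma mpres_noiseswap (A : set X0) (E : set G) : measurable A ->
  mpres muZ muZ (noiseswap A E).
Proof.
move=> mA; apply: (@mpres_of_Ex _ _ _ _ _ muZ muZ _ (measurable_noiseswap E mA)) => f.
rewrite !Ex_bint2; congr Ex; apply: bfun_eq => v.
rewrite [LHS](_ : _ = Ex (mu \x mu)%E (bcomp (mpres_mixswap mu_prod (marked A E v)).1 (bsec1 f v))).
  by rewrite Ex_comp.
by congr Ex; exact: bfun_eq.
Qed.

Lemma mpres_x : mpres muZ mu (fun z : Z => z.2.1).
Proof. exact: mpres_comp (mpres_snd mu (mu \x mu)%E) (mpres_fst mu mu). Qed.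

Lemma mpres_noise (A : set X0) (E : set G) : measurable A ->
  mpres muZ mu (noise A E).
Proof. by move=> mA; exact: mpres_comp (mpres_noiseswap E mA) mpres_x. Qed.

(** * Noise as resampling, one coordinate at a time *)

Section link.
Variables (A : set X0) (mA : measurable A).
Implicit Types (f h : bfun R X) (E : set G).
Local Notation p := (fine (mu0 A)).

Let F E f h : bfun R Z := bcomp mpres_x.1 f * bcomp (mpres_noise E mA).1 h.
Let L E f h : bfun R X := bint2 mu (mu \x mu)%E (F E f h).
Let lab (g : G) : bfun R X := bind R (measurable_label g mA).

Lemma Ex_res B f : Ex mu (res mu B f) = Ex mu f.
Proof.
have := res_adj mu_prod B f 1; rewrite mulr1 => ->.
by rewrite (_ : res mu B 1 = 1) ?mulr1 //; apply: res_id.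
Qed.

Lemma Ex_label g : Ex mu (lab g) = p.
Proof.
rewrite Ex_ind (_ : [set v : X | A (v g)] = box [fset g]%fset (fun=> A)).
  by rewrite (mu_box mu_prod) //= big_seq_fset1.
apply/seteqP; split=> v /= Av; first by move=> k /fset1P ->.
by apply: Av; rewrite fset11.
Qed.

Let L_step E f h g : ~ E g ->
  L (E `|` [set g]) f h = lab g * L E f (res mu [set g] h) + (1 - lab g) * L E f h.
Proof.
move=> gE; apply: bfun_eq => v.
have LE E' h' : L E' f h' v = Ex (mu \x mu)%E (bsec1 (F E' f h') v) by [].
rewrite bfunD !bfunM bfunD bfunN bfun1 !LE [lab g v]bindE.
have [Av|Av] := pselect (A (v g)); last first.
  rewrite memNset // mul0r add0r subr0 mul1r; congr Ex; apply: bfun_eq => -[x y] /=.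
  congr (_ * _); congr (h _); rewrite /noise /=; congr mix.
  by apply/seteqP; split=> k [] // => [[] // -> //|Ek ?]; split=> //; left.
rewrite mem_set // subrr mul0r addr0 mul1r !Ex_bint2; congr Ex; apply: bfun_eq => x.
pose B := marked A E v; have gB : g \notin B by apply/negP => /set_mem [].
have eC : marked A (E `|` [set g]) v = B `|` [set g].
  apply/seteqP; split=> k [].
    by move=> [Ek|->] Ak; [left|right].
  by move=> [Ek Ak]; split=> //; left.
  by move=> ->; split=> //; right.
pose k := bsec1 (bcomp (measurable_mix (X0 := X0) (B `|` [set g])) h) x.
pose k' := bsec1 (bcomp (measurable_mix (X0 := X0) B) (res mu [set g] h)) x.
rewrite [LHS](_ : _ = Ex mu (bcst _ (f x) * k)); last first.
  congr Ex; apply: bfun_eq => y; rewrite [RHS](_ : _ = f x * h (mix (B `|` [set g]) x y)) // -eC.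
  by [].
rewrite [RHS](_ : _ = Ex mu (bcst _ (f x) * k')); last first.
  by congr Ex; exact: bfun_eq.
rewrite !ExZ -(Ex_res [set g] k); congr (_ * Ex mu _); apply: bfun_eq => y.
rewrite [RHS](_ : _ = res mu [set g] h (mix B x y)) // !resE; congr Ex.
apply: bfun_eq => z /=; congr (h _); apply/funext => j; rewrite /mix in_setU.
have [->|jg] := eqVneq j g; first by rewrite mem_self orbT.
by rewrite (_ : (j \in [set g]) = false) ?orbF //; apply/negP => /set_mem /= e; rewrite e eqxx in jg.
Qed.

(** By [L_step], given the labels, the coordinate [g] is resampled exactly when its own label lies
    in [A]. As [g] is not in [E], that label is independent of [L E f h] and contributes the factor
    [p]. *)
Lemma Ex_noise_step E f h g : ~ E g ->
  Ex muZ (F (E `|` [set g]) f h) =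
  p * Ex muZ (F E f (res mu [set g] h)) + (1 - p) * Ex muZ (F E f h).
Proof.
move=> gE; have FL E' h' : Ex muZ (F E' f h') = Ex mu (L E' f h').
  exact: Ex_bint2.
rewrite !FL L_step //.
have Linv h' x y : L E f h' (mix [set g] x y) = L E f h' x.
  have mixE k : E k -> mix [set g] x y k = x k.
    move=> Ek; rewrite /mix (_ : (k \in [set g]) = false) //.
    by apply/negP => /set_mem /= kg; rewrite kg in Ek.
  congr Ex; apply: bfun_eq => z /=; congr (_ * _); congr (h' _); rewrite /noise /=; congr mix.
  by apply/seteqP; split=> k [Ek /= Ak]; split=> //=; move: Ak; rewrite mixE.
have rlab : res mu [set g] (lab g) = bcst _ p.
  apply: bfun_eq => x; rewrite resE; apply: (etrans _ (Ex_label g)); congr Ex; apply: bfun_eq => z /=.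
  rewrite !indicE; congr (_%:R); congr nat_of_bool.
  by apply/idP/idP => /set_mem h1; apply/mem_set; move: h1; rewrite /= /mix mem_self.
have key h' : Ex mu (lab g * L E f h') = p * Ex mu (L E f h').
  by rewrite mulrC -(Ex_res [set g]) (resM _ _ (Linv h')) rlab mulrC ExZ.
by rewrite ExD mulrBl mul1r ExB !key mulrBl mul1r.
Qed.

Lemma Ex_noise0 f h : Ex muZ (F set0 f h) = Ex mu (f * h).
Proof.
rewrite -(Ex_comp mpres_x); congr Ex; apply: bfun_eq => z /=.
congr (_ * _); congr (h _); apply/funext => g; rewrite /noise /mix.
by case: ifPn => // /set_mem [].
Qed.

End link.

Definition cnoise (A : set X0) (mA : measurable A) (E : set G) (f : cpx R X) : cpx R Z :=
  ccomp (mpres_noise E mA).1 f.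

Definition cx (f : cpx R X) : cpx R Z := ccomp mpres_x.1 f.

(* The sensitivity of [f] to resampling, in [E], the coordinates with label in [A]. *)
Definition sens (A : set X0) (mA : measurable A) (E : set G) (f : cpx R X) : R :=
  Ex muZ (nsq (cx f - cnoise mA E f)).

(** For values of modulus one, the squared distance is 2 minus twice the correlation. In the latter
    the component of index [T] keeps the factor [(1 - mu0 A) ^+ size T], the probability that the
    noise misses [T]. *)
Lemma sens_link (A : set X0) (mA : measurable A) (E : seq G) (f : cpx R X) : uniq E ->
  cunit f -> sens mA [set` E] f =
  2 * (1 - q (ip mu) P E f f (fun T => (1 - fine (mu0 A)) ^+ size T)).
Proof.
move=> uE uf; pose I2 (E : seq G) (f h : cpx R X) := ip muZ (cx f) (cnoise mA [set` E] h).
have I0 f' h' : I2 [::] f' h' = ip mu f' h'.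
  rewrite /I2 /ip /cip !ExD /= (_ : [set` [::]] = set0); last by apply/seteqP; split.
  by rewrite !Ex_noise0.
have IS g E' f' h' : g \notin E' ->
    I2 (g :: E') f' h' = (1 - (1 - fine (mu0 A))) * I2 E' f' (P g h') +
      (1 - fine (mu0 A)) * I2 E' f' h'.
  move=> gE; rewrite /I2 /ip /cip !ExD /= (_ : [set` g :: E'] = [set` E'] `|` [set g]).
    rewrite !Ex_noise_step; try exact/negP.
    by rewrite subKr !mulrDr addrACA.
  apply/seteqP; split=> k /=; rewrite inE; first by move=> /orP[/eqP ->|kE]; [right|left].
  by move=> [->|->]; rewrite ?eqxx ?orbT.
rewrite -(q_geom (resampling_bernoulli mu_prod) f f I0 IS uE) /I2 /sens.
rewrite nsqB.
have -> : nsq (cx f) = 1 by apply: bfun_eq => z; exact: cunit_ccomp.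
have -> : nsq (cnoise mA [set` E] f) = 1 by apply: bfun_eq => z; exact: cunit_ccomp.
have key (t : R) : 1 + 1 - (t + t) = 2 * (1 - t) by ring.
rewrite ExB (ExD _ 1 1) (ExD _ (cip _ _) (cip _ _)) Ex1; exact: key.
Qed.

Lemma sens_cmul (A : set X0) (mA : measurable A) (E : set G) (f h : cpx R X) :
  cunit f -> cunit h ->
  sens mA E (cmul f h) <= 2 * sens mA E f + 2 * sens mA E h.
Proof.
move=> uf uh; rewrite /sens -!ExZ -ExD; apply: Ex_le => z.
rewrite [leRHS](_ : _ = 2 * nsq (cx f - cnoise mA E f) z +
  2 * nsq (cx h - cnoise mA E h) z) // !nsqE.
set x := z.2.1; set n := noise A E z.
have := uf x; have := uh n; rewrite !nsqE => e1 e2.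
change (((f.1 x * h.1 x - f.2 x * h.2 x) - (f.1 n * h.1 n - f.2 n * h.2 n)) ^+ 2 +
  ((f.1 x * h.2 x + f.2 x * h.1 x) - (f.1 n * h.2 n + f.2 n * h.1 n)) ^+ 2 <=
  2 * ((f.1 x - f.1 n) ^+ 2 + (f.2 x - f.2 n) ^+ 2) +
  2 * ((h.1 x - h.1 n) ^+ 2 + (h.2 x - h.2 n) ^+ 2)).
move: e1 e2; move: (f.1 x) (f.2 x) (h.1 x) (h.2 x) (f.1 n) (f.2 n) (h.1 n) (h.2 n).
move=> a1 a2 b1 b2 c1 c2 d1 d2 e1 e2.
(* Real and imaginary parts of the two terms of [f(x) h(x) - f(n) h(n) = f(x) (h(x) - h(n)) + (f(x)
   - f(n)) h(n)]. *)
pose u := a1 * (b1 - d1) - a2 * (b2 - d2); pose u' := a1 * (b2 - d2) + a2 * (b1 - d1).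
pose w := (a1 - c1) * d1 - (a2 - c2) * d2; pose w' := (a1 - c1) * d2 + (a2 - c2) * d1.
have -> : a1 * b1 - a2 * b2 - (c1 * d1 - c2 * d2) = u + w by rewrite /u /w; ring.
have -> : a1 * b2 + a2 * b1 - (c1 * d2 + c2 * d1) = u' + w' by rewrite /u' /w'; ring.
have h1 : u ^+ 2 + u' ^+ 2 = (b1 - d1) ^+ 2 + (b2 - d2) ^+ 2.
  rewrite -[RHS]mul1r -e2 /u /u'; ring.
have h2 : w ^+ 2 + w' ^+ 2 = (a1 - c1) ^+ 2 + (a2 - c2) ^+ 2.
  rewrite -[RHS]mul1r -e1 /w /w'; ring.
have := sqr_ge0 (u - w); have := sqr_ge0 (u' - w'); rewrite -h1 -h2.
by move: u u' w w' {h1 h2} => u u' w w' k1 k2; nra.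
Qed.

End noise.

(** * Slowly varying weights *)

Section length.
Context (G : groupType) (e : nat -> G).
Hypothesis e_surj : forall g, exists n, e n = g.

(** Products of two elements of one ball lie in the next, so [glen] behaves like the logarithm of a
    word length: a left translation changes it by a bounded amount, and its balls are finite
    although [G] need not be finitely generated. *)
Fixpoint lball (n : nat) : seq G :=
  if n is n'.+1 then
    e n' :: lball n' ++ [seq (x * y)%g | x <- lball n', y <- lball n']
  else [::].

Lemma lball_sub m n : (m <= n)%N -> {subset lball m <= lball n}.
Proof.
move=> mn; rewrite -(subnKC mn); elim: (n - m)%N => [|k IH] g; first by rewrite addn0.
by move=> /IH h; rewrite addnS /= inE mem_cat h orbT.
Qed.

Lemma lball_ex g : exists n, g \in lball n.
Proof. by have [n <-] := e_surj g; exists n.+1; rewrite /= mem_head. Qed.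

Definition glen g : nat := ex_minn (lball_ex g).

Lemma glenP g : g \in lball (glen g).
Proof. by rewrite /glen; case: ex_minnP. Qed.

Lemma glen_le g n : g \in lball n -> (glen g <= n)%N.
Proof. by rewrite /glen; case: ex_minnP => m _ H /H. Qed.

Lemma glen_mul g h : (glen (g * h)%g <= (maxn (glen g) (glen h)).+1)%N.
Proof.
apply: glen_le; rewrite /= inE mem_cat; apply/orP; right; apply/orP; right.
apply/allpairsP; exists (g, h); split=> //=.
  exact: lball_sub (leq_maxl _ _) _ (glenP g).
exact: lball_sub (leq_maxr _ _) _ (glenP h).
Qed.

Lemma glen_shift s : exists c : nat, forall g,
  (glen (s * g)%g <= glen g + c)%N /\ (glen g <= glen (s * g)%g + c)%N.
Proof.
exists (glen s + glen s^-1%g).+1 => g.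
have h1 := glen_mul s g; have h2 := glen_mul s^-1%g (s * g)%g; rewrite mulKg in h2.
by move: h1 h2; move: (glen _) (glen _) (glen _) (glen _) => *; lia.
Qed.

Lemma slow_weight (R : realType) (Q E : seq G) (dl ep : R) : 0 <= dl -> 0 < ep ->
  exists p : G -> R,
  [/\ forall g, 0 <= p g <= dl,
      forall g, g \in E -> dl / 2 <= p g,
      forall s g, s \in Q -> `|p (s * g)%g - p g| <= ep * p g &
      forall r : R, 0 < r -> finite_set [set g | r <= p g]].
Proof.
move=> d0 ep0.
have [c hc] : exists c : nat, forall s, s \in Q -> forall g,
    (glen (s * g)%g <= glen g + c)%N /\ (glen g <= glen (s * g)%g + c)%N.
  elim: Q => [|s Q [c IH]]; first by exists 0%N.
  have [c' hc'] := glen_shift s; exists (maxn c c') => s'; rewrite inE => /orP[/eqP ->|sQ] g.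
    have [h1 h2] := hc' g; split.
      by rewrite (leq_trans h1) // leq_add2l leq_maxr.
    by rewrite (leq_trans h2) // leq_add2l leq_maxr.
  have [h1 h2] := IH s' sQ g; split.
    by rewrite (leq_trans h1) // leq_add2l leq_maxl.
  by rewrite (leq_trans h2) // leq_add2l leq_maxl.
have [M hM] : exists M : nat, forall g, g \in E -> (glen g <= M)%N.
  elim: E => [|g E [M IH]]; first by exists 0%N.
  exists (maxn M (glen g)) => g'; rewrite inE => /orP[/eqP ->|gE]; first exact: leq_maxr.
  by rewrite (leq_trans (IH _ gE)) ?leq_maxl.
(* The weight is [dl K / (K + glen g)]. [K >= M] keeps it above [dl / 2] on [E]; as translation by
   [Q] changes [glen] by at most [c], [K >= c / ep] makes its relative variation at most [ep]. *)
pose K : R := 1 + M%:R + c%:R / ep.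
have c0 : 0 <= c%:R / ep by rewrite divr_ge0 // ltW.
have M0 : (0 : R) <= M%:R by [].
have K0 : 0 < K by rewrite /K; lra.
have KM : M%:R <= K by rewrite /K; lra.
have Kc : c%:R <= ep * K by rewrite mulrC -ler_pdivrMr // /K; lra.
pose D g : R := K + (glen g)%:R.
have D0 g : 0 < D g by rewrite /D ltr_wpDr.
have DK g : K <= D g by rewrite /D lerDl.
have dK0 : 0 <= dl * K by rewrite mulr_ge0 // ltW.
have dKD g : 0 <= dl * K / D g by rewrite divr_ge0 // ltW.
exists (fun g => dl * K / D g); split.
- by move=> g; rewrite dKD /= ler_pdivrMr // ler_wpM2l.
- move=> g /hM gM; rewrite ler_pdivlMr // mulrAC ler_pdivrMr // -mulrA ler_wpM2l //.
  have : (glen g)%:R <= K by rewrite (le_trans _ KM) // ler_nat.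
  by rewrite /D; lra.
- move=> s g sQ; have [h1 h2] := hc s sQ g.
  have -> : dl * K / D (s * g)%g - dl * K / D g =
      dl * K / D g * ((D g - D (s * g)%g) / D (s * g)%g).
    by field; rewrite !gt_eqF.
  rewrite normrM (ger0_norm (dKD g)) mulrC ler_wpM2r //.
  rewrite normrM normfV (gtr0_norm (D0 _)) ler_pdivrMr //.
  apply: (@le_trans _ _ c%:R).
    rewrite /D opprD addrACA subrr add0r ler_norml.
    move: h1 h2; rewrite -!(ler_nat R) !natrD => h1 h2; apply/andP; split; lra.
  by rewrite (le_trans Kc) // ler_wpM2l // ltW.
move=> r r0; pose N := Num.bound (dl * K / r).
apply: (@sub_finite_set _ _ [set` lball N]); last exact: finite_seq.
move=> g /=; rewrite ler_pdivlMr // mulrC -ler_pdivlMr // => h.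
have x0 : 0 <= dl * K / r by rewrite divr_ge0 // ltW.
have := archi_boundP x0; rewrite -/N => hN.
suff gN : (glen g <= N)%N by exact: (lball_sub gN (glenP g)).
rewrite -(ler_nat R); apply/ltW; apply: le_lt_trans hN; apply: le_trans h.
by rewrite /D lerDr ltW.
Qed.

End length.

(** * Weighted averages over a finite set *)

Section weights.
Context (R : realType) (G : groupType).
Implicit Types (p f : G -> R) (T F : seq G).

(** An average in which a unit mass is added at the value 0. It is defined for the empty set, and
    discarding points of small weight changes it little even when [T] carries little weight. *)
Definition wsum p f T : R := (\sum_(g <- T) p g * f g) / (1 + \sum_(g <- T) p g).

Lemma frac_close (n n' m m' a : R) : 0 <= m -> 0 <= m' -> `|n| <= m ->
  `|n - n'| <= a * (1 + m') -> `|m - m'| <= a * (1 + m') ->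
  `|n / (1 + m) - n' / (1 + m')| <= 2 * a.
Proof.
move=> m0 m'0 nm nn' mm'.
have p1 : 0 < 1 + m by rewrite ltr_wpDr.
have p2 : 0 < 1 + m' by rewrite ltr_wpDr.
have -> : n / (1 + m) - n' / (1 + m') =
    (n - n') / (1 + m') - n / (1 + m) * ((m - m') / (1 + m')).
  by field; rewrite !gt_eqF.
rewrite (le_trans (ler_normB _ _)) //.
have h1 : `|(n - n') / (1 + m')| <= a.
  by rewrite normrM normfV [X in _ / X]gtr0_norm // ler_pdivrMr.
have h2 : `|(m - m') / (1 + m')| <= a.
  by rewrite normrM normfV [X in _ / X]gtr0_norm // ler_pdivrMr.
have h3 : `|n / (1 + m)| <= 1.
  rewrite normrM normfV [X in _ / X]gtr0_norm // ler_pdivrMr // mul1r; lra.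
have h4 : `|n / (1 + m) * ((m - m') / (1 + m'))| <= a.
  by rewrite normrM -[leRHS]mul1r ler_pM.
lra.
Qed.

Lemma wsum_perm p f T T' : perm_eq T T' -> wsum p f T = wsum p f T'.
Proof. by move=> TT'; rewrite /wsum !(perm_big _ TT'). Qed.

Variables (p : G -> R).
Hypothesis p0 : forall g, 0 <= p g.

Lemma wsum_num f (K : R) T : (forall g, `|f g| <= K) ->
  `|\sum_(g <- T) p g * f g| <= K * \sum_(g <- T) p g.
Proof.
move=> fK; rewrite (le_trans (ler_norm_sum _ _ _)) // mulr_sumr ler_sum // => g _.
by rewrite normrM (ger0_norm (p0 g)) mulrC ler_wpM2r.
Qed.

Lemma wsum_den T : 0 < 1 + \sum_(g <- T) p g.
Proof. by rewrite ltr_wpDr // sumr_ge0. Qed.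

Lemma wsum_norm f (K : R) T : 0 <= K -> (forall g, `|f g| <= K) -> `|wsum p f T| <= K.
Proof.
move=> K0 fK; rewrite /wsum normrM normfV [X in _ / X]gtr0_norm ?wsum_den //.
rewrite ler_pdivrMr ?wsum_den // (le_trans (wsum_num T fK)) // ler_wpM2l //.
by rewrite lerDr.
Qed.

Lemma adm_wsum f (K : R) : 0 <= K -> (forall g, `|f g| <= K) -> adm (wsum p f).
Proof.
move=> K0 fK; split; first by move=> T T'; exact: wsum_perm.
by exists K => T; exact: wsum_norm.
Qed.

Lemma wsum_lin (c : R) f h T :
  wsum p (fun g => c * f g + h g) T = c * wsum p f T + wsum p h T.
Proof.
rewrite /wsum mulrA -mulrDl mulr_sumr -big_split /=; congr (_ / _).
by apply: eq_bigr => g _; ring.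
Qed.

Lemma wsum_ge0 f T : (forall g, 0 <= f g) -> 0 <= wsum p f T.
Proof.
move=> f0; rewrite divr_ge0 ?(ltW (wsum_den T)) // sumr_ge0 // => g _.
by rewrite mulr_ge0.
Qed.

Lemma sum_filter_le F T : uniq T ->
  \sum_(g <- T | g \in F) p g <= \sum_(g <- F) p g.
Proof.
move=> uT; rewrite -big_filter; apply: (@le_trans _ _ (\sum_(g <- undup F) p g)).
  rewrite [leRHS](bigID (mem T)) /= -[X in X + _]big_filter.
  rewrite (perm_big [seq g <- undup F | g \in T]) /= ?lerDl ?sumr_ge0 //.
  apply: uniq_perm; rewrite ?filter_uniq ?undup_uniq // => g.
  by rewrite !mem_filter mem_undup andbC.
elim: F => [|g F IH] //=; rewrite !big_cons; case: ifP => _.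
  by rewrite (le_trans IH) // lerDr.
by rewrite big_cons lerD2l.
Qed.

Lemma wsum_drop f F T : (forall g, `|f g| <= 1) -> uniq T ->
  `|wsum p f T - wsum p f (seq.filter (predC (mem F)) T)| <= 2 * \sum_(g <- F) p g.
Proof.
move=> f1 uT; set T' := seq.filter _ _.
have split (h : G -> R) : \sum_(g <- T) h g - \sum_(g <- T') h g = \sum_(g <- T | g \in F) h g.
  by rewrite (bigID (mem F)) /= [X in _ - X]big_filter addrK.
have le := sum_filter_le F uT.
have m'1 : 1 <= 1 + \sum_(g <- T') p g by rewrite lerDl sumr_ge0.
have F0 : 0 <= \sum_(g <- F) p g by rewrite sumr_ge0.
have leF : \sum_(g <- T | g \in F) p g <= (\sum_(g <- F) p g) * (1 + \sum_(g <- T') p g).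
  by rewrite (le_trans le) // ler_peMr.
apply: frac_close; rewrite ?sumr_ge0 //.
- by rewrite (le_trans (wsum_num T f1)) // mul1r.
- rewrite split (le_trans _ leF) // (le_trans (ler_norm_sum _ _ _)) // ler_sum // => g _.
  by rewrite normrM (ger0_norm (p0 g)) ler_piMr.
- by rewrite split ger0_norm // sumr_ge0.
Qed.

Lemma wsum_shift f (s : G) (ep : R) T : 0 <= ep -> (forall g, `|f g| <= 1) ->
  (forall g, `|p (s * g)%g - p g| <= ep * p g) ->
  `|wsum p f (map (fun g => s * g)%g T) - wsum p (fun g => f (s * g)%g) T| <= 2 * ep.
Proof.
move=> ep0 f1 ps; rewrite /wsum !big_map.
have E : ep * \sum_(g <- T) p g <= ep * (1 + \sum_(g <- T) p g).
  by rewrite ler_wpM2l // lerDr.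
apply: frac_close; rewrite ?sumr_ge0 //.
- rewrite (le_trans (ler_norm_sum _ _ _)) // ler_sum // => g _.
  by rewrite normrM (ger0_norm (p0 _)) ler_piMr.
- rewrite (le_trans _ E) // -sumrB (le_trans (ler_norm_sum _ _ _)) // mulr_sumr ler_sum // => g _.
  by rewrite -mulrBl normrM (le_trans _ (ps g)) // ler_piMr.
- rewrite (le_trans _ E) // -sumrB (le_trans (ler_norm_sum _ _ _)) // mulr_sumr ler_sum // => g _.
Qed.

End weights.

(** * States and means *)

Lemma fmap_ultra T U (f : T -> U) (F : set_system T) :
  UltraFilter F -> UltraFilter (f @ F).
Proof.
move=> FU; have PF : ProperFilter F by exact: ultra_proper.
split; first exact: fmap_proper_filter.
move=> K PK FK; apply/seteqP; split=> // A KA.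
have [//|h] := in_ultra_setVsetC (f @^-1` A) FU.
exfalso; apply: (@filter_not_empty _ K); rewrite -(setICr A).
by apply: filterI => //; exact: FK.
Qed.

Section states.
Local Open Scope complex_scope.
Context (R : realType) (H : groupType).
Implicit Types (g h f : H -> R).

Definition rbounded f := exists M : R, forall s, `|f s| <= M.

Definition rsmall f := rbounded f /\ forall (t : H) (e : R), 0 < e ->
  finite_set [set s | e <= `|f s - f (s * t)%g|].

Lemma rbounded_lin (c : R) g h : rbounded g -> rbounded h ->
  rbounded (fun s => c * g s + h s).
Proof.
move=> [M gM] [N hN]; exists (`|c| * M + N) => s.
by rewrite (le_trans (ler_normD _ _)) // lerD // normrM ler_wpM2l.
Qed.

Lemma rsmall_lin (c : R) g h : rsmall g -> rsmall h -> rsmall (fun s => c * g s + h s).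
Proof.
move=> [bg sg] [bh sh]; split; first exact: rbounded_lin.
move=> t e e0; have c0 : 0 < `|c| + 1 by rewrite ltr_wpDl.
have e2 : 0 < e / 2 by rewrite divr_gt0.
have e3 : 0 < e / 2 / (`|c| + 1) by rewrite divr_gt0.
apply: (@sub_finite_set _ _ ([set s | e / 2 / (`|c| + 1) <= `|g s - g (s * t)%g|] `|`
  [set s | e / 2 <= `|h s - h (s * t)%g|])); last first.
  by rewrite finite_setU; split; [exact: sg|exact: sh].
move=> s /= es; apply/orP; rewrite -[X in X || _]negbK -[X in _ || X]negbK -negb_and.
apply/negP; rewrite -!ltNge => /andP[h1 h2].
have := ler_normD (c * (g s - g (s * t)%g)) (h s - h (s * t)%g).
have -> : c * (g s - g (s * t)%g) + (h s - h (s * t)%g) =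
  c * g s + h s - (c * g (s * t)%g + h (s * t)%g) by ring.
rewrite normrM; have h3 : `|c| * `|g s - g (s * t)%g| <= e / 2.
  rewrite (le_trans (ler_wpM2l (normr_ge0 c) (ltW h1))) //.
  by rewrite mulrCA ger_pMr // ler_pdivrMr // mul1r lerDl.
by move=> h4; have := le_lt_trans (le_trans es h4) (ler_ltD h3 h2); lra.
Qed.

Lemma rsmall_cst (c : R) : rsmall (fun=> c).
Proof.
split; first by exists `|c|.
move=> t e e0; rewrite (_ : [set s | _] = set0) //.
by apply/seteqP; split=> // s /=; rewrite subrr normr0 leNgt e0.
Qed.

Lemma rsmall_shift (t : H) f : rsmall f -> rsmall (fun s => f (t * s)%g).
Proof.
move=> [[M fM] sf]; split; first by exists M.
move=> u e e0; have := sf u e e0; set S := [set s | _] => fS.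
rewrite (_ : [set s | _] = (fun s => (t * s)%g) @^-1` S).
  by apply: finite_preimage => // x y _ _; exact: mulgI.
by apply/seteqP; split=> s /=; rewrite mulgA.
Qed.

Lemma rsmall_small f : rsmall f -> @small_at_infinity R H (fun s => (f s)%:C).
Proof.
move=> [[M fM] sf]; split; first by exists M => s; rewrite normcR.
move=> t e e0; rewrite (_ : [set s | _] = [set s | e <= `|f s - f (s * t)%g|]).
  exact: sf.
by apply/funext => s; rewrite /= -[in RHS]normcR rmorphB.
Qed.

Record rmean (V : (H -> R) -> Prop) (m : (H -> R) -> R) : Prop := RMean {
  rmean_lin : forall (c : R) f g, V f -> V g ->
    m (fun s => c * f s + g s) = c * m f + m g;
  rmean_ge0 : forall f, V f -> (forall s, 0 <= f s) -> 0 <= m f;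
  rmean1 : m (fun=> 1) = 1 }.

Lemma real_state : (exists phi, left_invariant_state (@small_at_infinity R H) phi) ->
  exists psi, rmean rsmall psi /\
    forall t f, rsmall f -> psi (fun s => f (t * s)%g) = psi f.
Proof.
move=> [phi [[lin pos one] inv]]; exists (fun f => complex.Re (phi (fun s => (f s)%:C))).
split; first split.
- move=> c f g sf sg; have := lin c%:C _ _ (rsmall_small sf) (rsmall_small sg).
  have -> : c%:C *: (fun s => (f s)%:C) + (fun s => (g s)%:C) = fun s => (c * f s + g s)%:C.
    by apply/funext => s; rewrite rmorphD rmorphM.
  by move=> ->; case: (phi _) (phi _) => [a b] [a' b'] /=; ring.
- move=> f sf f0; have := pos _ (rsmall_small sf) _; case: (phi _) => a b /=.
  move=> /(_ _)/wrap[] => [s|]; first by rewrite ler0c.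
  by rewrite lecE /= => /andP[].
- by rewrite (_ : (fun s => _) = fun=> 1) ?one //.
move=> t f sf; have := inv t^-1%g _ (rsmall_small sf).
by rewrite /ltrans invgK => ->.
Qed.

Lemma amenable_of_mean : (exists m, rmean rbounded m /\
    forall t f, rbounded f -> m (fun s => f (t * s)%g) = m f) -> amenable R H.
Proof.
move=> [m [[lin pos one] inv]].
have Rle (z : R[i]) : `|complex.Re z| <= Normc.normc z.
  by rewrite -(@ler_pXn2r _ 2) ?nnegrE ?normc_ge0 // normc_sq real_normK
    ?num_real // lerDl sqr_ge0.
have Ile (z : R[i]) : `|complex.Im z| <= Normc.normc z.
  by rewrite -(@ler_pXn2r _ 2) ?nnegrE ?normc_ge0 // normc_sq real_normK
    ?num_real // lerDr sqr_ge0.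
have bR (f : H -> R[i]) : @linf R H f -> rbounded (fun s => complex.Re (f s)).
  by move=> [M fM]; exists M => s; rewrite (le_trans (Rle _)).
have bI (f : H -> R[i]) : @linf R H f -> rbounded (fun s => complex.Im (f s)).
  by move=> [M fM]; exists M => s; rewrite (le_trans (Ile _)).
have b0 : rbounded (fun=> 0 : R) by exists 0 => s; rewrite normr0.
have m0 : m (fun=> 0) = 0.
  have := lin 1 _ _ b0 b0; rewrite (_ : (fun s => _) = fun=> 0).
    by rewrite mul1r; move: (m _) => k; lra.
  by apply/funext => s; rewrite mulr0 addr0.
exists (fun f : H -> R[i] => m (fun s => complex.Re (f s)) +i* m (fun s => complex.Im (f s))).
split; first split.
- move=> [a b] f g lf lg /=.
  have -> : (fun s => complex.Re ((((a +i* b)%C *: f) + g) s)) =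
     fun s => a * complex.Re (f s) + ((- b) * complex.Im (f s) + complex.Re (g s)).
    by apply/funext => s; rewrite !fctE /= /GRing.scale /=; case: (f s) (g s) => [? ?] [? ?] /=; ring.
  have -> : (fun s => complex.Im ((((a +i* b)%C *: f) + g) s)) =
     fun s => a * complex.Im (f s) + (b * complex.Re (f s) + complex.Im (g s)).
    by apply/funext => s; rewrite !fctE /= /GRing.scale /=; case: (f s) (g s) => [? ?] [? ?] /=; ring.
  have bRf := bR _ lf; have bIf := bI _ lf; have bRg := bR _ lg; have bIg := bI _ lg.
  rewrite !lin //; try exact: rbounded_lin.
  by apply/eqP; rewrite eq_complex /=; apply/andP; split; apply/eqP; ring.
- move=> f lf f0; rewrite (_ : (fun s => complex.Im (f s)) = fun=> 0); last first.
    by apply/funext => s; have := f0 s; rewrite lecE /= => /andP[/eqP].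
  rewrite m0 lecE /= eqxx /=; apply: pos; first exact: bR.
  by move=> s; have := f0 s; rewrite lecE /= => /andP[].
- by rewrite /= one m0.
move=> t f lf; rewrite /ltrans.
by rewrite (inv t^-1%g _ (bR _ lf)) (inv t^-1%g _ (bI _ lf)).
Qed.

Lemma rmean_bounded_norm m f (K : R) : rmean rbounded m -> (forall s, `|f s| <= K) ->
  `|m f| <= K.
Proof.
move=> [lin pos one] fK; have bf : rbounded f by exists K.
have b1 c : rbounded (fun=> c) by exists `|c|.
have b3 : rbounded (fun s => (-1) * f s + 0) by exact: rbounded_lin.
have m0 : m (fun=> 0) = 0.
  have := lin 1 _ _ (b1 0) (b1 0); rewrite (_ : (fun s => _) = fun=> 0).
    by rewrite mul1r; move: (m _) => k; lra.
  by apply/funext => s; rewrite mulr0 addr0.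
have h1 : 0 <= m (fun s => K * 1 + f s).
  apply: pos => [|s]; first exact: rbounded_lin.
  by have := fK s; rewrite ler_norml => /andP[]; lra.
have h2 : 0 <= m (fun s => K * 1 + ((-1) * f s + 0)).
  apply: pos => [|s]; first exact: rbounded_lin.
  by have := fK s; rewrite ler_norml => /andP[]; lra.
rewrite lin // one in h1; rewrite !lin // one m0 in h2.
rewrite ler_norml; apply/andP; split; lra.
Qed.

(** An enumeration of [H] gives means [mn n] that are invariant up to [1 / (n + 1)] under the first
    [n] elements; their limit along an ultrafilter finer than the filter at infinity is a mean, and
    the errors disappear. *)
Lemma mean_limit (e : nat -> H) : (forall s, exists n, e n = s) ->
  (forall (Q : seq H) (ep : R), 0 < ep -> exists m, rmean rbounded m /\
     forall s f, s \in Q -> (forall t, `|f t| <= 1) ->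
       `|m (fun t => f (s * t)%g) - m f| <= ep) ->
  exists m, rmean rbounded m /\
    forall t f, rbounded f -> m (fun s => f (t * s)%g) = m f.
Proof.
move=> e_surj app.
have /choice[mn hmn] : forall n : nat, exists m, rmean rbounded m /\
    forall s f, s \in [seq e k | k <- iota 0 n] -> (forall t, `|f t| <= 1) ->
       `|m (fun t => f (s * t)%g) - m f| <= n.+1%:R^-1.
  by move=> n; apply: app; rewrite invr_gt0.
have [U UU leU] : exists2 U : set_system nat, UltraFilter U & \oo `<=` U.
  by have [U [UU leU]] := ultraFilterLemma (eventually_filter); exists U.
have PU : ProperFilter U by exact: ultra_proper.
have cv f : rbounded f -> exists l : R, (fun n => mn n f) @ U --> l.
  move=> [M fM]; have mM n : `|mn n f| <= M by apply: rmean_bounded_norm fM; have [] := hmn n.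
  have cM : compact `[- M, M]%classic by exact: segment_compact.
  have : ((fun n => mn n f) @ U) `[- M, M]%classic.
    apply: (@filterS _ U _ setT) (@filterT _ U _) => n _ /=.
    by rewrite in_itv /=; have := mM n; rewrite ler_norml.
  rewrite compact_ultra in cM.
  by move=> /(cM _ (fmap_ultra _ UU))[l [_ cl]]; exists l.
pose m f := lim ((fun n => mn n f) @ U).
have mP f : rbounded f -> (fun n => mn n f) @ U --> m f.
  by move=> /cv[l cl]; apply/cvg_ex; exists l.
exists m; split; first split.
- move=> c f g bf bg; apply: cvg_lim => //.
  rewrite (_ : (fun n => _) = (fun n => c * mn n f) \+ (fun n => mn n g)); last first.
    by apply/funext => n; have [[lin _ _] _] := hmn n; rewrite lin.
  by apply: cvgD; [apply: cvgMr; exact: mP|exact: mP].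
- move=> f bf f0; apply: limr_ge; first by apply/cvg_ex; exists (m f); exact: mP.
  apply: (@filterS _ U _ setT) (@filterT _ U _) => n _; have [[_ pos _] _] := hmn n; exact: pos.
- apply: cvg_lim => //; rewrite (_ : (fun n => _) = cst 1); first exact: cvg_cst.
  by apply/funext => n; have [[_ _ one] _] := hmn n.
move=> t f [M fM]; have bf : rbounded f by exists M.
have bft : rbounded (fun s => f (t * s)%g) by exists M.
apply/eqP; rewrite -subr_eq0; apply/eqP.
have : (fun n => mn n (fun s => f (t * s)%g) - mn n f) @ U -->
    m (fun s => f (t * s)%g) - m f by apply: cvgB; exact: mP.
move=> /cvg_lim <- //; apply: cvg_lim => //.
suff c0 : (fun n => mn n (fun s => f (t * s)%g) - mn n f) @ \oo --> (0 : R).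
  by move=> S /c0 /leU.
have M0 : 0 <= M by exact: le_trans (fM 1%g).
have M1 : 0 < M + 1 by rewrite ltr_wpDl.
have [k ek] := e_surj t.
have bound n : (k < n)%N -> `|mn n (fun s => f (t * s)%g) - mn n f| <= (M + 1) * n.+1%:R^-1.
  (* [f] is rescaled because approximate invariance is known for functions bounded by 1; the summand
     0 gives the shape of [rmean_lin]. *)
  move=> kn; have [mm H1] := hmn n; pose f' s := (M + 1)^-1 * f s + 0.
  have f'1 s : `|f' s| <= 1.
    rewrite /f' addr0 normrM gtr0_norm ?invr_gt0 // mulrC ler_pdivrMr // mul1r.
    by rewrite (le_trans (fM s)) // lerDl.
  have tQ : t \in [seq e k | k <- iota 0 n] by apply/mapP; exists k => //; rewrite mem_iota.
  have b0 : rbounded (fun=> 0 : R) by exists 0 => s; rewrite normr0.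
  have := H1 t f' tQ f'1; rewrite /f' !(rmean_lin mm) // opprD addrACA subrr addr0.
  rewrite -mulrBr normrM gtr0_norm ?invr_gt0 // mulrC ler_pdivrMr //.
  by rewrite [X in _ <= X]mulrC.
apply/cvgrPdist_le => ep ep0; near=> n.
rewrite sub0r normrN (le_trans (bound n _)) //; first by near: n; exact: nbhs_infty_gt.
rewrite ler_pdivrMr // mulrC -ler_pdivrMr // mulrC.
have : (M + 1) / ep < n%:R by near: n; exact: nbhs_infty_gtr.
by rewrite -natr1 mulrC; move: (_ / _) => k0; lra.
Unshelve. all: by end_near.
Qed.

End states.

(** * From sensitive cocycles to amenability *)

(** With a representative [r g] of each coset [j(H) g], [pi g] is the unique [s] such that
    [g = j s * r g]. It carries the points of random subsets of [G] to [H], where the mean has to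
    live. *)
Lemma transversal (G H : groupType) (j : H -> G) :
  (forall s t, j (s * t)%g = (j s * j t)%g) -> injective j ->
  exists pi : G -> H, forall s g, pi (j s * g)%g = (s * pi g)%g.
Proof.
move=> jM jI; have j1 : j 1%g = 1%g.
  by apply: (mulgI (j 1%g)); rewrite -jM !mulg1.
have jV s : j s^-1%g = (j s)^-1%g.
  by apply: (mulgI (j s)); rewrite -jM !mulgV.
pose O g := [set h : G | exists s, h = (j s * g)%g].
have Ojs s g : O (j s * g)%g = O g.
  apply/seteqP; split=> h [s' ->].
    by exists (s' * s)%g; rewrite jM mulgA.
  by exists (s' * s^-1)%g; rewrite jM jV mulgA mulgVK.
pose r g := xget 1%g (O g).
have rP g : exists s, g = (j s * r g)%g.
  have [s hs] : O g (r g) by apply: xgetPex; exists g, 1%g; rewrite j1 mul1g.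
  by exists s^-1%g; rewrite hs jV mulKg.
pose pi g := xget 1%g [set s | g = (j s * r g)%g].
have piP g : g = (j (pi g) * r g)%g by exact: (xgetPex 1%g (rP g)).
exists pi => s g; have rs : r (j s * g)%g = r g by rewrite /r Ojs.
apply: jI; apply: (can_inj (mulgK (r g))).
by rewrite jM -mulgA -piP -[in LHS]rs -piP.
Qed.

Section amenability.
Context (R : realType) (G : groupType) d (X0 : measurableType d).
Local Notation X := (bernoulli_space G X0).
Context (mu0 : probability X0 R) (mu : probability X R).
Hypothesis mu_prod : is_product_measure mu0 mu.
Local Notation P := (fun g => cres mu [set g]).
Local Notation law := (Lw (ip mu) P).
Local Notation rs := (resampling_bernoulli mu_prod).
Local Notation cact := (cact mu_prod).
Context (H : groupType) (j : H -> G).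
Hypothesis jM : forall s t, j (s * t)%g = (j s * j t)%g.
Hypothesis jI : injective j.
Context (W : H -> cpx R X).
Hypothesis Wu : forall t, cunit (W t).
Hypothesis Wc : forall s t,
  ip mu (W (s * t)%g - cmul (W s) (cact (j s) (W t)))
        (W (s * t)%g - cmul (W s) (cact (j s) (W t))) = 0.

Lemma tightW t : tight (ip mu) P (W t).
Proof. exact: (tight_unit mu_prod (Wu t)). Qed.

Lemma cunit_cact t (f : cpx R X) : cunit f -> cunit (cact t f).
Proof. exact: cunit_ccomp. Qed.

Lemma law_norm t u (K : R) : adm u -> (forall T, `|u T| <= K) -> `|law (W t) u| <= K.
Proof.
move=> au uK; have := Lw_close rs (tightW t) au (adm_cst _ 0) (c := K).
rewrite (Lw_cst rs) ?mul0r ?subr0; last exact: tightW.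
by rewrite ip_unit // mulr1; apply=> T _; rewrite subr0.
Qed.

Lemma lawW_mul s t u : adm u ->
  law (W (s * t)%g) u = law (cmul (W s) (cact (j s) (W t))) u.
Proof.
move=> au; apply: (law_null mu_prod) => //; apply: cunit_cmul => //.
exact: cunit_cact.
Qed.

(** [W (t s)] is [W t] times the translate by [j t] of [W s]. Up to small probability that factor
    disturbs the random set inside [j t F] only, with [F] depending on [s]; by hypothesis [u] nearly
    ignores [j t F] for all but finitely many [t]. *)
Lemma rsmall_law u (K : R) : adm u -> (forall T, `|u T| <= K) ->
  (forall (F : seq G) (n : R), 0 < n -> finite_set [set t : H |
     ~ forall T, uniq T -> `|u T - u (seq.filter
       (predC (mem (map (fun g => j t * g)%g F))) T)| <= n]) ->
  rsmall (fun t => law (W t) u).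
Proof.
move=> au uK uF; split; first by exists K => t; exact: law_norm.
move=> s e e0; have e4 : 0 < e / 4 by rewrite divr_gt0.
have e8 : 0 < e / 8 by rewrite divr_gt0.
have K0 : 0 <= K by exact: le_trans (uK [::]).
have [F hF] := law_cmul mu_prod (Wu s) K0 e4.
apply: sub_finite_set (uF F _ e8) => t /= et H1.
have := hF (j t) (W t) u (e / 8) (Wu t) au uK H1.
rewrite cmulC -lawW_mul // distrC.
by move: et; move: (`|_|) => A; lra.
Qed.

Lemma finite_j (F : seq G) (S : set G) : finite_set S ->
  finite_set [set t : H | exists2 g, g \in F & S (j t * g)%g].
Proof.
move=> fS; rewrite (_ : [set t | _] = \bigcup_(g in [set` F]) [set t | S (j t * g)%g]).
  apply: bigcup_finite; first exact: finite_seq.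
  move=> g _; apply: (finite_preimage (f := fun t => (j t * g)%g)) => //.
  by move=> x y _ _ /(can_inj (mulgK g))/jI.
by apply/seteqP; split=> t /= [g gF Sg]; exists g.
Qed.

Lemma rsmall_wsum (p f : G -> R) : (forall g, 0 <= p g) ->
  (forall r : R, 0 < r -> finite_set [set g | r <= p g]) ->
  (forall g, `|f g| <= 1) -> rsmall (fun t => law (W t) (wsum p f)).
Proof.
move=> p0 pc f1; apply: (rsmall_law (K := 1)).
- exact: adm_wsum p0 _ _ ler01 f1.
- by move=> T; exact: wsum_norm.
(* Dropping a translate of [F] costs twice its weight, at most [2 r (size F)], which is below
   [n]. *)
move=> F n n0; pose r : R := n / 2 / (size F).+1%:R.
have r0 : 0 < r by rewrite !divr_gt0.
apply: sub_finite_set (finite_j F (pc _ r0)) => t /= nH; apply: contrapT => nS.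
apply: nH => T uT; rewrite (le_trans (wsum_drop p0 _ f1 uT)) // mulrC -ler_pdivlMr //.
have pr g : g \in F -> p (j t * g)%g <= r.
  move=> gF; rewrite leNgt; apply/negP => rp; apply: nS; exists g => //.
  exact: ltW.
rewrite big_map big_seq (le_trans (ler_sum _ pr)) // -big_seq.
rewrite big_const_seq count_predT iter_addr_0 -[r *+ _]mulr_natr /r.
by rewrite mulrAC ler_pdivrMr // ler_wpM2l ?ler_nat // divr_ge0 // ltW.
Qed.

(** Twice the probability that noise of rate [dl] marks some point of [T] in the window [E]; by
    [sens_law] its average over the random set is the sensitivity in [E]. *)
Definition wind (E : seq G) (dl : R) (T : seq G) : R :=
  2 * (1 - (1 - dl) ^+ size (seq.filter (mem E) T)).

Lemma wind_bd (E : seq G) (dl : R) T : 0 <= dl <= 1 -> 0 <= wind E dl T <= 2.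
Proof.
move=> /andP[d0 d1]; have c0 : 0 <= 1 - dl by rewrite subr_ge0.
have c1 : 1 - dl <= 1 by rewrite gerBl.
have h1 := exprn_ge0 (size (seq.filter (mem E) T)) c0.
have h2 := exprn_ile1 (size (seq.filter (mem E) T)) c0 c1.
by rewrite /wind; apply/andP; split; move: h1 h2; move: (_ ^+ _) => k; lra.
Qed.

Lemma adm_wind (E : seq G) (dl : R) : 0 <= dl <= 1 -> adm (wind E dl).
Proof.
move=> dd; split.
  move=> T T' TT'; rewrite /wind; congr (2 * (1 - _ ^+ _)).
  by apply: perm_size; exact: perm_filter.
exists 2 => T; have /andP[h1 h2] := wind_bd E T dd; rewrite ger0_norm //.
Qed.

Lemma rsmall_wind (E : seq G) (dl : R) : 0 <= dl <= 1 ->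
  rsmall (fun t => law (W t) (wind E dl)).
Proof.
move=> dd; apply: (rsmall_law (K := 2)); first exact: adm_wind.
  by move=> T; have /andP[h1 h2] := wind_bd E T dd; rewrite ger0_norm.
move=> F n n0.
apply: sub_finite_set (finite_j F (finite_seq E)) => t /= nH; apply: contrapT => nS.
apply: nH => T uT; rewrite /wind -filter_predI.
suff -> : seq.filter (predI (mem E) (predC (mem [seq (j t * g)%g | g <- F]))) T =
  seq.filter (mem E) T by rewrite subrr normr0 ltW.
apply: eq_filter => g /=; case: (boolP (g \in E)) => //= gE; apply/negP => /mapP[h hF e].
by apply: nS; exists h => //; rewrite -e.
Qed.

Lemma sens_law (A : set X0) (mA : measurable A) (E : seq G) (f : cpx R X) :
  uniq E -> cunit f -> sens mu_prod mA [set` E] f = law f (wind E (fine (mu0 A))).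
Proof.
move=> uE uf; have dd : 0 <= fine (mu0 A) <= 1.
  rewrite fine_ge0 //= -lee_fin fineK ?fin_num_measure //; exact: probability_le1.
rewrite sens_link // (Lw_window rs (tight_unit mu_prod uf) (adm_wind _ dd) uE); last first.
  by move=> T; rewrite /wind -filter_predI (eq_filter (a2 := mem E)) // => g /=; exact: andbb.
have := q_lin (ip mu) P E f f (-2) (fun T => (1 - fine (mu0 A)) ^+ size T) (fun=> 2).
rewrite (q_cst rs) ip_unit // => e.
rewrite [RHS](_ : _ = q (ip mu) P E f f (fun T => -2 * (1 - fine (mu0 A)) ^+ size T + 2)).
  by rewrite e; ring.
apply: q_ext => T TE; rewrite /wind (_ : seq.filter (mem E) T = T); first by ring.
by apply/all_filterP/allP => g gT; exact: (mem_subseq TE).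
Qed.

Lemma sens_cconj (A : set X0) (mA : measurable A) (E : set G) (f : cpx R X) :
  sens mu_prod mA E (cconj f) = sens mu_prod mA E f.
Proof.
have h (g : cpx R X) z : nsq (cx mu g - cnoise mu_prod mA E g) z =
    (g.1 z.2.1 - g.1 (noise A E z)) ^+ 2 + (g.2 z.2.1 - g.2 (noise A E z)) ^+ 2.
  by rewrite nsqE.
have k (a b : R) : (- a - - b) ^+ 2 = (a - b) ^+ 2 by ring.
by congr Ex; apply: bfun_eq => z; rewrite !h; congr (_ + _); exact: k.
Qed.

Hypothesis cG : exists e : nat -> G, forall g, exists n, e n = g.
Hypothesis cH : exists e : nat -> H, forall g, exists n, e n = g.

(* Average [f] over the random finite set of [W t] with a slowly varying weight [p].
   The random sets of [W (s t)] and of the translate of [W t] by [s] agree up to a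
   finite set depending on [s] only, which [p] makes negligible; the lower bound on
   the sensitivity ensures that the total weight is not negligible on average. *)
Lemma amenable_of_unbounded (c : R) : 0 < c ->
  (forall dl : R, 0 < dl -> exists (A : set X0) (mA : measurable A),
     fine (mu0 A) <= dl /\ exists (t : H) (E : seq G),
       uniq E /\ c <= sens mu_prod mA [set` E] (W t)) ->
  (exists phi, left_invariant_state (@small_at_infinity R H) phi) ->
  amenable R H.
Proof.
move=> c0 NT /real_state[psi [mpsi ipsi]]; apply: amenable_of_mean.
have [eH eHs] := cH; apply: (mean_limit eHs) => Q ep ep0.
have [pi piE] := transversal jM jI.
(* The final comparison is [7 b <= 8 b = ep (c / 32) <= ep v], where [c / 32] is the lower bound on
   [v]. *)
pose b := c * ep / 256; have b0 : 0 < b.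
  by apply: divr_gt0; [exact: mulr_gt0|exact: ltr0n].
have [N hN] : exists N : nat, forall s, s \in Q -> exists2 F : seq G, (size F <= N)%N &
    forall (t : G) h u (k : R), cunit h -> adm u -> (forall T, `|u T| <= 1) ->
    (forall T, uniq T -> `|u T - u (seq.filter
      (predC (mem (map (fun g => t * g)%g F))) T)| <= k) ->
    `|law (cmul (cact t (W s^-1%g)) h) u - law h u| <= b + 2 * k.
  elim: Q => [|s Q [N hN]]; first by exists 0%N.
  have [F hF] := law_cmul mu_prod (Wu s^-1%g) ler01 b0.
  exists (maxn N (size F)) => s'; rewrite inE => /orP[/eqP ->|sQ].
    by exists F => //; exact: leq_maxr.
  have [F' F'N hF'] := hN _ sQ; exists F' => //.
  by rewrite (leq_trans F'N) // leq_maxl.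
(* [N] bounds the exceptional sets before [A] is chosen; weights of at most [dl <= dl0] then give
   each translate of such a set total weight at most [b]. *)
pose dl0 := b / N.+1%:R; have dl00 : 0 < dl0 by rewrite divr_gt0.
have [A [mA [Ad [t0 [E0 [uE0 cE0]]]]]] := NT _ dl00.
pose dl := fine (mu0 A).
have dd : 0 <= dl <= 1.
  rewrite fine_ge0 //= -lee_fin fineK ?fin_num_measure //; exact: probability_le1.
have /andP[d0 d1] := dd.
(* The translate is included because the random set of the translate of [W t] by [j t0] meets [E0]
   where that of [W t] meets [(j t0)^-1 E0]. *)
pose E := undup (E0 ++ map (fun g => (j t0)^-1 * g)%g E0).
have [eG eGs] := cG.
have [p [pdl pE pQ pc]] := slow_weight eGs (map (fun s => j s^-1%g) Q) E d0 b0.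
have p0 g : 0 <= p g by have /andP[] := pdl g.
pose Th (f : H -> R) (t : H) := law (W t) (wsum p (f \o pi)).
have aw (f : H -> R) (K : R) : (forall t, `|f t| <= K) -> adm (wsum p (f \o pi)).
  move=> fK; have K0 : 0 <= K by exact: le_trans (fK 1%g).
  by apply: (adm_wsum p0 K0) => g; exact: fK.
have Th_lin (k : R) f h : rbounded f -> rbounded h ->
    Th (fun s => k * f s + h s) = fun t => k * Th f t + Th h t.
  move=> [K fK] [K' hK']; apply/funext => t; rewrite /Th.
  rewrite -(Lw_lin rs k (tightW t) (aw _ _ fK) (aw _ _ hK')).
  by congr (Lw _ _ _ _); apply/funext => T; rewrite -wsum_lin.
have Th_small f : rbounded f -> rsmall (Th f).
  move=> [K fK]; have K0 : 0 <= K by exact: le_trans (fK 1%g).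
  have K1 : 0 < K + 1 by rewrite ltr_wpDl.
  have b' : rbounded (fun t => f t / (K + 1)).
    exists 1 => t; rewrite normrM normfV (gtr0_norm K1) ler_pdivrMr // mul1r.
    by rewrite (le_trans (fK t)) // lerDl.
  have bz : rbounded (fun _ : H => 0 : R) by exists 0 => t; rewrite normr0.
  have s1 : rsmall (Th (fun t => f t / (K + 1))).
    apply: rsmall_wsum => // g /=; rewrite normrM normfV (gtr0_norm K1).
    by rewrite ler_pdivrMr // mul1r (le_trans (fK _)) // lerDl.
  have s2 : rsmall (Th (fun=> 0)).
    by apply: rsmall_wsum => // g /=; rewrite normr0.
  rewrite (_ : f = fun t => (K + 1) * (f t / (K + 1)) + 0).
    by rewrite Th_lin //; exact: rsmall_lin.
  by apply/funext => t; rewrite addr0 mulrCA divff ?mulr1 // gt_eqF.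
have b1 : rbounded (fun _ : H => 1 : R) by exists 1 => t; rewrite normr1.
pose v := psi (Th (fun=> 1)).
have mono f h : rsmall f -> rsmall h -> (forall t, f t <= h t) -> psi f <= psi h.
  move=> sf sh fh; have := rmean_ge0 mpsi (rsmall_lin (-1) sf sh) _.
  rewrite (rmean_lin mpsi) // => /(_ _)/wrap[] => [t|]; first by have := fh t; lra.
  by move: (psi f) (psi h) => k k'; lra.
(* [W t0] is the quotient of [W (t0 t)] by a translate of [W t], so for every [t] the sensitivities
   of [W (t0 t)] and [W t] in [E] add up to at least [c / 2]. Invariance of [psi] leaves an average
   of [c / 4] for [W t], and comparing noise with weights costs a factor 8. *)
have v0 : c / 32 <= v.
  have M_small : rsmall (fun t => law (W t) (wind E dl)) by exact: rsmall_wind.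
  have M_shift : rsmall (fun t => law (W (t0 * t)%g) (wind E dl)).
    exact: (rsmall_shift t0 M_small).
  have h1 t : c / 2 <= law (W (t0 * t)%g) (wind E dl) + law (W t) (wind E dl).
    have uc : cunit (cact (j t0) (W t)) by exact: cunit_cact.
    have uE : uniq E by exact: undup_uniq.
    have e1 : cmul (cmul (W t0) (cact (j t0) (W t))) (cconj (cact (j t0) (W t))) = W t0.
      exact: cmulK.
    have s0 : sens mu_prod mA [set` E0] (W t0) <=
        2 * sens mu_prod mA [set` E0] (cmul (W t0) (cact (j t0) (W t))) +
        2 * sens mu_prod mA [set` E0] (cact (j t0) (W t)).
      have := sens_cmul mu_prod mA [set` E0] (cunit_cmul (Wu t0) uc) (cunit_cconj uc).
      by rewrite e1 sens_cconj.
    rewrite !sens_law // in s0; try exact: cunit_cmul.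
    rewrite -lawW_mul in s0; last exact: adm_wind.
    rewrite sens_law // in cE0.
    rewrite law_cact in s0.
    have le1 : law (W (t0 * t)%g) (wind E0 dl) <= law (W (t0 * t)%g) (wind E dl).
      apply: (Lw_mono rs) => //; try exact: tightW; try exact: adm_wind.
      move=> T uT; rewrite /wind ler_wpM2l // lerD2l lerN2; apply: ler_wiXn2l.
      - by rewrite subr_ge0.
      - by rewrite gerBl.
      - rewrite !size_filter; apply: sub_count => g /= gE.
        by rewrite mem_undup mem_cat gE.
    have le2 : law (W t) (fun T => wind E0 dl (map (fun g => j t0 * g)%g T)) <=
        law (W t) (wind E dl).
      apply: (Lw_mono rs); try exact: tightW; try exact: adm_wind.
        split; first by move=> T T' TT'; apply: (proj1 (adm_wind E0 dd)); exact: perm_map.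
        exists 2 => T; have /andP[k1 k2] := wind_bd E0 (map (fun g => j t0 * g)%g T) dd.
        by rewrite ger0_norm.
      move=> T uT; rewrite /wind ler_wpM2l // lerD2l lerN2; apply: ler_wiXn2l.
      - by rewrite subr_ge0.
      - by rewrite gerBl.
      - rewrite filter_map size_map !size_filter; apply: sub_count => g /= gE.
        rewrite mem_undup mem_cat; apply/orP; right; apply/mapP.
        by exists (j t0 * g)%g => //; rewrite mulKg.
    move: cE0 s0 le1 le2; rewrite -/dl.
    move: (law _ _) (law _ _) (law _ _) (law _ _) (law _ _) => k1 k2 k3 k4 k5; lra.
  have h2 : c / 4 <= psi (fun t => law (W t) (wind E dl)).
    have := mono _ _ (rsmall_cst _ (c / 2)) (rsmall_lin 1 M_shift M_small) _.
    move=> /(_ _)/wrap[] => [t|]; first by rewrite mul1r.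
    rewrite (rmean_lin mpsi) // mul1r (ipsi t0 _ M_small).
    have -> : psi (fun=> c / 2) = c / 2.
      have := rmean_lin mpsi (c / 2 - 1) (rsmall_cst _ 1) (rsmall_cst _ 1).
      rewrite (rmean1 mpsi) (_ : (fun _ => _) = fun=> c / 2); first by move=> ->; ring.
      by apply/funext => s; ring.
    by move: (psi _) => k; lra.
  have b0' : rbounded (fun _ : H => 0 : R) by exists 0 => t; rewrite normr0.
  have s8 : rsmall (fun t => 8 * Th (fun=> 1) t + Th (fun=> 0) t).
    by apply: rsmall_lin; exact: Th_small.
  have h3 : psi (fun t => law (W t) (wind E dl)) <= 8 * v.
    (* [8 v] is treated as [7 v + v], the shape that linearity is stated in. *)
    have := mono _ _ M_small (rsmall_lin 7 (Th_small _ b1) (Th_small _ b1)) _.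
    rewrite (rmean_lin mpsi); [|exact: Th_small|exact: Th_small].
    move=> /(_ _)/wrap[] => [t|]; last by rewrite -/v; move: (psi _) => k; lra.
    rewrite -(Lw_lin rs 7 (tightW t) (aw _ 1 _) (aw _ 1 _)); try by move=> ?; rewrite normr1.
    apply: (Lw_mono rs); try exact: tightW; try exact: adm_wind.
      by apply: adm_lin; apply: (aw _ 1) => ?; rewrite normr1.
    move=> T uT; rewrite /wsum /=.
    under eq_bigr do rewrite mulr1.
    have m0 : 0 <= \sum_(g <- T) p g by rewrite sumr_ge0.
    have mk : dl * (size (seq.filter (mem E) T))%:R <= 2 * \sum_(g <- T) p g.
      rewrite -ler_pdivrMl // (bigID (mem E)) /= ler_wpDr ?sumr_ge0 //.
      rewrite -big_filter mulrA.
      have : \sum_(g <- [seq x <- T | x \in E]) (dl / 2) <= \sum_(g <- [seq x <- T | x \in E]) p g.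
        rewrite big_seq [leRHS]big_seq; apply: ler_sum => g; rewrite mem_filter => /andP[gE _].
        exact: pE.
      by rewrite big_const_seq count_predT iter_addr_0 -[_ *+ _]mulr_natr [2^-1 * _]mulrC.
    have bern k : 1 - dl * k%:R <= (1 - dl) ^+ k.
      elim: k => [|k IH]; first by rewrite mulr0 subr0.
      rewrite exprS -natr1.
      have k0 : (0 : R) <= k%:R by [].
      have e0 : 0 <= (1 - dl) ^+ k by rewrite exprn_ge0 // subr_ge0.
      move: IH k0 e0; move: (k%:R) (_ ^+ _) => a y IH a0 y0; nra.
    have := bern (size (seq.filter (mem E) T)); have /andP[_] := wind_bd E T dd.
    rewrite /wind; move: (\sum_(g <- T) p g) m0 mk => m m0.
    move: ((1 - dl) ^+ _) => y; move: (dl * _) => z zm y2 zy.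
    have m1 : 0 < 1 + m by rewrite ltr_wpDr.
    (* Bernoulli's inequality and [p >= dl / 2] on [E] give [2 (1 - y) <= 4 m], which settles
       [m <= 1]; for larger [m] the bound [2 (1 - y) <= 2] is enough. *)
    have key : 2 * (1 - y) * (1 + m) <= 8 * m.
      have [m1'|m1'] := leP m 1; nra.
    rewrite -(ler_pdivlMr _ _ m1) in key.
    by move: key; rewrite -mulrA; move: (m / _) => k; lra.
  by move: h2 h3; move: (psi _) => k; lra.
have v_gt0 : 0 < v by rewrite (lt_le_trans _ v0) // divr_gt0.
exists (fun f => psi (Th f) / v); split; first split.
- move=> k f h bf bh; rewrite Th_lin // (rmean_lin mpsi); try exact: Th_small.
  by rewrite mulrDl mulrA.
- move=> f bf f0; rewrite divr_ge0 ?(ltW v_gt0) //; apply: (rmean_ge0 mpsi); first exact: Th_small.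
  move=> t; have [K fK] := bf.
  rewrite -(mul0r (ip mu (W t) (W t))) -(Lw_cst rs 0 (tightW t)).
  apply: (Lw_mono rs); try exact: tightW; try exact: adm_cst; first exact: aw fK.
  by move=> T _; apply: wsum_ge0 => // g; exact: f0.
- by rewrite divff // gt_eqF.
move=> s f sQ f1; have bf : rbounded f by exists 1.
have bfs : rbounded (fun t => f (s * t)%g) by exists 1 => t.
have [F FN hF] := hN _ sQ.
have sF k : \sum_(g <- map (fun g => k * g)%g F) p g <= b.
  rewrite big_map (le_trans (ler_sum _ (fun g _ => proj2 (andP (pdl (k * g)%g))))) //.
  rewrite big_const_seq count_predT iter_addr_0 -mulr_natr.
  apply: (@le_trans _ _ (dl0 * N.+1%:R)); last by rewrite /dl0 divfK // gt_eqF.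
  by rewrite ler_pM // ?ler_nat ltnW.
pose fs t := f (s * t)%g.
have fs1 t : `|fs t| <= 1 by exact: f1.
(* The factor [W s^-1] moves the random set essentially within [F], at a cost of [b + 2 (2 b)]; the
   slow variation of [p] costs [2 b] more. *)
have close t : `|Th fs (s^-1 * t)%g - Th f t| <= 7 * b.
  pose u := wsum p (fs \o pi); have au : adm u by exact: (aw _ _ fs1).
  have uh : cunit (cact (j s^-1%g) (W t)) by exact: cunit_cact.
  have u1 T : `|u T| <= 1 by apply: wsum_norm => // g; exact: fs1.
  have k1 : `|law (cmul (cact 1%g (W s^-1%g)) (cact (j s^-1%g) (W t))) u -
      law (cact (j s^-1%g) (W t)) u| <= b + 2 * (2 * b).
    apply: hF => // T uT; apply: le_trans (wsum_drop p0 _ _ uT) _; first by move=> g; exact: fs1.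
    by rewrite ler_wpM2l // sF.
  rewrite cact1 -lawW_mul // law_cact in k1.
  have k2 : `|law (W t) (fun T => u (map (fun g => j s^-1 * g)%g T)) - Th f t| <= 2 * b.
    have au' : adm (fun T => u (map (fun g => j s^-1 * g)%g T)).
      split; first by move=> T T' TT'; apply: (proj1 au); exact: perm_map.
      by exists 1 => T.
    have := Lw_close rs (tightW t) au' (aw _ _ f1) (c := 2 * b).
    rewrite ip_unit // mulr1; apply=> T _.
    rewrite (_ : f \o pi = fun g => (fs \o pi) (j s^-1 * g)%g).
      apply: wsum_shift => //; [exact: ltW|by move=> g; exact: fs1|].
      by move=> g; apply: pQ; apply/mapP; exists s.
    by apply/funext => g; rewrite /= piE /fs mulVKg.
  move: k1 k2; rewrite /Th -/u; move: (law _ _) (law _ _) (law _ _) => a1 a2 a3.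
  rewrite !ler_norml => /andP[? ?] /andP[? ?]; apply/andP; split; lra.
have S1 : rsmall (fun t => Th fs (s^-1 * t)%g) by exact: rsmall_shift (Th_small _ bfs).
have S2 := Th_small _ bf.
have e1 : psi (fun t => Th fs (s^-1 * t)%g) = psi (Th fs) by exact: ipsi (Th_small _ bfs).
have le1 : psi (Th fs) <= 7 * b + psi (Th f).
  have := mono _ _ S1 (rsmall_lin (7 * b) (rsmall_cst _ 1) S2) _.
  rewrite (rmean_lin mpsi) ?(rmean1 mpsi) ?mulr1 ?e1 //; last exact: rsmall_cst.
  by apply=> t; move: (close t); rewrite ler_norml => /andP[_]; lra.
have le2 : psi (Th f) <= 7 * b + psi (Th fs).
  have := mono _ _ S2 (rsmall_lin (7 * b) (rsmall_cst _ 1) S1) _.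
  rewrite (rmean_lin mpsi) ?(rmean1 mpsi) ?mulr1 ?e1 //; last exact: rsmall_cst.
  by apply=> t; move: (close t); rewrite ler_norml => /andP[+ _]; lra.
rewrite -mulrBl normrM normfV (gtr0_norm v_gt0) ler_pdivrMr //.
apply: (@le_trans _ _ (7 * b)); first by rewrite ler_norml; apply/andP; split; lra.
apply: (@le_trans _ _ (ep * (c / 32))); last by rewrite ler_wpM2l // ltW.
have : 0 < c * ep by rewrite mulr_gt0.
rewrite /b; lra.
Qed.

End amenability.

(** * Vectors of minimal norm *)

Section limits.
Context (R : realType) d (T : measurableType d) (mu : probability T R).
Implicit Types f g : bfun R T.

(** The expectations of the absolute increments are summable, so the sum of these increments is
    finite almost everywhere and the telescoping series converges absolutely. *)
Lemma fast_cvg (f_ : nat -> bfun R T) :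
  (forall n, Ex mu (babs (f_ n.+1 - f_ n)) <= 2^-1 ^+ n) ->
  {ae mu, forall x, cvgn (fun n => f_ n x)}.
Proof.
move=> fE; pose h n x := ((babs (f_ n.+1 - f_ n)) x)%:E.
have mh n : measurable_fun setT (h n).
  by apply/measurable_EFinP; exact: (measurable_bfun (babs _)).
have h0 n x : True -> (0 <= h n x)%E by move=> _; rewrite /h lee_fin /=; exact: normr_ge0.
have ih n : (\int[mu]_x h n x = (Ex mu (babs (f_ n.+1 - f_ n)))%:E)%E.
  by rewrite /Ex /Rintegral fineK //; exact: integrable_fin_num (bfun_integrable mu _).
have mH : measurable_fun setT (fun x => \sum_(n <oo) h n x)%E.
  by apply: ge0_emeasurable_sum => // n x _ _; exact: h0.
have iH : (\int[mu]_x (\sum_(n <oo) h n x) <= 2%:E)%E.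
  rewrite integral_nneseries //.
  apply: lime_le; first by apply: is_cvg_nneseries => n _ _; apply: integral_ge0 => x; exact: h0.
  have geo k : \sum_(0 <= i < k) (2^-1 : R) ^+ i = 2 * (1 - 2^-1 ^+ k).
    elim: k => [|k IH]; first by rewrite big_nil subrr mulr0.
    rewrite big_nat_recr //= IH exprS; move: (_ ^+ k) => a; lra.
  near=> n; under eq_bigr do rewrite ih; rewrite sumEFin lee_fin.
  apply: (@le_trans _ _ (\sum_(0 <= i < n) 2^-1 ^+ i)); first exact: ler_sum.
  rewrite geo.
  by have : 0 <= (2^-1 : R) ^+ n by []; move: (_ ^+ n) => k; lra.
have intH : mu.-integrable setT (fun x => \sum_(n <oo) h n x)%E.
  apply/integrableP; split=> //.
  rewrite (eq_integral (fun x => \sum_(n <oo) h n x)%E); last first.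
    by move=> x _; rewrite gee0_abs // nneseries_ge0 // => n _ _; exact: h0.
  by rewrite (le_lt_trans iH) ?ltry.
apply: filterS (integrable_ae measurableT intH) => x /(_ I) Hx.
have -> : (fun n => f_ n x) = fun n => f_ 0%N x + series (telescope (fun n => f_ n x)) n.
  by apply/funext => n; rewrite -eq_sum_telescope.
apply: is_cvgD; first exact: is_cvg_cst.
apply: normed_cvg.
change (cvgn (series (fun n => `|telescope (fun n => f_ n x) n|))).
apply: nondecreasing_is_cvgn.
  by apply/nondecreasing_seqP => n; rewrite !seriesEnat /= big_nat_recr //= lerDl.
exists (fine (\sum_(n <oo) h n x)%E) => _ [n _ <-]; rewrite -lee_fin fineK //.
rewrite seriesEnat /= -sumEFin.
by apply: nneseries_lim_ge => k _ _; exact: h0.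
Unshelve. all: by end_near. Qed.

Lemma Ex_dominated (f_ : nat -> bfun R T) f (M : R) :
  (forall n x, `|f_ n x| <= M) ->
  {ae mu, forall x, (fun n => f_ n x) @ \oo --> f x} ->
  (fun n => Ex mu (f_ n)) @ \oo --> Ex mu f.
Proof.
move=> fM ff.
have [] := @dominated_convergence _ T R mu setT measurableT
  (fun n x => (f_ n x)%:E) (fun x => (f x)%:E) (cst M%:E).
- by move=> n; exact/measurable_EFinP/measurable_bfun.
- exact/measurable_EFinP/measurable_bfun.
- by apply: filterS ff => x fx _; apply/fine_cvgP; split; [exact: nearW|exact: fx].
- exact: finite_measure_integrable_cst.
- by apply: aeW => x n _; rewrite lee_fin.
move=> _ _ h; apply: fine_cvg; apply: cvg_trans h _; rewrite fineK //.
exact: integrable_fin_num (bfun_integrable mu f).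
Qed.

Lemma L2_limit (F_ : nat -> cpx R T) : (forall n x, nsq (F_ n) x <= 1) ->
  (forall n, ip mu (F_ n.+1 - F_ n) (F_ n.+1 - F_ n) <= 4^-1 ^+ n) ->
  exists F : cpx R T, (forall x, nsq F x <= 1) /\
    {ae mu, forall x, (fun n => (F_ n).1 x) @ \oo --> F.1 x /\
                      (fun n => (F_ n).2 x) @ \oo --> F.2 x}.
Proof.
move=> F1 Fip.
have [b1 b2] : (forall n x, `|(F_ n).1 x| <= 1) /\ (forall n x, `|(F_ n).2 x| <= 1).
  by split=> n x; rewrite -(@ler_pXn2r _ 2) ?nnegrE // expr1n real_normK ?num_real //;
    apply: le_trans (F1 n x); rewrite nsqE ?lerDl ?lerDr sqr_ge0.
have fast (f : nat -> bfun R T) : (forall n, Ex mu (f n * f n) <= 4^-1 ^+ n) ->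
    forall n, Ex mu (babs (f n)) <= 2^-1 ^+ n.
  move=> fE n; rewrite -(@ler_pXn2r _ 2) ?nnegrE ?exprn_ge0 //; last first.
    by apply: Ex_ge0 => x; exact: normr_ge0.
  rewrite -exprM mulnC exprM (_ : 2^-1 ^+ 2 = 4^-1 :> R); last by field.
  apply: le_trans (Ex_sqr_le _ _) _; apply: le_trans (fE n).
  by apply: Ex_le => x; rewrite !bfunM /= -!expr2 real_normK ?num_real.
have c1 : {ae mu, forall x, cvgn (fun n => (F_ n).1 x)}.
  apply: fast_cvg; apply: (fast (fun n => (F_ n.+1).1 - (F_ n).1)) => n.
  by apply: le_trans (Fip n); apply: Ex_le => x; rewrite [leRHS]bfunD lerDl bfunM -expr2 sqr_ge0.
have c2 : {ae mu, forall x, cvgn (fun n => (F_ n).2 x)}.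
  apply: fast_cvg; apply: (fast (fun n => (F_ n.+1).2 - (F_ n).2)) => n.
  by apply: le_trans (Fip n); apply: Ex_le => x; rewrite [leRHS]bfunD lerDr bfunM -expr2 sqr_ge0.
(* Upper limits are measurable and defined everywhere; cutting them off outside [B] keeps the
   modulus at most one at every point, not just almost everywhere. *)
pose g1 x := limn_sup (fun n => (F_ n).1 x); pose g2 x := limn_sup (fun n => (F_ n).2 x).
have mg (f : nat -> bfun R T) : (forall n x, `|f n x| <= 1) ->
    measurable_fun setT (fun x => limn_sup (fun n => f n x)).
  move=> f1; apply: measurable_fun_limn_sup => [x _|x _|n].
  - by exists 1 => _ [n _ <-]; have := f1 n x; rewrite ler_norml => /andP[].
  - by exists (-1) => _ [n _ <-]; have := f1 n x; rewrite ler_norml => /andP[].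
  - exact: measurable_bfun.
have mg1 : measurable_fun setT g1 by exact: (mg (fun n => (F_ n).1)).
have mg2 : measurable_fun setT g2 by exact: (mg (fun n => (F_ n).2)).
pose B := [set x | g1 x ^+ 2 + g2 x ^+ 2 <= 1].
have mB : measurable B.
  rewrite (_ : B = (fun x => g1 x ^+ 2 + g2 x ^+ 2) @^-1` `]-oo, 1]).
    rewrite -[X in measurable X]setTI.
    have mm : measurable_fun setT (fun x => g1 x ^+ 2 + g2 x ^+ 2).
      by apply: measurable_funD; apply: measurable_funX.
    by apply: mm => //; exact: measurable_itv.
  by apply/seteqP; split=> x /=; rewrite in_itv.
have bm (g : T -> R) : measurable_fun setT g -> (forall x, B x -> `|g x| <= 1) ->
    (fun x => g x * (\1_B x)) \in @bmeas R _ T.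
  move=> mgg gB; apply/bmeasP; split.
    by apply: measurable_funM => //; exact: measurable_indic.
  exists 1 => x; rewrite indicE; case: (boolP (x \in B)) => [/set_mem /gB|_].
    by rewrite mulr1.
  by rewrite mulr0 normr0.
have B1 x : B x -> `|g1 x| <= 1.
  move=> Bx; rewrite -(@ler_pXn2r _ 2) ?nnegrE // expr1n real_normK ?num_real //.
  by apply: le_trans Bx; rewrite lerDl sqr_ge0.
have B2 x : B x -> `|g2 x| <= 1.
  move=> Bx; rewrite -(@ler_pXn2r _ 2) ?nnegrE // expr1n real_normK ?num_real //.
  by apply: le_trans Bx; rewrite lerDr sqr_ge0.
exists (BFun (bm g1 mg1 B1), BFun (bm g2 mg2 B2)); split.
  move=> x; rewrite nsqE /= indicE; case: (boolP (x \in B)) => [/set_mem|_].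
    by rewrite !mulr1.
  by rewrite !mulr0 expr0n addr0.
apply: filterS2 c1 c2 => x /cvg_ex[l1 h1] /cvg_ex[l2 h2].
have e1 : g1 x = l1 by apply: (cvg_lim (@Rhausdorff R)); exact: cvg_sups h1.
have e2 : g2 x = l2 by apply: (cvg_lim (@Rhausdorff R)); exact: cvg_sups h2.
suff Bx : B x by rewrite /= indicE mem_set // !mulr1 e1 e2.
rewrite /B /= e1 e2.
have cv : (fun n => nsq (F_ n) x) @ \oo --> l1 ^+ 2 + l2 ^+ 2.
  rewrite (_ : (fun n => _) = (fun n => (F_ n).1 x ^+ 2 + (F_ n).2 x ^+ 2)).
    by apply: cvgD; [rewrite !expr2|rewrite !expr2]; apply: cvgM.
  by apply/funext => n; rewrite nsqE.
have cc : cvgn (fun n => nsq (F_ n) x) by apply/cvg_ex; eexists; exact: cv.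
by rewrite -(cvg_lim (@Rhausdorff R) cv); apply: limr_le => //; exact: nearW.
Qed.

Definition mid (f h : cpx R T) : cpx R T :=
  (bcst _ 2^-1 * (f.1 + h.1), bcst _ 2^-1 * (f.2 + h.2)).

Lemma mid_parallelogram (f h : cpx R T) :
  ip mu (f - h) (f - h) = 2 * ip mu f f + 2 * ip mu h h - 4 * ip mu (mid f h) (mid f h).
Proof.
rewrite /ip -!ExZ -ExD -ExB; congr Ex; apply: bfun_eq => x.
rewrite bfunB bfunD !bfunM; change (nsq (f - h) x = 2 * nsq f x + 2 * nsq h x - 4 * nsq (mid f h) x).
rewrite !nsqE; change ((f.1 x - h.1 x) ^+ 2 + (f.2 x - h.2 x) ^+ 2 =
  2 * (f.1 x ^+ 2 + f.2 x ^+ 2) + 2 * (h.1 x ^+ 2 + h.2 x ^+ 2) -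
  4 * ((2^-1 * (f.1 x + h.1 x)) ^+ 2 + (2^-1 * (f.2 x + h.2 x)) ^+ 2)).
by move: (f.1 x) (f.2 x) (h.1 x) (h.2 x) => a b a' b'; field.
Qed.

Lemma nsq_mid (f h : cpx R T) x : nsq f x <= 1 -> nsq h x <= 1 -> nsq (mid f h) x <= 1.
Proof.
rewrite !nsqE; change (f.1 x ^+ 2 + f.2 x ^+ 2 <= 1 -> h.1 x ^+ 2 + h.2 x ^+ 2 <= 1 ->
  (2^-1 * (f.1 x + h.1 x)) ^+ 2 + (2^-1 * (f.2 x + h.2 x)) ^+ 2 <= 1).
move: (f.1 x) (f.2 x) (h.1 x) (h.2 x) => a b a' b'.
have := sqr_ge0 (a - a'); have := sqr_ge0 (b - b'); nra.
Qed.

(** By the parallelogram identity a minimizing sequence is Cauchy and two points of minimal norm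
    agree almost everywhere. As functions are not identified modulo null sets, [C] is asked to be
    closed under almost everywhere convergence to functions of modulus at most one. *)
Lemma min_norm (C : cpx R T -> Prop) : (exists f : cpx R T, C f) ->
  (forall f : cpx R T, C f -> forall x, nsq f x <= 1) ->
  (forall f h : cpx R T, C f -> C h -> C (mid f h)) ->
  (forall (f_ : nat -> cpx R T) (f : cpx R T), (forall n, C (f_ n)) -> (forall x, nsq f x <= 1) ->
    {ae mu, forall x, (fun n => (f_ n).1 x) @ \oo --> f.1 x /\
                      (fun n => (f_ n).2 x) @ \oo --> f.2 x} -> C f) ->
  exists f : cpx R T, C f /\ forall h : cpx R T, C h -> ip mu h h = ip mu f f -> ip mu (h - f) (h - f) = 0.
Proof.
move=> [f0 Cf0] C1 Cmid Clim.
pose S := [set ip mu f f | f in C]; pose m := inf S.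
have hS : has_inf S.
  by split; [exists (ip mu f0 f0), f0|exists 0 => _ [f _ <-]; exact: ip_ge0].
have mS (f : cpx R T) : C f -> m <= ip mu f f by move=> Cf; apply: (ge_inf hS.2); exists f.
(* The parallelogram bound on consecutive terms is twice the sum of two successive slacks, hence at
   most [4^-1 ^+ n] as [L2_limit] requires. *)
have /choice[f_ hf] : forall n : nat, exists f : cpx R T, C f /\ ip mu f f <= m + 4^-1 ^+ n / 8.
  move=> n; have e0 : (0 : R) < 4^-1 ^+ n / 8 by rewrite divr_gt0 // exprn_gt0.
  by have [_ [f Cf <-] /ltW fm] := inf_adherent e0 hS; exists f.
have close (f h : cpx R T) : C f -> C h -> ip mu (f - h) (f - h) <= 2 * ip mu f f + 2 * ip mu h h - 4 * m.
  by move=> Cf Ch; rewrite mid_parallelogram lerD2l lerN2 ler_wpM2l // mS //; exact: Cmid.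
have [|n|f [f1 ff]] := @L2_limit f_.
- by move=> n; apply: C1; exact: (hf n).1.
- apply: le_trans (close _ _ (hf n.+1).1 (hf n).1) _.
  have := (hf n.+1).2; have := (hf n).2; rewrite exprS.
  have : 0 <= (4^-1 : R) ^+ n by [].
  by move: (ip mu _ _) (ip mu _ _) (_ ^+ n) => a b k; lra.
have Cf : C f by apply: (Clim f_) => // n; exact: (hf n).1.
have fm : ip mu f f = m.
  apply/eqP; rewrite eq_le mS // andbT.
  have cv : (fun n => ip mu (f_ n) (f_ n)) @ \oo --> ip mu f f.
    apply: (@Ex_dominated _ _ 1).
      by move=> n x; rewrite ger0_norm ?nsq_ge0 //; apply: C1; exact: (hf n).1.
    apply: filterS ff => x [h1 h2].
    rewrite (_ : (fun n => _) = (fun n => (f_ n).1 x * (f_ n).1 x + (f_ n).2 x * (f_ n).2 x)) //.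
    by apply: cvgD; apply: cvgM.
  have cc : cvgn (fun n => ip mu (f_ n) (f_ n)) by apply/cvg_ex; eexists; exact: cv.
  apply/ler_addgt0Pr => e e0; rewrite -(cvg_lim (@Rhausdorff R) cv).
  apply: limr_le => //.
  have g0 : (fun n => (4^-1 : R) ^+ n / 8) @ \oo --> (0 : R).
    rewrite -[X in _ --> X](mul0r (8^-1)); apply: cvgMl.
    by apply: cvg_expr; rewrite ger0_norm //; lra.
  near=> n; apply: le_trans (hf n).2 _; rewrite lerD2l.
  near: n; have /cvgrPdist_le/(_ _ e0) := g0; apply: filterS => n.
  by rewrite sub0r normrN ger0_norm // divr_ge0 // exprn_ge0.
exists f; split=> // h Ch hh; apply/eqP; rewrite eq_le ip_ge0 andbT.
apply: le_trans (close _ _ Ch Cf) _; rewrite hh fm; move: (m) => k; lra.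
Unshelve. all: by end_near. Qed.

End limits.

(** * Complex values and product spaces *)

Section values.
Context (R : realType) d (T : measurableType d).
Implicit Types f h : cpx R T.

Definition cv f (x : T) : R[i] := Complex (f.1 x) (f.2 x).

Definition ccst (z : R[i]) : cpx R T := (bcst T (complex.Re z), bcst T (complex.Im z)).

Lemma cv_cst z x : cv (ccst z) x = z. Proof. by case: z. Qed.

Lemma cv_mul f h x : cv (cmul f h) x = cv f x * cv h x.
Proof. by []. Qed.

Lemma cv_neq0 f x : cunit f -> cv f x != 0.
Proof.
move=> uf; apply/negP => /eqP[e1 e2]; have := uf x.
by rewrite nsqE e1 e2 expr0n addr0 => /eqP; rewrite eq_sym oner_eq0.
Qed.

Lemma cv_conj f x : cunit f -> cv (cconj f) x = (cv f x)^-1.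
Proof.
move=> uf; apply: (mulIf (cv_neq0 x uf)); rewrite mulVf ?cv_neq0 //.
apply/eqP; rewrite eq_complex; apply/andP; split; apply/eqP.
- by change (f.1 x * f.1 x - (- f.2 x) * f.2 x = 1); rewrite -(uf x) nsqE; ring.
- by change (f.1 x * f.2 x + (- f.2 x) * f.1 x = 0); ring.
Qed.

Lemma cv_sub0 f h x : (cv f x = cv h x) <-> nsq (f - h) x = 0.
Proof.
rewrite nsqE; change (cv f x = cv h x <-> (f.1 x - h.1 x) ^+ 2 + (f.2 x - h.2 x) ^+ 2 = 0).
split=> [[-> ->]|]; first by rewrite !subrr expr0n addr0.
move=> /eqP; rewrite paddr_eq0 ?sqr_ge0 // !sqrf_eq0 !subr_eq0 => /andP[/eqP e1 /eqP e2].
by rewrite /cv e1 e2.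
Qed.

Context (mu : probability T R).

Lemma cv_ae f h : {ae mu, forall x, cv f x = cv h x} <-> ip mu (f - h) (f - h) = 0.
Proof.
split=> [fh|e]; last first.
  by have := Ex_eq0_ae (nsq_ge0 _) e; apply: filterS => x /cv_sub0.
rewrite -(Ex0 mu); apply: ae_Ex_eq; apply: filterS fh => x /cv_sub0; exact.
Qed.

End values.

Lemma ae_section (R : realType) d (T : measurableType d) d' (T' : measurableType d')
    (mu : probability T R) (nu : probability T' R) (f h : cpx R (T * T')%type) :
  {ae (mu \x nu)%E, forall p, cv f p = cv h p} ->
  exists x, {ae nu, forall y, cv f (x, y) = cv h (x, y)}.
Proof.
move=> /cv_ae e; have := Ex_bint2 mu nu (nsq (f - h)); rewrite [LHS]e => /esym e2.
have [|x ex] := Ex_eq0_point _ e2.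
  by move=> x; apply: Ex_ge0 => y; exact: nsq_ge0.
exists x; have := Ex_eq0_ae _ ex => /(_ _)/wrap[] => [y|]; first exact: nsq_ge0.
by apply: filterS => y ey; apply/cv_sub0.
Qed.

Lemma ae_pull (R : realType) d (T : measurableType d) d' (T' : measurableType d')
    (mu : probability T R) (nu : probability T' R) (p : T -> T') (hp : mpres mu nu p)
    (f h : cpx R T') :
  {ae mu, forall x, cv f (p x) = cv h (p x)} -> {ae nu, forall y, cv f y = cv h y}.
Proof.
move=> fh; apply/cv_ae; rewrite /ip -(Ex_comp hp) -(Ex0 mu); apply: ae_Ex_eq.
by apply: filterS fh => x /cv_sub0.
Qed.

Section rearrange.
Context (R : realType) d1 (A : measurableType d1) d2 (B : measurableType d2)
  d3 (C : measurableType d3) (a : probability A R) (b : probability B R)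
  (c : probability C R).

Lemma mpres_assoc : mpres ((a \x b) \x c)%E (a \x (b \x c))%E
  (fun p : (A * B) * C => (p.1.1, (p.1.2, p.2))).
Proof.
have m : measurable_fun setT (fun p : (A * B) * C => (p.1.1, (p.1.2, p.2))).
  apply: measurable_fun_pair; first exact: (measurableT_comp measurable_fst measurable_fst).
  apply: measurable_fun_pair; last exact: measurable_snd.
  exact: (measurableT_comp measurable_snd measurable_fst).
apply: (@mpres_of_Ex _ _ _ _ _ ((a \x b) \x c)%E (a \x (b \x c))%E _ m) => f.
rewrite !Ex_bint2; congr Ex; apply: bfun_eq => x.
have e2 F (y : A) : bint2 a (b \x c)%E F y = Ex (b \x c)%E (bsec1 F y) by [].
by rewrite e2 Ex_bint2; congr Ex; apply: bfun_eq => y; congr Ex; exact: bfun_eq.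
Qed.

Lemma mpres_swap : mpres (a \x (b \x c))%E (b \x (a \x c))%E
  (fun p : A * (B * C) => (p.2.1, (p.1, p.2.2))).
Proof.
have m : measurable_fun setT (fun p : A * (B * C) => (p.2.1, (p.1, p.2.2))).
  apply: measurable_fun_pair; first exact: (measurableT_comp measurable_fst measurable_snd).
  apply: measurable_fun_pair; first exact: measurable_fst.
  exact: (measurableT_comp measurable_snd measurable_snd).
have m' : measurable_fun setT (fun p : (A * B) * C => (p.1.2, (p.1.1, p.2))).
  apply: measurable_fun_pair; first exact: (measurableT_comp measurable_snd measurable_fst).
  apply: measurable_fun_pair; last exact: measurable_snd.
  exact: (measurableT_comp measurable_fst measurable_fst).
apply: (@mpres_of_Ex _ _ _ _ _ (a \x (b \x c))%E (b \x (a \x c))%E _ m) => f.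
pose K := bint2 (a \x b)%E c (bcomp m' f).
have e1 F (y : A) : bint2 a (b \x c)%E F y = Ex (b \x c)%E (bsec1 F y) by [].
have e2 F (y : B) : bint2 b (a \x c)%E F y = Ex (a \x c)%E (bsec1 F y) by [].
have -> : Ex (a \x (b \x c))%E (bcomp m f) = Ex (a \x b)%E K.
  rewrite !Ex_bint2; congr Ex; apply: bfun_eq => x.
  by rewrite e1 Ex_bint2; congr Ex; apply: bfun_eq => y; congr Ex; exact: bfun_eq.
rewrite Ex_bint1 Ex_bint2; congr Ex; apply: bfun_eq => y.
by rewrite e2 Ex_bint2; congr Ex; apply: bfun_eq => x; congr Ex; exact: bfun_eq.
Qed.

End rearrange.

(** * Coboundaries *)

Lemma mpres_inv (R : realType) d1 (A : measurableType d1) d2 (B : measurableType d2)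
    (m1 : probability A R) (m2 : probability B R) (h : A -> B) (g : B -> A) :
  mpres m1 m2 h -> measurable_fun setT g -> cancel h g -> mpres m2 m1 g.
Proof.
move=> [mh eh] mg hg; split=> // S mS; rewrite -eh; last first.
  by rewrite -[X in measurable X]setTI; exact: mg.
by congr (m1 _); apply/seteqP; split=> x /=; rewrite hg.
Qed.

Lemma mpres_id (R : realType) d (T : measurableType d) (mu : probability T R) :
  mpres mu mu (fun x : T => x).
Proof. by split. Qed.

Lemma mpres_mid (R : realType) d1 (A : measurableType d1) d2 (B : measurableType d2)
  d3 (C : measurableType d3) d4 (D : measurableType d4) (a : probability A R)
  (b : probability B R) (c : probability C R) (e : probability D R) :
  mpres ((a \x b) \x (c \x e))%E ((a \x c) \x (b \x e))%E
  (fun p : (A * B) * (C * D) => ((p.1.1, p.2.1), (p.1.2, p.2.2))).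
Proof.
have k1 := mpres_assoc a b (c \x e)%E.
have k2 := mpres_prod (mpres_id a) (mpres_swap b c e).
have mg : measurable_fun setT (fun p : A * (C * (B * D)) => ((p.1, p.2.1), p.2.2)).
  apply: measurable_fun_pair.
    apply: measurable_fun_pair; first exact: measurable_fst.
    exact: (measurableT_comp measurable_fst measurable_snd).
  exact: (measurableT_comp measurable_snd measurable_snd).
have k3 := mpres_inv (mpres_assoc a c (b \x e)%E) mg _.
move: k3 => /(_ _)/wrap[] => [[[x y] z] //|k3].
exact: mpres_comp (mpres_comp k1 k2) k3.
Qed.

Section coboundary.
Context (R : realType) d (T : measurableType d) (mu : probability T R).
Context (L : groupType) (a : L -> T -> T) (pa : pmp mu a).
Hypothesis aM : forall s t x, a (s * t)%g x = a s (a t x).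
Hypothesis a1 : forall x, a 1%g x = x.
Context (tau : nat -> L).
Hypotheses (mix_a : mixing pa) (tau_inj : injective tau).

Lemma ae_cst_of_invariant (f : cpx R T) :
  (forall n, {ae mu, forall x, cv f (a (tau n) x) = cv f x}) ->
  exists z, {ae mu, forall x, cv f x = z}.
Proof.
move=> inv; exists (Complex (Ex mu f.1) (Ex mu f.2)).
have c1 : {ae mu, forall x, f.1 x = Ex mu f.1}.
  by apply: (mixing_const mix_a tau_inj) => n; apply: filterS (inv n) => x [].
have c2 : {ae mu, forall x, f.2 x = Ex mu f.2}.
  by apply: (mixing_const mix_a tau_inj) => n; apply: filterS (inv n) => x [].
by apply: filterS2 c1 c2 => x e1 e2; rewrite /cv e1 e2.
Qed.

(** [cunit] demands modulus one at every point, while the modulus of [f] is known almost everywhere;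
    off [B] the value is set to 1. *)
Lemma unit_normalization (f : cpx R T) (r : R) : 0 < r ->
  {ae mu, forall x, nsq f x = r} ->
  exists g : cpx R T, cunit g /\
    {ae mu, forall x, cv g x = ((Num.sqrt r)^-1)%:C%C * cv f x}.
Proof.
move=> r0 fr; pose B := [set x | nsq f x = r].
have mB : measurable B.
  rewrite (_ : B = (nsq f : T -> R) @^-1` [set r]); last by apply/seteqP; split.
  rewrite -[X in measurable X]setTI; apply: measurable_bfun => //; exact: measurable_set1.
pose k := bcst T (Num.sqrt r)^-1.
pose g : cpx R T := (k * f.1 * bind R mB + (1 - bind R mB), k * f.2 * bind R mB).
have g1 x : g.1 x = (Num.sqrt r)^-1 * f.1 x * (x \in B)%:R + (1 - (x \in B)%:R).
  by rewrite /g !bfunE bindE.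
have g2 x : g.2 x = (Num.sqrt r)^-1 * f.2 x * (x \in B)%:R.
  by rewrite /g !bfunE bindE.
have sr : (Num.sqrt r)^-1 ^+ 2 * r = 1.
  by rewrite exprVn sqr_sqrtr ?ltW // mulVf // gt_eqF.
exists g; split=> [x|].
  rewrite nsqE g1 g2; case: (boolP (x \in B)) => [/set_mem|_]; last first.
    by rewrite !mulr0 subr0 add0r expr1n expr0n addr0.
  move=> fx; have {}fx : nsq f x = r by []; rewrite nsqE in fx; rewrite subrr addr0 !mulr1 !exprMn -mulrDr fx; exact: sr.
apply: filterS fr => x fx; have xB : x \in B by exact/mem_set.
rewrite /cv g1 g2 xB subrr addr0 !mulr1; apply/eqP; rewrite eq_complex /=.
by apply/andP; split; apply/eqP; ring.
Qed.

Definition tr (t : L) (f : cpx R T) : cpx R T := ccomp (pa t^-1%g).1 f.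

Context (D : L -> cpx R T).
Hypothesis Du : forall t, cunit (D t).
Hypothesis Dc : forall s t, {ae mu, forall x,
  cv (D (s * t)%g) x = cv (D s) x * cv (D t) (a s^-1%g x)}.

Let pi t f := cmul (D t) (tr t f).

Let nsq_pi t f x : nsq (pi t f) x = nsq f (a t^-1%g x).
Proof. by rewrite nsq_cmul bfunM Du mul1r. Qed.

Let pi1 t f x : (pi t f).1 x =
  (D t).1 x * f.1 (a t^-1%g x) - (D t).2 x * f.2 (a t^-1%g x).
Proof. by []. Qed.

Let ip_pi t f : ip mu (pi t f) (pi t f) = ip mu f f.
Proof.
have e : nsq (pi t f) = bcomp (pa t^-1%g).1 (nsq f).
  by apply: bfun_eq; exact: nsq_pi.
by change (Ex mu (nsq (pi t f)) = Ex mu (nsq f)); rewrite e Ex_comp.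
Qed.

Let piM s t f : {ae mu, forall x, cv (pi s (pi t f)) x = cv (pi (s * t)%g f) x}.
Proof.
apply: filterS (Dc s t) => x e; rewrite !cv_mul e -mulrA.
change (cv (tr s (pi t f)) x) with (cv (pi t f) (a s^-1%g x)); rewrite cv_mul.
change (cv (tr t f) (a s^-1%g x)) with (cv f (a t^-1%g (a s^-1%g x))).
by change (cv (tr (s * t)%g f) x) with (cv f (a (s * t)^-1%g x)); rewrite invgM aM.
Qed.

(* The vectors of norm at most one whose whole orbit under the unitary
   representation [pi] has real part of the mean at least [c0] form a closed
   convex invariant set; its point of minimal norm is fixed by [pi]. *)
Lemma coboundary (c0 : R) : 0 < c0 -> (forall t, c0 <= Ex mu (D t).1) ->
  exists f, cunit f /\
    forall t, {ae mu, forall x, cv f x = cv (D t) x * cv f (a t^-1%g x)}.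
Proof.
move=> c00 cD.
pose C (f : cpx R T) := (forall x, nsq f x <= 1) /\ forall t, c0 <= Ex mu (pi t f).1.
have [||||f [[f1 fc] fmin]] := @min_norm _ _ _ mu C.
(* The constant 1 belongs to [C] because [pi t] sends it to [D t]. *)
- exists (1, 0); split=> [x|t].
    by rewrite nsqE bfun1 bfun0 expr1n expr0n addr0.
  apply: le_trans (cD t) _; apply: Ex_le => x; rewrite pi1.
  by rewrite bfun1 bfun0 mulr1 mulr0 subr0.
- by move=> f [].
- move=> f h [f1 fc] [h1 hc]; split=> [x|t]; first exact: nsq_mid.
  have -> : Ex mu (pi t (mid f h)).1 = 2^-1 * (Ex mu (pi t f).1 + Ex mu (pi t h).1).
    rewrite -ExD -ExZ; congr Ex; apply: bfun_eq => x; rewrite bfunM bfunD !pi1.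
    set y := a t^-1%g x.
    change ((D t).1 x * (2^-1 * (f.1 y + h.1 y)) - (D t).2 x * (2^-1 * (f.2 y + h.2 y)) =
      2^-1 * (((D t).1 x * f.1 y - (D t).2 x * f.2 y) +
              ((D t).1 x * h.1 y - (D t).2 x * h.2 y))).
    by move: ((D t).1 x) ((D t).2 x) (f.1 y) (f.2 y) (h.1 y) (h.2 y) => *; ring.
  by have := fc t; have := hc t; move: (Ex _ _) (Ex _ _) => k k'; lra.
- move=> f_ f Cf f1 ff; split=> // t.
  have cv1 : (fun n => Ex mu (pi t (f_ n)).1) @ \oo --> Ex mu (pi t f).1.
    apply: (@Ex_dominated _ _ _ _ _ _ 1).
      move=> n x; rewrite -(@ler_pXn2r _ 2) ?nnegrE // expr1n real_normK ?num_real //.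
      apply: (@le_trans _ _ (nsq (pi t (f_ n)) x)); first by rewrite nsqE lerDl sqr_ge0.
      by rewrite nsq_pi; exact: (Cf n).1.
    apply: filterS (ae_comp (pa t^-1%g) ff) => x [h1 h2].
    rewrite (_ : (fun n => _) = (fun n => (D t).1 x * (f_ n).1 (a t^-1%g x) -
      (D t).2 x * (f_ n).2 (a t^-1%g x))) //.
    by apply: cvgB; [exact: cvgMr|exact: cvgMr].
  have cc : cvgn (fun n => Ex mu (pi t (f_ n)).1) by apply/cvg_ex; eexists; exact: cv1.
  rewrite -(cvg_lim (@Rhausdorff R) cv1); apply: limr_ge => //.
  by apply: nearW => n; exact: (Cf n).2.
have fix_ t : {ae mu, forall x, cv (pi t f) x = cv f x}.
  apply/cv_ae; apply: fmin; last exact: ip_pi.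
  split=> [x|s]; first by rewrite nsq_pi.
  apply: le_trans (fc (s * t)%g) _; rewrite le_eqVlt; apply/orP; left; apply/eqP.
  by apply: ae_Ex_eq; apply: filterS (piM s t f) => x [].
(* Since [D] has modulus one, a fixed vector has invariant modulus, constant by mixing; the constant
   is positive because [f] has mean of real part at least [c0], so [f] can be normalized. *)
have finv t : {ae mu, forall x, nsq f (a t x) = nsq f x}.
  have nc (g h : cpx R T) x y : cv g x = cv h y -> nsq g x = nsq h y.
    by move=> [e1 e2]; rewrite !nsqE e1 e2.
  by apply: filterS (fix_ t^-1%g) => x /nc <-; rewrite nsq_pi invgK.
have fconst := mixing_const mix_a tau_inj (fun n => finv (tau n)).
have r0 : 0 < Ex mu (nsq f).
  have h1 : c0 <= Ex mu f.1.
    apply: le_trans (fc 1%g) _; rewrite le_eqVlt; apply/orP; left; apply/eqP.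
    by apply: ae_Ex_eq; apply: filterS (fix_ 1%g) => x [].
  have h2 : Ex mu f.1 ^+ 2 <= Ex mu (nsq f).
    apply: le_trans (Ex_sqr_le _ _) _; apply: Ex_le => x.
    by rewrite nsqE bfunM -expr2 lerDl sqr_ge0.
  by apply: lt_le_trans h2; rewrite exprn_gt0 // (lt_le_trans c00).
have [g [ug gf]] := unit_normalization r0 fconst.
exists g; split=> // t.
apply: filterS3 gf (fix_ t) (ae_comp (pa t^-1%g) gf) => x e1 e2 e3.
by rewrite e1 e3 -e2 cv_mul mulrCA.
Qed.

End coboundary.

(** * Separation of variables *)

Section splitting.
Context (R : realType) d (T : measurableType d) (mu : probability T R).
Context (L : groupType) (a : L -> T -> T) (pa : pmp mu a) (tau : nat -> L).
Hypotheses (mix_a : mixing pa) (tau_inj : injective tau).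

Local Notation Q := (T * T)%type.
Local Notation nu := (mu \x mu)%E.
Local Notation muT := ((mu \x nu)%E : probability (T * Q)%type R).
Local Notation aQ := (pact a a).
Let pQ : pmp nu aQ := pmp_prod pa pa.

Lemma frac_invert (K : fieldType) (p q r s : K) : p != 0 -> q != 0 -> r != 0 ->
  s != 0 -> p * q^-1 = r * s^-1 -> s = r * q * p^-1.
Proof.
move=> p0 q0 r0 s0 e.
have : p * q^-1 * q * s = r * s^-1 * q * s by rewrite e.
by rewrite divfK // => e'; apply: (mulfI p0); rewrite e'; field; rewrite p0 s0.
Qed.

(* [f (x, q) f (x', q') / (f (x', q) f (x, q'))] is invariant, hence constant. *)
Lemma product_form (W : L -> cpx R T) (f : cpx R (T * Q)%type) :
  (forall t, cunit (W t)) -> cunit f ->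
  (forall t, {ae muT, forall p, cv (W t) p.1 * (cv (W t) p.2.2)^-1 =
     cv f p * (cv f (a t^-1%g p.1, aQ t^-1%g p.2))^-1}) ->
  exists (u : cpx R T) (k : cpx R Q) (c : R[i]), [/\ cunit u, cunit k &
    {ae muT, forall p, cv f p = c * cv u p.1 * cv k p.2}].
Proof.
move=> Wu uf Wf.
have e11 := mpres_prod (mpres_fst mu mu) (mpres_fst nu nu).
have e12 := mpres_prod (mpres_fst mu mu) (mpres_snd nu nu).
have e21 := mpres_prod (mpres_snd mu mu) (mpres_fst nu nu).
have e22 := mpres_prod (mpres_snd mu mu) (mpres_snd nu nu).
pose F : cpx R ((T * T) * (Q * Q))%type := cmul (cmul (ccomp e11.1 f) (ccomp e22.1 f))
  (cconj (cmul (ccomp e12.1 f) (ccomp e21.1 f))).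
have FE p : cv F p = cv f (p.1.1, p.2.1) * cv f (p.1.2, p.2.2) *
    (cv f (p.1.1, p.2.2) * cv f (p.1.2, p.2.1))^-1.
  rewrite cv_mul cv_conj //; apply: cunit_cmul; exact: cunit_ccomp.
have f0 p : cv f p != 0 by exact: cv_neq0.
have W0 t x : cv (W t) x != 0 by exact: cv_neq0.
have mixP : mixing (pmp_prod (pmp_prod pa pa) (pmp_prod pQ pQ)).
  by apply: mixing_prod; apply: mixing_prod => //; apply: mixing_prod.
have [n|z Fz] := ae_cst_of_invariant mixP tau_inj (f := F).
  set t := tau n; have H := Wf t^-1%g.
  apply: filterS3 (ae_comp e11 H) (ae_comp e12 H) (filterI (ae_comp e21 H) (ae_comp e22 H)).
  move=> [[x x'] [q q']] /= h11 h12 [h21 h22]; rewrite !FE /=.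
  rewrite invgK in h11 h12 h21 h22.
  have r11 := frac_invert (W0 _ _) (W0 _ _) (f0 _) (f0 _) h11.
  have r12 := frac_invert (W0 _ _) (W0 _ _) (f0 _) (f0 _) h12.
  have r21 := frac_invert (W0 _ _) (W0 _ _) (f0 _) (f0 _) h21.
  have r22 := frac_invert (W0 _ _) (W0 _ _) (f0 _) (f0 _) h22.
  rewrite r11 r12 r21 r22.
  move: (f0 (x, q)) (f0 (x, q')) (f0 (x', q)) (f0 (x', q')).
  move: (W0 t^-1%g x) (W0 t^-1%g x') (W0 t^-1%g q.2) (W0 t^-1%g q'.2).
  move: (cv f (x, q)) (cv f (x, q')) (cv f (x', q)) (cv f (x', q')).
  move: (cv _ x) (cv _ x') (cv _ q.2) (cv _ q'.2) => b1 b2 b3 b4 c1 c2 c3 c4.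
  by move=> n1 n2 n3 n4 m1 m2 m3 m4; field; rewrite ?n1 ?n2 ?n3 ?n4 ?m1 ?m2 ?m3 ?m4.
(* Regrouping as [((x', q'), (x, q))] lets Fubini freeze a generic [(x', q')]; the constant
   cross-ratio then expresses [f (x, q)] through [f (x, q')] and [f (x', q)]. *)
have mid := mpres_mid mu nu mu nu.
have [[x' q']] := ae_section (f := ccomp mid.1 F) (h := ccst _ z)
  (ltac:(by apply: filterS (ae_comp mid Fz) => p; rewrite cv_cst)).
move=> H; pose u : cpx R T := ccomp (pair2_measurable q') f.
pose k : cpx R Q := ccomp (pair1_measurable x') f.
exists u, k, (z * (cv f (x', q'))^-1); split; try exact: cunit_ccomp.
apply: filterS H => -[x q]; rewrite cv_cst => <-.
change (cv (ccomp mid.1 F) (x', q', (x, q))) with (cv F ((x', x), (q', q))).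
rewrite -[cv u _]/(cv f (x, q')) -[cv k _]/(cv f (x', q)).
rewrite FE /=; move: (f0 (x, q)) (f0 (x, q')) (f0 (x', q)) (f0 (x', q')).
move: (cv f (x, q)) (cv f (x, q')) (cv f (x', q)) (cv f (x', q')) => b1 b2 b3 b4 *.
by field; apply/and3P.
Qed.

(** Inserting the product form into the coboundary equation separates the variables: a function of
    [x] equals almost everywhere a function of [(v, y)], so it is constant. *)
Lemma splitting (W : L -> cpx R T) (f : cpx R (T * Q)%type) :
  (forall t, cunit (W t)) -> cunit f ->
  (forall t, {ae muT, forall z, cv (W t) z.2.1 * (cv (W t) z.2.2)^-1 =
     cv f z * (cv f (a t^-1%g z.1, aQ t^-1%g z.2))^-1}) ->
  exists u : cpx R T, cunit u /\ forall t, exists c : R[i],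
    {ae mu, forall x, cv (W t) x * cv u (a t^-1%g x) * (cv u x)^-1 = c}.
Proof.
move=> Wu uf Wf; have sw := mpres_swap mu mu mu.
have Wf' t : {ae muT, forall p, cv (W t) p.1 * (cv (W t) p.2.2)^-1 =
     cv (ccomp sw.1 f) p * (cv (ccomp sw.1 f) (a t^-1%g p.1, aQ t^-1%g p.2))^-1}.
  by apply: filterS (ae_comp sw (Wf t)) => -[x [v y]].
have [u [k [c [uu uk uE]]]] := product_form Wu (cunit_ccomp sw.1 uf) Wf'.
exists u; split=> // t.
have f0 p : cv (ccomp sw.1 f) p != 0 by apply: cv_neq0; exact: cunit_ccomp.
have c0 : c != 0.
  by have [p ep] := ae_exists uE; apply: contraNneq (f0 p) => c0; rewrite ep c0 !mul0r.
pose A : cpx R T := cmul (cmul (W t) (ccomp (pa t^-1%g).1 u)) (cconj u).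
pose B : cpx R Q := cmul (cmul (ccomp (mpres_snd mu mu).1 (W t)) k)
  (cconj (ccomp (pQ t^-1%g).1 k)).
have AE x : cv A x = cv (W t) x * cv u (a t^-1%g x) * (cv u x)^-1.
  by rewrite cv_mul cv_conj.
have BE q : cv B q = cv (W t) q.2 * cv k q * (cv k (aQ t^-1%g q))^-1.
  by rewrite cv_mul cv_conj //; exact: cunit_ccomp.
have AB : {ae muT, forall p, cv A p.1 = cv B p.2}.
  have e2 := ae_comp (pmp_prod pa pQ t^-1%g) uE.
  have FF := ae_filter_ringOfSetsType muT.
  have H := @filterI _ _ FF _ _ (Wf' t) (@filterI _ _ FF _ _ uE e2).
  apply: (@filterS _ _ FF _ _ _ H) => -[x q] /= [h1 [h2 h3]]; rewrite AE BE.
  rewrite h2 [cv _ (a _ _, aQ _ _)]h3 in h1.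
  have := cv_neq0 x (Wu t); have := cv_neq0 q.2 (Wu t).
  have := cv_neq0 x uu; have := cv_neq0 (a t^-1%g x) uu.
  have := cv_neq0 q uk; have := cv_neq0 (aQ t^-1%g q) uk; move: h1 c0.
  move: (cv (W t) x) (cv (W t) q.2) (cv u x) (cv u (a t^-1%g x)) (cv k q)
    (cv k (aQ t^-1%g q)) => w1 w2 u1 u2 k1 k2 h1 n0 n1 n2 n3 n4 n5 n6.
  have -> : w1 = w2 * (w1 * w2^-1) by field.
  by rewrite h1; field; rewrite ?n0 ?n1 ?n2 ?n3 ?n4 ?n5 ?n6.
have [x0 hx0] := ae_section (f := ccomp (mpres_fst mu nu).1 A)
  (h := ccomp (mpres_snd mu nu).1 B) AB.
exists (cv A x0).
have cA : {ae mu, forall x, cv A x = cv (ccst _ (cv A x0)) x}.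
  apply: (ae_pull (mpres_fst mu nu)).
  apply: filterS2 AB (ae_comp (mpres_snd mu nu) hx0) => -[x q] /= -> e.
  by rewrite cv_cst -[RHS]/(cv (ccomp (mpres_fst mu nu).1 A) (x0, q)) e.
by apply: filterS cA => x; rewrite cv_cst AE.
Qed.

End splitting.

(** * Stable cocycles are coboundaries *)

Section transfer.
Context (R : realType) (G : groupType) d (X0 : measurableType d).
Local Notation X := (bernoulli_space G X0).
Context (mu0 : probability X0 R) (mu : probability X R).
Hypothesis mu_prod : is_product_measure mu0 mu.
Local Notation act := (@bernoulli_action G d X0).
Local Notation Z := (X * (X * X))%type.
Local Notation muZ := ((mu \x (mu \x mu))%E : probability Z R).

(** Finite windows are those that the law of the random set describes. [f] is close in quadratic
    mean to its conditional expectation [a] on a finite [F], and [a] cannot tell noise in [F] from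
    noise in all of [G]; the quadratic triangle inequality costs the factor 2. *)
Lemma sens_full (A : set X0) (mA : measurable A) (f : cpx R X) (c : R) : cunit f ->
  (forall E : seq G, uniq E -> sens mu_prod mA [set` E] f <= c) ->
  sens mu_prod mA setT f <= 2 * c.
Proof.
move=> uf sc; have eq_le (x y : R) : x = y -> x <= y by move=> ->.
(* Each component of [f - a] has squared norm at most [2 e / 32], so [f - a] has at most [e / 8],
   and two such errors with coefficient 4 make [e]. *)
apply/ler_addgt0Pr => e e0; have e0' : 0 < e / 32 by rewrite divr_gt0.
have [F1 h1] := tail_approx mu_prod f.1 e0'; have [F2 h2] := tail_approx mu_prod f.2 e0'.
have {}h1 := h1 _ (fsubsetUl F1 F2); have {}h2 := h2 _ (fsubsetUr F1 F2).
set F := (F1 `|` F2)%fset in h1 h2; pose B := ~` [set` F]; pose a := cres mu B f.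
have small (g : bfun R X) : (forall x, `|g x| <= 1) ->
    Ex (mu \x mu)%E (babs (bcomp (mpres_fst mu mu).1 g - bcomp (mpres_mix mu_prod B).1 g)) <= e / 32 ->
    Ex mu ((g - res mu B g) * (g - res mu B g)) <= e / 16.
  move=> g1 hg; apply: le_trans (cres_sqr_le mu B g1) _.
  by have := le_trans (Ex_abs_res mu_prod B g) hg; move: (Ex _ _) => k; lra.
have fa : Ex mu (nsq (f - a)) <= e / 8.
  have e1 := small f.1 (fun x => (cunit_le uf x).1) h1.
  have e2 := small f.2 (fun x => (cunit_le uf x).2) h2.
  rewrite /nsq /cip ExD /=; move: e1 e2; move: (Ex _ _) (Ex _ _) => k k'; lra.
pose nF := noise A [set` F]; pose nT := noise (X0 := X0) (G := G) A setT.
have aFT z : a.1 (nF z) = a.1 (nT z) /\ a.2 (nF z) = a.2 (nT z).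
  have -> : nF z = mix B (nT z) (nF z).
    apply/funext => g; rewrite /mix; case: (boolP (g \in B)) => // gB.
    have gF : [set` F] g by apply: contrapT => ngF; move/negP: gB; apply; exact/mem_set.
    rewrite /nF /nT /noise /mix /marked; congr (if _ then _ else _).
    by apply/idP/idP => /set_mem [_ k]; apply/mem_set; split.
  by split; exact: res_mix.
have -> : 2 * c + e = 2 * c + (4 * (e / 8) + 4 * (e / 8)) by field.
apply: (@le_trans _ _ (2 * sens mu_prod mA [set` F] f +
  (4 * Ex muZ (bcomp (mpres_noise mu_prod [set` F] mA).1 (nsq (f - a))) +
   4 * Ex muZ (bcomp (mpres_noise mu_prod setT mA).1 (nsq (f - a)))))); last first.
  have eF := Ex_comp (mpres_noise mu_prod [set` F] mA) (nsq (f - a)).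
  have eT := Ex_comp (mpres_noise mu_prod setT mA) (nsq (f - a)).
  apply: lerD; first by apply: ler_wpM2l => //; exact: sc (fset_uniq F).
  by apply: lerD; apply: ler_wpM2l => //; [exact: le_trans (eq_le _ _ eF) fa|exact: le_trans (eq_le _ _ eT) fa].
have lin3 (h g1 g2 : bfun R Z) : 2 * Ex muZ h + (4 * Ex muZ g1 + 4 * Ex muZ g2) =
    Ex muZ (bcst Z 2 * h + (bcst Z 4 * g1 + bcst Z 4 * g2)).
  by rewrite -!ExZ -!ExD.
apply: (le_trans _ (eq_le _ _ (esym (lin3 _ _ _)))); apply: Ex_le => z.
have [a1 a2] := aFT z.
change (nsq (cx mu f - cnoise mu_prod mA setT f) z <=
  2 * nsq (cx mu f - cnoise mu_prod mA [set` F] f) z +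
  (4 * nsq (f - a) (nF z) + 4 * nsq (f - a) (nT z))).
rewrite !nsqE; change ((f.1 z.2.1 - f.1 (nT z)) ^+ 2 + (f.2 z.2.1 - f.2 (nT z)) ^+ 2 <=
  2 * ((f.1 z.2.1 - f.1 (nF z)) ^+ 2 + (f.2 z.2.1 - f.2 (nF z)) ^+ 2) +
  (4 * ((f.1 (nF z) - a.1 (nF z)) ^+ 2 + (f.2 (nF z) - a.2 (nF z)) ^+ 2) +
   4 * ((f.1 (nT z) - a.1 (nT z)) ^+ 2 + (f.2 (nT z) - a.2 (nT z)) ^+ 2))).
rewrite a1 a2.
have key (x y w k : R) : (x - w) ^+ 2 <= 2 * (x - y) ^+ 2 + (4 * (y - k) ^+ 2 + 4 * (w - k) ^+ 2).
  have p1 := sqr_ge0 ((x - y) - (y - w)); have p2 := sqr_ge0 ((y - k) + (w - k)).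
  rewrite -subr_ge0.
  have -> : 2 * (x - y) ^+ 2 + (4 * (y - k) ^+ 2 + 4 * (w - k) ^+ 2) - (x - w) ^+ 2 =
    ((x - y) - (y - w)) ^+ 2 + 2 * ((y - k) + (w - k)) ^+ 2 by ring.
  by rewrite addr_ge0 // mulr_ge0.
have re (x x' y y' w w' : R) : 2 * x + (4 * y + 4 * w) + (2 * x' + (4 * y' + 4 * w')) =
  2 * (x + x') + (4 * (y + y') + 4 * (w + w')) by ring.
have q1 := key (f.1 z.2.1) (f.1 (nF z)) (f.1 (nT z)) (a.1 (nT z)).
have q2 := key (f.2 z.2.1) (f.2 (nF z)) (f.2 (nT z)) (a.2 (nT z)).
by apply: le_trans (lerD q1 q2) _; rewrite re.
Qed.

Definition actZ (t : G) (z : Z) : Z := pact act (pact act act) t z.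

Lemma marked_act (A : set X0) (t : G) (v : X) (k : G) :
  (k \in marked A setT (act t v)) = ((t^-1 * k)%g \in marked A setT v).
Proof. by apply/idP/idP => /set_mem [_ h]; apply/mem_set; split. Qed.

Lemma noise_act (A : set X0) (t : G) (z : Z) :
  noise A setT (actZ t z) = act t (noise A setT z).
Proof. by apply/funext => k; rewrite /noise {1}/mix marked_act. Qed.

Lemma noiseswap_act (A : set X0) (t : G) (z : Z) :
  noiseswap A setT (actZ t z) = actZ t (noiseswap A setT z).
Proof.
rewrite /noiseswap /actZ /pact /mixswap /=; congr (_, (_, _));
by apply/funext => k; rewrite {1}/mix marked_act.
Qed.

(** Disjointness ensures that a coordinate with label in [A] was not exchanged by the swap over [D],
    so the second replacement still reads the original [y]. *)
Lemma noise_union (D A : set X0) (z : Z) : D `&` A = set0 ->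
  noise (D `|` A) setT z = noise A setT (noiseswap D setT z).
Proof.
move=> DA; apply/funext => k; rewrite /noise /noiseswap /mixswap /mix /marked /=.
have e (C : set X0) : (k \in [set: G] `&` [set g | C (z.1 g)]) = `[< C (z.1 k) >].
  by apply/idP/idP => [/set_mem [_ h]|/asboolP h]; [exact/asboolP|apply/mem_set; split].
rewrite (e (D `|` A)) !e (@asbool_or (D (z.1 k)) (A (z.1 k))).
have : ~~ (`[< D (z.1 k) >] && `[< A (z.1 k) >]).
  apply/negP => /andP[/asboolP h1 /asboolP h2].
  by have : (D `&` A) (z.1 k) by []; rewrite DA.
by case: `[< D (z.1 k) >]; case: `[< A (z.1 k) >].
Qed.

Context (H : groupType) (j : H -> G).
Hypothesis jM : forall s t, j (s * t)%g = (j s * j t)%g.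
Hypothesis jI : injective j.
Context (W : H -> cpx R X).
Hypothesis Wu : forall t, cunit (W t).
Hypothesis Wc : forall s t, {ae mu, forall x,
  cv (W (s * t)%g) x = cv (W s) x * cv (W t) (act (j s)^-1%g x)}.
Context (tau : nat -> H).
Hypothesis tau_inj : injective tau.

Let jV s : j s^-1%g = (j s)^-1%g.
Proof.
have j1 : j 1%g = 1%g by apply: (mulgI (j 1%g)); rewrite -jM !mulg1.
by apply: (mulgI (j s)); rewrite -jM !mulgV.
Qed.

Let aX (t : H) : X -> X := act (j t).
Let pX : pmp mu aX := fun t => mpres_act mu_prod (j t).

Let mixX : mixing pX.
Proof. by move=> th ith f g; apply: (mixing_bernoulli mu_prod (tau := j \o th)); exact: inj_comp. Qed.

Let aZ (t : H) : Z -> Z := pact aX (pact aX aX) t.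
Let pZ : pmp muZ aZ := pmp_prod pX (pmp_prod pX pX).

Let mixZ : mixing pZ.
Proof. by apply: mixing_prod => //; exact: mixing_prod. Qed.

(* Resampling the coordinates with label in [D] changes [W] by a coboundary. *)
Definition transfers (D : set X0) := exists f : cpx R Z, cunit f /\
  forall t, {ae muZ, forall z, cv (W t) z.2.1 * (cv (W t) (noise D setT z))^-1 =
    cv f z * (cv f (aZ t^-1%g z))^-1}.

Lemma transfers0 : transfers set0.
Proof.
have u1 : cunit ((1, 0) : cpx R Z) by move=> z; rewrite nsqE bfun1 bfun0 expr1n expr0n addr0.
exists (1, 0); split=> // t; apply: aeW => z.
have -> : noise set0 setT z = z.2.1.
  by apply/funext => k; rewrite /noise /mix; case: ifPn => // /set_mem [].
by rewrite !divff ?cv_neq0.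
Qed.

(** As the noise commutes with the action, the ratio [D t] is a cocycle on [Z]; for values of
    modulus one its mean has real part [1 - sens / 2], at least 1/2. *)
Lemma transfers_small (A : set X0) (mA : measurable A) :
  (forall t, sens mu_prod mA setT (W t) <= 1) -> transfers A.
Proof.
move=> sA; pose N := mpres_noise mu_prod setT mA; pose Px := mpres_x mu.
pose D t : cpx R Z := cmul (cx mu (W t)) (cconj (cnoise mu_prod mA setT (W t))).
have uN t : cunit (cnoise mu_prod mA setT (W t)) by exact: cunit_ccomp.
have DE t z : cv (D t) z = cv (W t) z.2.1 * (cv (W t) (noise A setT z))^-1.
  by rewrite cv_mul cv_conj.
have uD t : cunit (D t) by apply: cunit_cmul; [exact: cunit_ccomp|exact: cunit_cconj].
have aZM s t z : aZ (s * t)%g z = aZ s (aZ t z).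
  by rewrite /aZ /pact /aX jM /= !actM.
have Dc s t : {ae muZ, forall z, cv (D (s * t)%g) z = cv (D s) z * cv (D t) (aZ s^-1%g z)}.
  apply: filterS2 (ae_comp Px (Wc s t)) (ae_comp N (Wc s t)) => z h1 h2.
  rewrite !DE h1 h2 -/(noise A setT z).
  have -> : noise A setT (aZ s^-1%g z) = act (j s)^-1%g (noise A setT z).
    by rewrite -jV -noise_act.
  have -> : (aZ s^-1%g z).2.1 = act (j s)^-1%g z.2.1 by rewrite -jV.
  by rewrite invfM mulrACA.
have cD t : 2^-1 <= Ex muZ (D t).1.
  have h : sens mu_prod mA setT (W t) = 2 - 2 * Ex muZ (D t).1.
    rewrite /sens nsqB.
    have -> : nsq (cx mu (W t)) = 1 by apply: bfun_eq => z; exact: cunit_ccomp.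
    have -> : nsq (cnoise mu_prod mA setT (W t)) = 1 by apply: bfun_eq => z; exact: cunit_ccomp.
    have -> : cip (cx mu (W t)) (cnoise mu_prod mA setT (W t)) = (D t).1.
      by rewrite /cip /D /cmul /cconj /= mulrN opprK.
    rewrite ExB (ExD _ 1 1) (ExD _ (D t).1 (D t).1) Ex1; move: (Ex _ _) => k; ring.
  by have := sA t; rewrite h; move: (Ex _ _) => k; lra.
have c0 : (0 : R) < 2^-1 by [].
have [f [uf fD]] := coboundary aZM mixZ tau_inj uD Dc c0 cD.
exists f; split=> // t; apply: filterS (fD t) => z; rewrite DE => ->.
by rewrite mulfK // cv_neq0.
Qed.

(** The passage from [x] to its noise over the union goes through the noise over [D]. The second leg
    is the relation for [A] at the point [noiseswap D setT z], a map that preserves the measure and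
    commutes with the action. *)
Lemma transfers_union (D A : set X0) : measurable D -> D `&` A = set0 ->
  transfers D -> transfers A -> transfers (D `|` A).
Proof.
move=> mD DA [f [uf Hf]] [h [uh Hh]]; pose S := mpres_noiseswap mu_prod setT mD.
exists (cmul f (ccomp S.1 h)); split; first by apply: cunit_cmul => //; exact: cunit_ccomp.
move=> t; apply: filterS2 (Hf t) (ae_comp S (Hh t)) => z h1 h2.
rewrite !cv_mul noise_union //.
change (cv (ccomp S.1 h) z) with (cv h (noiseswap D setT z)).
change (cv (ccomp S.1 h) (aZ t^-1%g z)) with (cv h (noiseswap D setT (aZ t^-1%g z))).
have -> : noiseswap D setT (aZ t^-1%g z) = aZ t^-1%g (noiseswap D setT z).
  exact: noiseswap_act.
rewrite invfM mulrACA -h1 -h2 -[(noiseswap D setT z).2.1]/(noise D setT z).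
by rewrite mulrA divfK // cv_neq0.
Qed.

Lemma splitting_of_transfers : transfers setT ->
  exists u : cpx R X, cunit u /\ forall t, exists c : R[i],
    {ae mu, forall x, cv (W t) x * cv u (act (j t)^-1%g x) * (cv u x)^-1 = c}.
Proof.
move=> [f [uf Hf]].
have [|u [uu Hu]] := splitting mixX tau_inj Wu uf.
  move=> t; apply: filterS (Hf t) => z.
  (* With every label marked, the noise replaces [x] by [y] entirely. *)
  have -> // : noise setT setT z = z.2.2.
  by apply/funext => k; rewrite /noise /mix mem_set.
by exists u; split=> // t; have [c hc] := Hu t; exists c; rewrite -jV.
Qed.

End transfer.

(** Diffuseness gives each point a ball of measure at most [dl], and separability reduces these to
    countably many; the complements of finite unions decrease to the empty set, hence to measure
    0. *)
Lemma small_cover (R : realType) d (X0 : measurableType d) (mu0 : probability X0 R)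
    (dl : R) : standard_borel R X0 -> diffuse mu0 -> 0 < dl ->
  exists (A : nat -> set X0) (n : nat),
    [/\ forall i, measurable (A i), forall i, fine (mu0 (A i)) <= dl &
        fine (mu0 (~` \big[setU/set0]_(i < n) A i)) <= dl].
Proof.
move=> [dist [[d0 [dC dT]] _ [D cD densD] mE]] diff dl0.
have fin (S : set X0) : measurable S -> mu0 S \is a fin_num by exact: fin_num_measure.
have small (F : nat -> set X0) : (forall i, measurable (F i)) -> nonincreasing_seq F ->
    mu0 (\bigcap_n F n) = 0%E -> exists n, fine (mu0 (F n)) <= dl.
  move=> mF niF F0; have : mu0 \o F @ \oo --> 0%:E.
    rewrite -[0%:E]F0; apply: nonincreasing_cvg_mu => //; last exact: bigcap_measurable.
    by rewrite ltey_eq fin.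
  move=> /fine_cvgP[_ /cvgrPdist_le/(_ _ dl0)[n _ /(_ n (leqnn n))]].
  rewrite sub0r normrN => h; exists n; apply: le_trans h; exact: ler_norm.
have mball (y : X0) (r : R) : measurable [set z | dist y z < r].
  rewrite mE; apply: sub_sigma_algebra => x /= xy.
  exists (r - dist y x); first by rewrite subr_gt0.
  by move=> z /= xz; have := dT y x z; lra.
pose rad (m : nat) : R := m.+1%:R^-1.
have rad0 m : 0 < rad m by rewrite invr_gt0.
pose B y m := [set z : X0 | dist y z < rad m].
have dge0 x y : 0 <= dist x y.
  by have := dT x y x; rewrite (dC y x) (proj2 (d0 x x) erefl); move: (dist x y) => k; lra.
have rad_small (r : R) : 0 < r -> exists m, rad m < r.
  move=> r0; have x0 : 0 <= r^-1 by rewrite invr_ge0 ltW.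
  exists (Num.bound r^-1); rewrite /rad -[ltRHS]invrK ltf_pV2 ?posrE ?invr_gt0 //.
  by rewrite (lt_le_trans (archi_boundP x0)) // ler_nat.
have rad_le m n : (m <= n)%N -> rad n <= rad m by move=> mn; rewrite lef_pV2 ?posrE // ler_nat.
have ptB x : exists m, fine (mu0 (B x m)) <= dl.
  apply: (small (B x)) => [i||]; first exact: mball.
    apply/nonincreasing_seqP => n; apply/subsetPset => z /= h.
    by apply: lt_le_trans h _; exact: rad_le.
  rewrite (_ : \bigcap_n B x n = [set x]) //; apply/seteqP; split=> z /=.
    move=> h; apply/esym/d0/eqP; rewrite eq_le dge0 andbT leNgt; apply/negP => /rad_small[m hm].
    by have := h m I; rewrite /B /=; lra.
  by move=> -> m _; rewrite /B /= (proj2 (d0 x x) erefl).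
have /countable_injP[f finj] := cD.
pose e n := xget (point : X0) [set y | D y /\ f y = n].
have eD y : D y -> e (f y) = y.
  move=> Dy; have [De fe] : [set y' | D y' /\ f y' = f y] (e (f y)) by apply: xgetPex; exists y.
  by apply: finj => //; exact/mem_set.
(* The balls about [e n] with radius [rad m] are listed through a coding of pairs; those of measure
   above [dl], and numbers that code no pair, give the empty set. *)
pose A k := if (choice.unpickle k : option (nat * nat)%type) is Some (n, m) then
  if fine (mu0 (B (e n) m)) <= dl then B (e n) m else set0 else set0 : set X0.
have mA i : measurable (A i).
  by rewrite /A; case: (choice.unpickle _) => [[n m]|] //; case: ifP => _ //; exact: mball.
have A_le i : fine (mu0 (A i)) <= dl.
  rewrite /A; case: (choice.unpickle _) => [[n m]|]; last by rewrite measure0 /= ltW.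
  by case: ifP => // _; rewrite measure0 /= ltW.
have Acov x : exists k, A k x.
  (* [m' + 1 = 2 (m + 1)], so [rad m'] is half of [rad m]: about a point of [D] at distance less
     than [rad m'] from [x], the ball of that radius contains [x] and lies in [B x m]. *)
  have [m hm] := ptB x; pose m' := (m.+1).*2.-1.
  have m'E : rad m' + rad m' = rad m.
    rewrite /rad /m' prednK ?double_gt0 // -addnn natrD; field.
    by apply/andP; split; rewrite gt_eqF // ?addr_gt0.
  have [y Dy xy] := densD x (rad m') (rad0 _).
  exists (choice.pickle (f y, m')); rewrite /A choice.pickleK eD //.
  have sub : B y m' `<=` B x m.
    by move=> z /= yz; rewrite /B /= in yz *; have := dT x y z; lra.
  have -> : fine (mu0 (B y m')) <= dl.
    apply: le_trans hm; apply: fine_le; rewrite ?fin //; try exact: mball.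
    by apply: le_measure => //; rewrite inE; exact: mball.
  by rewrite /B /= dC.
have [|||n hn] := small (fun n => ~` \big[setU/set0]_(i < n) A i).
- by move=> i; apply: measurableC; exact: bigsetU_measurable.
- apply/nonincreasing_seqP => n; apply/subsetPset; apply: subsetC.
  by rewrite big_ord_recr /=; exact: subsetUl.
- rewrite (_ : \bigcap_n _ = set0) ?measure0 //; apply/seteqP; split=> // x h.
  have [k Ak] := Acov x; apply: (h k.+1 I); rewrite big_ord_recr /=; right; exact: Ak.
by exists A, n.
Qed.

Section stable.
Context (R : realType) (G : groupType) d (X0 : measurableType d).
Local Notation X := (bernoulli_space G X0).
Context (mu0 : probability X0 R) (mu : probability X R).
Hypothesis mu_prod : is_product_measure mu0 mu.
Hypotheses (std : standard_borel R X0) (diff : diffuse mu0).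
Context (H : groupType) (j : H -> G).
Hypothesis jM : forall s t, j (s * t)%g = (j s * j t)%g.
Hypothesis jI : injective j.
Context (W : H -> cpx R X).
Hypothesis Wu : forall t, cunit (W t).
Hypothesis Wc : forall s t, {ae mu, forall x,
  cv (W (s * t)%g) x = cv (W s) x * cv (W t) (@bernoulli_action G d X0 (j s)^-1%g x)}.
Context (tau : nat -> H).
Hypothesis tau_inj : injective tau.

(** The cover is made disjoint and added set by set; the differences and the remainder are small by
    monotonicity. [sens_full] turns the bound 1/2 into the bound 1 that [transfers_small]
    requires. *)
Lemma coboundary_of_stable (dl : R) : 0 < dl ->
  (forall (A : set X0) (mA : measurable A), fine (mu0 A) <= dl ->
     forall t (E : seq G), uniq E -> sens mu_prod mA [set` E] (W t) <= 2^-1) ->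
  exists u : cpx R X, cunit u /\ forall t, exists c : R[i], {ae mu, forall x,
    cv (W t) x * cv u (@bernoulli_action G d X0 (j t)^-1%g x) * (cv u x)^-1 = c}.
Proof.
move=> dl0 stab.
have [A [n [mA A_le Ac]]] := small_cover std diff dl0.
have small (S : set X0) : measurable S -> fine (mu0 S) <= dl -> transfers mu j W S.
  move=> mS S_le; apply: (transfers_small jM jI Wu Wc tau_inj (mu_prod := mu_prod) (mA := mS)) => t.
  have := sens_full (Wu t) (stab S mS S_le t); rewrite divff //; exact.
have le_sub (S S' : set X0) : measurable S -> measurable S' -> S `<=` S' ->
    fine (mu0 S') <= dl -> fine (mu0 S) <= dl.
  move=> mS mS' SS'; apply: le_trans; apply: fine_le; rewrite ?fin_num_measure //.
  by apply: le_measure => //; rewrite inE.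
have step k : transfers mu j W (\big[setU/set0]_(i < k) A i).
  elim: k => [|k IH]; first by rewrite big_ord0; exact: transfers0.
  have mk : measurable (\big[setU/set0]_(i < k) A i) by exact: bigsetU_measurable.
  set D := \big[setU/set0]_(i < k) A i in IH mk *.
  have -> : \big[setU/set0]_(i < k.+1) A i = D `|` (A k `\` D).
    by rewrite big_ord_recr /= setUDr setDv setD0.
  apply: (transfers_union mu_prod Wu mk) => //; first by rewrite setDE setICA setICr setI0.
  apply: small; first exact: measurableD.
  by apply: (le_sub _ (A k)) => //; exact: measurableD.
apply: (splitting_of_transfers mu_prod jM jI Wu tau_inj).
have mn : measurable (\big[setU/set0]_(i < n) A i) by exact: bigsetU_measurable.
rewrite -(setUCr (\big[setU/set0]_(i < n) A i)).
apply: (transfers_union mu_prod Wu mn) => //; first exact: setICr.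
by apply: small => //; exact: measurableC.
Qed.

End stable.

(** * Rigidity *)

Lemma infinite_injection (G : groupType) (A : set G) : infinite_set A ->
  exists tau : nat -> G, injective tau /\ forall n, A (tau n).
Proof.
move=> /infiniteP/(@pcard_leP _ (discrete_group G))[f]; exists f; split=> [m n e|n].
  by apply: (@inj _ _ setT f) e; exact/mem_set.
exact: funS.
Qed.

(** The uniform average is invariant. A nonamenable group is therefore infinite, which provides the
    injective sequence that the mixing arguments need. *)
Lemma amenable_finite (R : realType) (H : groupType) : finite_set [set: H] -> amenable R H.
Proof.
move=> /finite_seqP[s0 es0]; pose s := undup s0.
have sT h : h \in s by rewrite mem_undup; have : [set: H] h by []; rewrite es0.
have us : uniq s by exact: undup_uniq.
have n0 : 0 < (size s)%:R :> R.
  by rewrite ltr0n; case: (s) (sT 1%g).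
apply: amenable_of_mean; exists (fun f => (\sum_(h <- s) f h) / (size s)%:R); split; first split.
- by move=> c f g _ _; rewrite big_split /= -mulr_sumr mulrDl mulrA.
- by move=> f _ f0; rewrite divr_ge0 ?sumr_ge0 // ltW.
- by rewrite big_const_seq count_predT iter_addr_0 divff // gt_eqF.
move=> t f _; congr (_ / _).
rewrite -(big_map (fun h => t * h)%g predT f); apply: perm_big; apply: uniq_perm => //.
  by rewrite map_inj_uniq //; exact: mulgI.
by move=> h; rewrite sT; apply/mapP; exists (t^-1 * h)%g; rewrite ?mulVKg.
Qed.

Lemma normc_cv (R : realType) d (T : measurableType d) (f : cpx R T) x :
  cunit f -> Normc.normc (cv f x) = 1.
Proof. by move=> uf; have := uf x; rewrite nsqE /cv /= => ->; rewrite sqrtr1. Qed.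

Section rigidity.
Context (R : realType) (G : groupType) d (X0 : measurableType d).
Local Notation X := (bernoulli_space G X0).
Context (mu0 : probability X0 R) (mu : probability X R).
Hypothesis mu_prod : is_product_measure mu0 mu.
Local Notation act := (@bernoulli_action G d X0).
Context (W : G -> cpx R X).
Hypothesis Wu : forall t, cunit (W t).
Hypothesis Wc : forall s t, {ae mu, forall x,
  cv (W (s * t)%g) x = cv (W s) x * cv (W t) (act s^-1%g x)}.

Let cst_cocycle (t : G) := exists c : R[i], {ae mu, forall x, cv (W t) x = c}.

Let W0 t x : cv (W t) x != 0. Proof. exact: cv_neq0. Qed.

Lemma cst_cocycle_closed : group_closed (fun t : G => `[< cst_cocycle t >]).
Proof.
split.
  apply/asboolP; exists 1; apply: filterS (Wc 1%g 1%g) => x.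
  by rewrite invg1 act1 mulg1 -[X in X = _ -> _]mulr1 => /(mulfI (W0 _ _)).
move=> s t /asboolP[c hs] /asboolP[c' ht]; apply/asboolP; exists (c * c'^-1).
(* [W (s / t)] is found from the cocycle identity at [(s / t) t = s]. *)
have ht' := ae_comp (mpres_act mu_prod (s / t)^-1%g) ht.
apply: filterS3 hs ht' (Wc (s / t)%g t) => x e1 e2; rewrite mulgVK e1 e2 => ->.
by rewrite mulfK // -e2.
Qed.

(* If [k' = g k g^-1] with [k], [k'] in the subgroup where [W] is constant, then
   [W g] is multiplied by a scalar under [k']; mixing forces [W g] to be constant. *)
Lemma cst_cocycle_conj (g : G) :
  infinite_set ([set (g * k * g^-1)%g | k in [set k | cst_cocycle k]] `&`
    [set k | cst_cocycle k]) -> cst_cocycle g.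
Proof.
move=> /infinite_injection[tau [tau_inj tauK]].
pose tau' n := (tau n)^-1%g.
have tau'_inj : injective tau' by move=> m n /invg_inj/tau_inj.
(* The ratio of the values at two independent points cancels the unknown scalars, so it is
   invariant, hence constant; freezing one point then makes [W g] constant. *)
pose F := cmul (ccomp (mpres_fst mu mu).1 (W g)) (cconj (ccomp (mpres_snd mu mu).1 (W g))).
have FE p : cv F p = cv (W g) p.1 * (cv (W g) p.2)^-1.
  by rewrite cv_mul cv_conj //; exact: cunit_ccomp.
have pp := pmp_prod (mpres_act mu_prod) (mpres_act mu_prod).
have mixP := mixing_prod (mixing_bernoulli mu_prod) (mixing_bernoulli mu_prod).
have [n|z Fz] := ae_cst_of_invariant mixP tau'_inj (f := F).
  have [[k [c hk] ek] [c' hk']] := tauK n.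
  (* Two expansions of the cocycle at [g k = (g k g^-1) g]. *)
  have H : {ae mu, forall x, cv (W g) x * c = c' * cv (W g) (act (tau' n) x)}.
    have e2 := Wc (tau n) g; rewrite -ek mulgVK ek in e2.
    have h3 := ae_comp (mpres_act mu_prod g^-1%g) hk.
    apply: filterS3 (Wc g k) e2 (filterI hk' h3) => x e1 e3 [e4 e5].
    by rewrite -e4 -e3 e1 e5.
  have c0 : c != 0 by have [x <-] := ae_exists hk.
  have c'0 : c' != 0 by have [x <-] := ae_exists hk'.
  apply: filterS2 (ae_comp (mpres_fst mu mu) H) (ae_comp (mpres_snd mu mu) H) => -[x y] /= h1 h2.
  rewrite !FE /=; have -> : cv (W g) (act (tau' n) x) = c'^-1 * (cv (W g) x * c).
    by rewrite h1 mulKf.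
  have -> : cv (W g) (act (tau' n) y) = c'^-1 * (cv (W g) y * c) by rewrite h2 mulKf.
  have := W0 g x; have := W0 g y; move: (cv _ x) (cv _ y) => a b a0 b0.
  by field; rewrite ?c0 ?c'0 ?a0 ?b0.
have Fz' : {ae ((mu \x mu)%E : probability (X * X)%type R), forall p, cv F p = cv (ccst _ z) p}.
  by apply: (@filterS _ _ (ae_filter_ringOfSetsType _) _ _ _ Fz) => p; rewrite cv_cst.
have [x hx] := ae_section Fz'.
exists (cv (W g) x / z); apply: filterS hx => y; rewrite cv_cst FE /= => <-.
by rewrite invf_div mulrC divfK.
Qed.

Lemma character_of_wq_normal (S : {pred G}) : wq_normal S ->
  (forall t, t \in S -> cst_cocycle t) ->
  exists2 chi : G -> R[i], is_character chi &
    forall t, {ae mu, forall x, cv (W t) x = chi t}.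
Proof.
move=> wS SK; have all_cst t : cst_cocycle t.
  apply: contrapT => nt.
  have [||g /negP gK] := wS _ cst_cocycle_closed.
  - by move=> s /SK sK; apply/asboolP.
  - by exists t; apply/negP => /asboolP.
  rewrite (_ : [set` _] = [set k | cst_cocycle k]); last first.
    by apply/seteqP; split=> k /asboolP.
  by move=> /cst_cocycle_conj gc; apply: gK; apply/asboolP.
have /choice[chi hchi] := all_cst.
exists chi => //; split=> [t|s t].
  by have [x <-] := ae_exists (hchi t); exact: normc_cv.
have H : {ae mu, forall x, chi (s * t)%g = chi s * chi t}.
  apply: filterS3 (hchi (s * t)%g) (Wc s t)
    (filterI (hchi s) (ae_comp (mpres_act mu_prod s^-1%g) (hchi t))).
  by move=> x <- -> [-> ->].
by have [x] := ae_exists H.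
Qed.

End rigidity.

Lemma twist_cocycle (R : realType) (G : groupType) d (X0 : measurableType d)
    (mu0 : probability X0 R) (mu : probability (bernoulli_space G X0) R)
    (mu_prod : is_product_measure mu0 mu) (W : G -> cpx R (bernoulli_space G X0))
    (u : cpx R (bernoulli_space G X0)) :
  (forall t, cunit (W t)) -> cunit u ->
  (forall s t, {ae mu, forall x,
     cv (W (s * t)%g) x = cv (W s) x * cv (W t) (@bernoulli_action G d X0 s^-1%g x)}) ->
  exists W' : G -> cpx R (bernoulli_space G X0), [/\ forall t, cunit (W' t),
    (forall s t, {ae mu, forall x,
       cv (W' (s * t)%g) x = cv (W' s) x * cv (W' t) (@bernoulli_action G d X0 s^-1%g x)}) &
    forall t x, cv (W' t) x =
      cv (W t) x * cv u (@bernoulli_action G d X0 t^-1%g x) * (cv u x)^-1].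
Proof.
move=> Wu uu Wc.
exists (fun t => cmul (cmul (W t) (cact mu_prod t u)) (cconj u)).
have E t x : cv (cmul (cmul (W t) (cact mu_prod t u)) (cconj u)) x =
    cv (W t) x * cv u (@bernoulli_action G d X0 t^-1%g x) * (cv u x)^-1.
  by rewrite cv_mul cv_conj.
split=> // [t|s t].
  apply: cunit_cmul; last exact: cunit_cconj.
  by apply: cunit_cmul => //; exact: cunit_ccomp.
apply: filterS (Wc s t) => x e; rewrite !E e invgM actM.
have := cv_neq0 (@bernoulli_action G d X0 s^-1%g x) uu; have := cv_neq0 x uu.
move: (cv (W s) x) (cv (W t) _) (cv u x) (cv u (bernoulli_action s^-1%g x))
  (cv u (bernoulli_action t^-1%g _)) => a b c1 c2 c3 n1 n2.
by field; rewrite n1 n2.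
Qed.

Lemma bfun_of_cocycle (R : realType) d (T : measurableType d) (f : T -> R[i]) :
  cmeasurable f -> (forall x, circle (f x)) ->
  exists F : cpx R T, cunit F /\ forall x, cv F x = f x.
Proof.
move=> [m1 m2] f1.
have f1' x : complex.Re (f x) ^+ 2 + complex.Im (f x) ^+ 2 = 1.
  by rewrite -normc_sq (f1 x) expr1n.
have b1 : (fun x => complex.Re (f x)) \in @bmeas R _ T.
  apply/bmeasP; split=> //; exists 1 => x.
  by rewrite -(@ler_pXn2r _ 2) ?nnegrE // expr1n real_normK ?num_real // -(f1' x) lerDl sqr_ge0.
have b2 : (fun x => complex.Im (f x)) \in @bmeas R _ T.
  apply/bmeasP; split=> //; exists 1 => x.
  by rewrite -(@ler_pXn2r _ 2) ?nnegrE // expr1n real_normK ?num_real // -(f1' x) lerDr sqr_ge0.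
exists (BFun b1, BFun b2); split=> x; first by rewrite nsqE /=; exact: f1'.
by rewrite /cv /=; case: (f x).
Qed.

Lemma enumeration (G : groupType) : countable [set: G] ->
  exists e : nat -> G, forall g, exists n, e n = g.
Proof.
move=> /countable_injP[f fI]; exists (fun n => xget 1%g [set g | f g = n]) => g.
exists (f g); have fg : f (xget 1%g [set g' | f g' = f g]) = f g by apply: (@xgetPex _ 1%g [set g' | f g' = f g]); exists g.
by apply: fI => //; exact/mem_set.
Qed.

Theorem theorem1p2 (R : realType) (G : groupType) (d : measure_display)
    (X0 : measurableType d) (mu0 : probability X0 R)
    (mu : probability (bernoulli_space G X0) R) :
  countable [set: G] ->
  standard_borel R X0 -> diffuse mu0 -> is_product_measure mu0 mu ->
  exact_group R G ->
  (exists (S : {pred G}) (L : subGroupType S),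
    [/\ ~ amenable R L, ~ properly_proximal R L & wq_normal S]) ->
  circle_cocycle_superrigid (@bernoulli_action G d X0) mu.
Proof.
move=> cG std diff mu_prod _ [S [L [nam npp wq]]] w [mw w1 wc].
pose act := @bernoulli_action G d X0.
have wact t : cmeasurable (fun x => w t (act t^-1%g x)).
  have m : measurable_fun setT (fun x : bernoulli_space G X0 =>
      ((t : discrete_group G), act t^-1%g x)).
    apply: measurable_fun_pair; first exact: measurable_cst.
    exact: (mpres_act mu_prod t^-1%g).1.
  by split; [exact: (measurableT_comp mw.1 m)|exact: (measurableT_comp mw.2 m)].
have /choice[W WE] : forall t, exists F : cpx R (bernoulli_space G X0),
    cunit F /\ forall x, cv F x = w t (act t^-1%g x).
  by move=> t; apply: bfun_of_cocycle => // x; exact: w1.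
have Wu t : cunit (W t) by have [] := WE t.
have {}WE t x : cv (W t) x = w t (act t^-1%g x) by have [] := WE t.
have Wc s t : {ae mu, forall x, cv (W (s * t)%g) x = cv (W s) x * cv (W t) (act s^-1%g x)}.
  apply: filterS (ae_comp (mpres_act mu_prod (s * t)^-1%g) (wc s t)) => x.
  by rewrite !WE => ->; rewrite invgM actM /act actVK.
pose j : L -> G := val.
have jM s t : j (s * t)%g = (j s * j t)%g by exact: valM.
have jI : injective j by exact: val_inj.
have cL : countable [set: L].
  have [f fI] := countable_injP _ cG; apply/countable_injP; exists (f \o j) => s t _ _.
  by move=> /fI/jI; apply; exact/mem_set.
have [tau [tau_inj _]] : exists tau : nat -> L, injective tau /\ forall n, setT (tau n).
  apply: infinite_injection; apply: contra_not nam; exact: amenable_finite.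
have [u [uu uc]] : exists u : cpx R (bernoulli_space G X0), cunit u /\ forall t : L,
    exists c : R[i], {ae mu, forall x,
      cv (W (j t)) x * cv u (act (j t)^-1%g x) * (cv u x)^-1 = c}.
  have Wcj s t : {ae mu, forall x, cv (W (j (s * t)%g)) x =
      cv (W (j s)) x * cv (W (j t)) (act (j s)^-1%g x)} by rewrite jM.
  have [NT|NT] := pselect (forall dl : R, 0 < dl -> exists (A : set X0) (mA : measurable A),
     fine (mu0 A) <= dl /\ exists (t : L) (E : seq G),
       uniq E /\ 2^-1 <= sens mu_prod mA [set` E] (W (j t))).
    exfalso; apply: nam.
    apply: (@amenable_of_unbounded _ _ _ _ _ _ mu_prod _ j jM jI (W \o j) _ _
      (enumeration cG) (enumeration cL) 2^-1 _ NT (contrapT npp)) => //; first by move=> t; exact: Wu.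
    move=> s t; apply: (cv_ae mu (W (j (s * t)%g)) (cmul (W (j s)) (cact mu_prod (j s) (W (j t))))).1.
    exact: Wcj.
  have [dl [dl0 stab]] : exists dl : R, 0 < dl /\ forall (A : set X0) (mA : measurable A),
     fine (mu0 A) <= dl -> forall (t : L) (E : seq G), uniq E ->
       sens mu_prod mA [set` E] (W (j t)) <= 2^-1.
    apply: contrapT => H; apply: NT => dl dl0; apply: contrapT => H'; apply: H.
    exists dl; split=> // A mA Ad t E uE; rewrite leNgt; apply/negP => /ltW h; apply: H'.
    by exists A, mA; split=> //; exists t, E.
  exact: (@coboundary_of_stable _ _ _ _ _ _ mu_prod std diff _ j jM jI (W \o j)
    (fun t => Wu (j t)) Wcj tau tau_inj dl dl0 stab).
have [W' [W'u W'c W'E]] := twist_cocycle mu_prod Wu uu Wc.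
have W'L t : t \in S -> exists c : R[i], {ae mu, forall x, cv (W' t) x = c}.
  move=> tS; have [c hc] := uc (Sub t tS); exists c; apply: filterS hc => x.
  by rewrite W'E /j SubK.
have [chi hchi W'chi] := character_of_wq_normal mu_prod W'u W'c wq W'L.
exists chi => //; exists (cv u); split=> [|x|t].
- by split; exact: measurable_bfun.
- exact: normc_cv.
(* Evaluation at [act t x] undoes the shift in [W t x = w t (act t^-1 x)]. *)
apply: filterS (ae_comp (mpres_act mu_prod t) (W'chi t)) => x.
rewrite W'E WE /act actK => <-; have := cv_neq0 x uu; have := cv_neq0 (act t x) uu.
rewrite /act; move: (cv u x) (cv u _) (w t x) => a b c b0 a0.
by field; rewrite a0 b0.
Qed.
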